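(* Let $W$ be the vertex subalgebra of the $A_1$ lattice vertex operator algebra $V_{A_1}$ generated by $e^\alpha$, and let $C=\mathrm{Com}(W,V_{A_1})$. Then $(W,C)$ is a dual pair in $V_{A_1}$: $\mathrm{Com}(C,V_{A_1})=W$ and $\mathrm{Com}(W,V_{A_1})=C$.
   Context: $A_1=\mathbb{Z}\alpha$ with $(\alpha,\alpha)=2$; $V_{A_1}=\bigoplus_{n\in\mathbb{Z}}M(1,n\alpha)$ is the lattice vertex operator algebra built on Heisenberg Fock modules $M(1,n\alpha)$, with vertex operators $Y(e^\beta,z)=e^\beta(z)$ for $\beta\in A_1$. For a vertex subalgebra $U\subset V$, $\mathrm{Com}(U,V)=\{v\in V\mid [u(n),v(m)]=0 \text{ for all } u\in U,\ n,m\in\mathbb{Z}\}$, where $Y(v,z)=\sum_n v(n)z^{-n-1}$. *)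

(* Defs.v *)
From HB Require Import structures.
From mathcomp Require Import all_boot all_algebra.
From mathcomp Require complex Rstruct.
Import Rstruct complex.ComplexField.
Set Implicit Arguments. Unset Strict Implicit. Unset Printing Implicit Defensive.
Import GRing.Theory Num.Theory.
Local Open Scope ring_scope.

Definition Cx : fieldType := complex.complex Rdefinitions.R.

(* ---------- basis of V_{A_1} ----------
   A basis vector  alpha(-1)^{e_0} alpha(-2)^{e_1} ... alpha(-k)^{e_{k-1}} e^{n alpha}
   (a PBW monomial in M(1, n alpha)) is encoded by the key (n, e) with
   n : int and e : seq nat the exponent vector (trailing zeros are irrelevant). *)
Definition key := (int * seq nat)%type.

(* A vector of V_{A_1} is a finite formal linear combination of keys. *)
Definition vec := seq (Cx * key).

Definition eqexp (e e' : seq nat) : bool :=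
  all (fun i => nth 0%N e i == nth 0%N e' i) (iota 0 (maxn (size e) (size e'))).

Definition coef (v : vec) (k : key) : Cx :=
  \sum_(x <- v | (x.2.1 == k.1) && eqexp x.2.2 k.2) x.1.

Definition veq (v w : vec) : Prop := forall k, coef v k = coef w k.

Definition vzero : vec := [::].
Definition vadd (v w : vec) : vec := v ++ w.
Definition vscale (c : Cx) (v : vec) : vec := [seq (c * y.1, y.2) | y <- v].

Definition lift (f : key -> vec) (v : vec) : vec :=
  flatten [seq vscale x.1 (f x.2) | x <- v].

(* ---------- Heisenberg modes alpha(j), (alpha,alpha) = 2 ---------- *)
Definition heis (j : int) (w : key) : vec :=
  if (j < 0)%R then [:: (1, (w.1, incr_nth w.2 ((absz j).-1)))]
  else if j == 0 then [:: ((2 * w.1)%:~R, w)]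
  else let k := absz j in let c := nth 0%N w.2 k.-1 in
       [:: ((2 * k * c)%:R, (w.1, set_nth 0%N w.2 k.-1 c.-1))].

Definition wdeg (e : seq nat) : nat := \sum_(0 <= i < size e) (i.+1 * nth 0%N e i)%N.
Definition wt (k : key) : int := (wdeg k.2)%:Z + k.1 * k.1.

Definition subvecs (e : seq nat) : seq (seq nat) :=
  foldr (fun x acc => [seq y :: t | y <- iota 0 x.+1, t <- acc]) [:: [::]] e.

Definition parts (N : nat) : seq (seq nat) :=
  [seq b <- subvecs [seq (N %/ i.+1)%N | i <- iota 0 N] | wdeg b == N].

Definition combexp (e a b : seq nat) : seq nat :=
  mkseq (fun i => nth 0%N e i - nth 0%N a i + nth 0%N b i)%N (maxn (size e) (size b)).

(* ---------- modes of Y(e^{p alpha}, z) ----------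
   Y(e^{beta},z) = E^-(-beta,z) E^+(-beta,z) e_beta z^{beta}, with trivial
   cocycle (legitimate since all (beta,gamma) are even for A_1).  On
   f(x) e^{n alpha}, with x_k <-> alpha(-k), this is
   exp(sum_k p x_k z^k / k) f(x_k - 2p z^{-k}) z^{2pn} e^{(n+p) alpha}.
   emode p m w is the coefficient of z^{-m-1}. *)
Definition emode (p m : int) (w : key) : vec :=
  let n := w.1 in let e := w.2 in
  flatten [seq
    (let Nz := - m - 1 - 2 * p * n + (wdeg a)%:Z in
     if (Nz < 0)%R then [::] else
     [seq (((\prod_(0 <= i < size a) (('C(nth 0%N e i, nth 0%N a i))%:R
                             * ((- 2 * p)%:~R) ^+ nth 0%N a i))
           * (\prod_(0 <= i < size b) ((p%:~R / (i.+1)%:R) ^+ nth 0%N b i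
                                  / ((nth 0%N b i)`!)%:R))),
           (n + p, combexp e a b))
     | b <- parts (absz Nz)])
  | a <- subvecs e].

Definition modes (e : seq nat) : seq nat :=
  flatten [seq nseq (nth 0%N e i) i.+1 | i <- iota 0 (size e)].

(* ---------- modes of Y(v,z) for a basis vector v ----------
   v = alpha(-k) b  with  b = alpha(-l) e^{n alpha}; iterate formula
   (a_{(-k)} b)_{(m)} = sum_{i>=0} C(k+i-1,i) [ a_{(-k-i)} b_{(m+i)}
                                           - (-1)^k b_{(m-k-i)} a_{(i)} ]
   with a = alpha(-1)1, a_{(j)} = alpha(j).  The sum over i is finite on each
   w: terms vanish once i > size w.2 and m+i >= wt b + wt w (all weights of
   V_{A_1} are >= 0). *)
Fixpoint Ymode (l : seq nat) (n m : int) (w : key) {struct l} : vec :=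
  match l with
  | [::] => emode n m w
  | k :: l' =>
    let bnd := (size w.2 + absz ((sumn l')%:Z + n * n + wt w - m)%R).+1%N in
    flatten [seq
      vadd (vscale ('C(k + i - 1, i))%:R
              (lift (heis (- (k + i)%:Z)) (Ymode l' n (m + i%:Z) w)))
           (vscale (- ((-1) ^+ k * ('C(k + i - 1, i))%:R))
              (lift (Ymode l' n (m - k%:Z - i%:Z)) (heis i%:Z w)))
    | i <- iota 0 bnd]
  end.

Definition mode (v : vec) (m : int) (w : vec) : vec :=
  flatten [seq vscale x.1 (lift (Ymode (modes x.2.2) x.2.1 m) w) | x <- v].

Definition vacuum : vec := [:: (1, (0%:Z, [::]))].
Definition e_alpha : vec := [:: (1, (1%:Z, [::]))].

(* subsets of V_{A_1} (as predicates on representatives) *)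
Definition vsubspace (P : vec -> Prop) : Prop :=
  [/\ forall v w, P v -> veq v w -> P w,
      P vzero,
      forall v w, P v -> P w -> P (vadd v w)
    & forall c v, P v -> P (vscale c v)].

Definition gen_subalg (S : vec -> Prop) (v : vec) : Prop :=
  forall P : vec -> Prop, vsubspace P -> P vacuum ->
    (forall u, S u -> P u) ->
    (forall u w n, P u -> P w -> P (mode u n w)) -> P v.

Definition Com (U : vec -> Prop) (v : vec) : Prop :=
  forall u, U u -> forall (n m : int) (w : vec),
    veq (mode u n (mode v m w)) (mode v m (mode u n w)).

Definition W : vec -> Prop := gen_subalg (fun u => veq u e_alpha).
Definition Cc : vec -> Prop := Com W.

(* Main.v *)
Require Import Defs.
From HB Require Import structures.
From mathcomp Require Import all_boot all_order all_algebra.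
From mathcomp Require complex Rstruct.
From mathcomp Require Import finmap monalg.
From mathcomp Require Import zify ring.
From Stdlib Require Import ClassicalEpsilon FunctionalExtensionality.
Import Rstruct complex.ComplexField.
Set Implicit Arguments. Unset Strict Implicit. Unset Printing Implicit Defensive.
Import Order.TTheory GRing.Theory Num.Theory.
Local Open Scope ring_scope.

(* A vector of charge r is f(x) e^{r alpha}, with x_k standing for alpha(-k).  Put
   S_s(z) = exp(s sum_k x_k z^k / k), let Q_s(z) be the shift x_k -> x_k - 2 s z^{-k}, and let
   h_k be the coefficient of z^k in S_1.  The products h_{k_1} ... h_{k_n} e^{n alpha} lie
   in W: e^alpha(z) multiplies the generating function h(t_1) ... h(t_n) by
   h(z) prod_i (z - t_i)^2, and the factors (z - t_i)^2 can be divided out recursively.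
   Let D_n be the span of the products of length n.

   The test vectors are c^N = (coefficient of z^N in S_{1/2}) e^alpha.  Their vertex
   operators are residues of the bilocal field C(y_1, y_2), the normally ordered product
   of the two half-lattice operators S_{1/2}(y_i) Q_{1/2}(y_i).  Moving C past the vertex
   operator of h(t_1) ... h(t_n) e^{n alpha} produces prod_i (y_1 - t_i)(y_2 - t_i) on either
   side, so the c^N commute with D_n.  Conversely, let Z be the set of v annihilated by all
   c^N_i with i >= 0.  Looking at the lowest power of y_1 in C v shows that Q_{1/2}(y)
   has degree at most r in 1/y on the component of charge r of v, and this degree bound
   characterizes D_r (and forces the component to vanish for r < 0).
   Hence Z lies in the sum of the D_n, is closed under modes, and contains e^alpha, so that
   W is contained in Z and c^N belongs to Com W.  Therefore Com (Com W) is contained in Z,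
   hence in the sum of the D_n, hence in W. *)

(** * Finitely supported sums over the integers *)

(** Cutting alpha into two halves is what makes the test vectors commute with W. A half-lattice
    operator pairs with e^alpha to (alpha/2, alpha) = 1, so moving it past e^alpha(t) costs one
    factor y - t, whose sign depends on the side. A pair of them costs (y_1 - t)(y_2 - t) on both
    sides and commutes exactly. The exponents being positive, no expansion of a negative power of
    y_i - t enters, and every commutation is an identity between finite sums of coefficients. On
    charge r a half operator carries y^r, since (alpha/2, r alpha) = r, and normal ordering drops
    the factor (y_1 - y_2)^(1/2); so no fractional powers occur.

    C itself is never computed: the family c^N is large enough to force Z into the sum of the D_n.
    That description of Z has to precede the inclusion of W in Z, because closure of Z under modes
    relies on the commutation known only for the D_n. *)

Section FiniteSupportSums.
Variable V : zmodType.
Implicit Types F G : int -> V.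

Definition vanish_beyond F (N : nat) := forall i : int, (N <= `|i|)%N -> F i = 0.
Definition fsupp F := exists N, vanish_beyond F N.
Definition fsupp2 (F : int -> int -> V) :=
  exists N : nat, forall i j : int, (N <= `|i|)%N || (N <= `|j|)%N -> F i j = 0.

(* Meaningful for finitely supported [F] only: [epsilon] picks a bound on the support. *)
Definition lsum F : V :=
  let N := epsilon (inhabits 0%N) (vanish_beyond F) in
  \sum_(k < N.*2.+1) F (k%:Z - N%:Z).

Lemma sum_subrange F (lo lo' : int) (n n' : nat) :
  lo' <= lo -> lo + n%:Z <= lo' + n'%:Z ->
  (forall i, (i < lo) || (lo + n%:Z <= i) -> F i = 0) ->
  \sum_(k < n') F (lo' + k%:Z) = \sum_(k < n) F (lo + k%:Z).
Proof.
move=> hlo hhi F0; rewrite -!(big_mkord xpredT (fun k => F (_ + k%:Z))).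
pose a := `|lo - lo'|%N.
rewrite (@big_cat_nat _ _ _ a) //=; last by lia.
rewrite big_nat big1 ?add0r; last by move=> i hi; apply: F0; lia.
rewrite (@big_cat_nat _ _ _ (a + n)%N) //=; [|by lia..].
rewrite [X in _ + X]big_nat [X in _ + X]big1 ?addr0; last by move=> i hi; apply: F0; lia.
rewrite -{1}[a]add0n [X in index_iota _ X]addnC big_addn addnK.
by apply: eq_bigr => i _; congr F; lia.
Qed.

Lemma lsum_range F (lo : int) (n : nat) :
  (forall i, (i < lo) || (lo + n%:Z <= i) -> F i = 0) ->
  lsum F = \sum_(k < n) F (lo + k%:Z).
Proof.
move=> F0; rewrite /lsum; set M := epsilon _ _.
have M0 : vanish_beyond F M.
  by apply: epsilon_spec; exists (`|lo| + n + 1)%N => i hi; apply: F0; lia.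
under eq_bigr do rewrite addrC.
pose K := (`|lo| + n + M)%N.
rewrite -(@sum_subrange F (- M%:Z) (- K%:Z) M.*2.+1 K.*2.+1); first last.
- by move=> i hi; apply: M0; lia.
- by lia.
- by lia.
by rewrite (@sum_subrange F lo (- K%:Z) n) //; lia.
Qed.

Lemma fsuppI F (lo hi : int) :
  (forall i, i < lo -> F i = 0) -> (forall i, hi < i -> F i = 0) -> fsupp F.
Proof.
move=> Flo Fhi; exists (`|lo| + `|hi| + 1)%N => i hN.
have [/Flo//|] : i < lo \/ hi < i by lia.
exact: Fhi.
Qed.

Lemma fsupp2I (F : int -> int -> V) (lo hi lo' hi' : int) :
  (forall i j, i < lo -> F i j = 0) -> (forall i j, hi < i -> F i j = 0) ->
  (forall i j, j < lo' -> F i j = 0) -> (forall i j, hi' < j -> F i j = 0) ->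
  fsupp2 F.
Proof.
move=> h1 h2 h3 h4; exists (`|lo| + `|hi| + `|lo'| + `|hi'| + 1)%N => i j hN.
have [] : (i < lo \/ hi < i) \/ (j < lo' \/ hi' < j) by lia.
  by case=> [/h1|/h2].
by case=> [/h3|/h4].
Qed.

Lemma eq_lsum F G : F =1 G -> lsum F = lsum G.
Proof. by move/functional_extensionality=> ->. Qed.

Lemma lsum0 F : (forall i, F i = 0) -> lsum F = 0.
Proof. by move=> F0; rewrite (@lsum_range F 0 0) ?big_ord0. Qed.

Lemma lsum_window F N : vanish_beyond F N ->
  lsum F = \sum_(k < N.*2.+1) F (- N%:Z + k%:Z).
Proof. by move=> F0; apply: lsum_range => i hi; apply: F0; lia. Qed.

Lemma lsum1 F i0 : (forall i, i != i0 -> F i = 0) -> lsum F = F i0.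
Proof.
move=> F0; rewrite (@lsum_range F i0 1) ?big_ord1 ?addr0 // => i hi.
by apply: F0; lia.
Qed.

Lemma lsumD F G : fsupp F -> fsupp G -> lsum (fun i => F i + G i) = lsum F + lsum G.
Proof.
move=> [N FN] [M GM]; pose K := maxn N M.
have FK : vanish_beyond F K by move=> i hi; apply: FN; lia.
have GK : vanish_beyond G K by move=> i hi; apply: GM; lia.
rewrite (lsum_window FK) (lsum_window GK) -big_split; apply: lsum_window => i hi.
by rewrite FK ?GK ?addr0.
Qed.

Lemma lsum_shift F k : fsupp F -> lsum (fun i => F (i + k)) = lsum F.
Proof.
move=> [N FN]; rewrite (lsum_window FN) (@lsum_range _ (- N%:Z - k) N.*2.+1).
  by apply: eq_bigr => i _; congr F; lia.
by move=> i hi; apply: FN; lia.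
Qed.

Lemma exchange_lsum (F : int -> int -> V) : fsupp2 F ->
  lsum (fun i => lsum (fun j => F i j)) = lsum (fun j => lsum (fun i => F i j)).
Proof.
move=> [N FN].
rewrite (@lsum_window _ N); last first.
  by move=> i hi; apply: lsum0 => j; apply: FN; rewrite hi.
rewrite (@lsum_window (fun j => lsum (F^~ j)) N); last first.
  by move=> j hj; apply: lsum0 => i; apply: FN; rewrite hj orbT.
have FE i : lsum (F i) = \sum_(k < N.*2.+1) F i (- N%:Z + k%:Z).
  by apply: lsum_window => j hj; apply: FN; rewrite hj orbT.
have FE' j : lsum (F^~ j) = \sum_(k < N.*2.+1) F (- N%:Z + k%:Z) j.
  by apply: (@lsum_window (F^~ j)) => i hi; apply: FN; rewrite hi.
under eq_bigr do rewrite FE.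
by rewrite exchange_big; apply: eq_bigr => j _; rewrite FE'.
Qed.
End FiniteSupportSums.

Lemma raddf_lsum (V V' : zmodType) (A : {additive V -> V'}) (F : int -> V) :
  fsupp F -> A (lsum F) = lsum (fun i => A (F i)).
Proof.
move=> [N FN]; rewrite (lsum_window FN) raddf_sum (@lsum_window _ _ N) //.
by move=> i hi; rewrite FN ?raddf0.
Qed.

(** * Polynomials in the creation operators *)

Record free_module (F : fieldType) (K : choiceType) := FreeModule {
  fcar :> lmodType F;
  fmon : K -> fcar;
  fcoef : K -> fcar -> F;
  fsuppo : fcar -> seq K;
  fcoefP : forall c a f g, fcoef c (a *: f + g) = a * fcoef c f + fcoef c g;
  fcoef_mon : forall c c', fcoef c' (fmon c) = (c == c')%:R;
  fsuppo_uniq : forall f, uniq (fsuppo f);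
  mem_fsuppo : forall f c, (c \in fsuppo f) = (fcoef c f != 0);
  fexpand : forall f, f = \sum_(c <- fsuppo f) fcoef c f *: fmon c
}.

(* Opaque on purpose: unfolding the scaling of finitely supported functions
   during unification is prohibitively expensive. *)
Lemma free_mod (F : fieldType) (K : choiceType) : free_module F K.
Proof.
have scale_malgU (a : F) (c : K) : << a *g c >> = a *: << c >> :> {malg F[K]}.
  by apply/malgP => k; rewrite mcoeffZ !mcoeffU mulrnAr mulr1.
apply: (@FreeModule F K {malg F[K]} (fun c => << c >>) (fun c f => f@_c)
         (fun f => finmap.enum_fset (msupp f))).
- by move=> c a f g; rewrite mcoeffD mcoeffZ.
- by move=> c c'; rewrite mcoeffU.
- by move=> f; apply: fset_uniq.
- by move=> f c; rewrite mcoeff_neq0.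
- by move=> f; rewrite {1}(monalgE f); apply: eq_bigr => c _; rewrite scale_malgU.
Qed.

Section LinearExtension.
Variables (F : fieldType) (K : choiceType).
Local Notation R := (fcar (free_mod F K)).
Implicit Types (c : K) (a : F) (f g : R).

Definition mon c : R := fmon (free_mod F K) c.
Definition mcoef c f : F := fcoef c f.
Definition supp f : seq K := fsuppo f.

Lemma mcoefP c a f g : mcoef c (a *: f + g) = a * mcoef c f + mcoef c g.
Proof. exact: fcoefP. Qed.

Lemma mcoef_mon c c' : mcoef c' (mon c) = (c == c')%:R.
Proof. exact: fcoef_mon. Qed.

Lemma supp_uniq f : uniq (supp f).
Proof. exact: fsuppo_uniq. Qed.

Lemma mem_supp f c : (c \in supp f) = (mcoef c f != 0).
Proof. exact: mem_fsuppo. Qed.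

Lemma expand f : f = \sum_(c <- supp f) mcoef c f *: mon c.
Proof. exact: fexpand. Qed.

Lemma mcoef0 c : mcoef c 0 = 0.
Proof. by have := mcoefP c (-1) 0 0; rewrite scaleN1r oppr0 addr0 mulN1r addNr. Qed.

Lemma mcoefD c f g : mcoef c (f + g) = mcoef c f + mcoef c g.
Proof. by rewrite -[f]scale1r mcoefP scale1r mul1r. Qed.

Lemma mcoefZ c a f : mcoef c (a *: f) = a * mcoef c f.
Proof. by rewrite -[_ *: _]addr0 mcoefP mcoef0 addr0. Qed.

Lemma mcoef_sum c I (r : seq I) (P : pred I) (G : I -> R) :
  mcoef c (\sum_(i <- r | P i) G i) = \sum_(i <- r | P i) mcoef c (G i).
Proof.
by apply: (big_morph (mcoef c)) => [f g|]; rewrite ?mcoef0 ?mcoefD.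
Qed.

Lemma eq_mcoef f g : (forall c, mcoef c f = mcoef c g) -> f = g.
Proof.
move=> fg; rewrite (expand f) (expand g).
have sfg : perm_eq (supp f) (supp g).
  by apply: uniq_perm; rewrite ?supp_uniq // => c; rewrite !mem_supp fg.
by rewrite (perm_big _ sfg); apply: eq_bigr => c _; rewrite fg.
Qed.

Lemma mon_ind (P : R -> Prop) : P 0 ->
  (forall c a g, P g -> P (a *: mon c + g)) -> forall g, P g.
Proof.
move=> P0 PS g; rewrite (expand g).
elim: (supp g) => [|c s IH]; first by rewrite big_nil.
by rewrite big_cons; apply: PS.
Qed.

Section Ext.
Variable V : lmodType F.
Implicit Type phi : K -> V.

Definition lext phi f : V := \sum_(c <- supp f) mcoef c f *: phi c.

Lemma lextEw phi f (s : seq K) : uniq s -> {subset supp f <= s} ->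
  lext phi f = \sum_(c <- s) mcoef c f *: phi c.
Proof.
move=> us fs; rewrite [RHS](bigID (fun c => c \in supp f)) /= [X in _ + X]big1 ?addr0.
  rewrite -big_filter /lext; apply: perm_big; apply: uniq_perm.
  - exact: supp_uniq.
  - exact: filter_uniq.
  - by move=> c; rewrite mem_filter; case: (boolP (c \in supp f)) => // /fs->.
by move=> c; rewrite mem_supp negbK => /eqP->; rewrite scale0r.
Qed.

Lemma lext_is_linear phi : linear (lext phi).
Proof.
move=> a f g; pose s := undup (supp f ++ supp g).
have us : uniq s by apply: undup_uniq.
rewrite !(lextEw _ us); first last.
- move=> c; rewrite mem_undup mem_cat !mem_supp mcoefP.
  by apply: contraR; rewrite negb_or !negbK => /andP[/eqP-> /eqP->]; rewrite mulr0 addr0.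
- by move=> c; rewrite mem_undup mem_cat => ->.
- by move=> c; rewrite mem_undup mem_cat => ->; rewrite orbT.
rewrite scaler_sumr -big_split; apply: eq_bigr => c _ /=.
by rewrite mcoefP scalerDl scalerA.
Qed.
HB.instance Definition _ phi := GRing.isLinear.Build F R V *:%R (lext phi) (lext_is_linear phi).

Lemma lext_mon phi c : lext phi (mon c) = phi c.
Proof.
rewrite (@lextEw _ _ [:: c]) //; last first.
  move=> c'; rewrite mem_supp mcoef_mon inE eq_sym; by case: (eqVneq c' c) => // _; rewrite eqxx.
by rewrite big_seq1 mcoef_mon eqxx scale1r.
Qed.

Lemma eq_linear_mon (A B : {linear R -> V}) :
  (forall c, A (mon c) = B (mon c)) -> forall f, A f = B f.
Proof.
by move=> AB; apply: mon_ind => [|c a f IH]; rewrite ?linear0 // !linearP AB IH.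
Qed.
End Ext.
End LinearExtension.
Arguments mon {F K} c.

(* The exponent vector of a monomial in the x_k is stored as a polynomial over [nat], so
   that multiplying monomials is adding exponents; index [i] belongs to x_{i+1}. *)
Definition cf (c : {poly nat}) (i : nat) : nat := nth 0%N (polyseq c) i.

Section Weights.
Implicit Types c d : {poly nat}.

Lemma eq_expo c d : (forall i, cf c i = cf d i) -> c = d.
Proof. by move=> h; apply/polyP. Qed.

Lemma cf_ge_size c i : (size c <= i)%N -> cf c i = 0%N.
Proof. exact: nth_default. Qed.

Lemma cfD c d i : cf (c + d) i = (cf c i + cf d i)%N.
Proof. exact: coefD. Qed.

Lemma cfXn k i : cf 'X^k i = (i == k).
Proof. by rewrite /cf coefXn; case: eqP. Qed.

Definition wdegp c := (\sum_(i < size c) i.+1 * cf c i)%N.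

Lemma wdegpE n c : (size c <= n)%N -> wdegp c = (\sum_(i < n) i.+1 * cf c i)%N.
Proof.
move=> le_cn; rewrite /wdegp -!(big_mkord xpredT (fun i => i.+1 * cf c i)%N).
rewrite [RHS](@big_cat_nat _ _ _ (size c)) //= [X in (_ + X)%N]big_nat.
by rewrite [X in (_ + X)%N]big1 ?addn0 // => i /andP[hi _]; rewrite cf_ge_size ?muln0.
Qed.

Lemma wdegpD c d : wdegp (c + d) = (wdegp c + wdegp d)%N.
Proof.
pose n := (size c + size d)%N.
rewrite (@wdegpE n (c + d)); last by rewrite (leq_trans (size_polyD _ _)) // geq_max; lia.
rewrite (@wdegpE n c) ?leq_addr // (@wdegpE n d) ?leq_addl // -big_split.
by apply: eq_bigr => i _; rewrite cfD /= mulnDr.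
Qed.

Lemma wdegpXn i : wdegp 'X^i = i.+1.
Proof.
rewrite (@wdegpE i.+1) ?size_polyXn // (bigD1 ord_max) //= cfXn eqxx muln1.
rewrite big1 ?addn0 // => j; rewrite -val_eqE /= => hj.
by rewrite cfXn (negbTE hj) muln0.
Qed.

Definition csub c i : {poly nat} := \poly_(j < size c) (cf c j - (j == i))%N.

Lemma cf_csub c i j : cf (csub c i) j = (cf c j - (j == i))%N.
Proof.
rewrite /cf coef_poly; case: ltnP => // hj.
by rewrite nth_default.
Qed.

Lemma csubK c i : (0 < cf c i)%N -> csub c i + 'X^i = c.
Proof.
move=> ci; apply: eq_expo => j; rewrite cfD cf_csub cfXn.
by case: (eqVneq j i) => [->|_] /=; lia.
Qed.

Lemma addXnK c i : csub (c + 'X^i) i = c.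
Proof.
apply: eq_expo => j; rewrite cf_csub cfD cfXn.
by lia.
Qed.

Lemma csubC c i j : csub (csub c i) j = csub (csub c j) i.
Proof. by apply: eq_expo => k; rewrite !cf_csub; lia. Qed.

Lemma csub_addXn c i j : i != j -> (0 < cf c i)%N -> csub (c + 'X^j) i = csub c i + 'X^j.
Proof.
move=> ij ci; apply: eq_expo => k; rewrite cf_csub !cfD cf_csub cfXn.
case: (eqVneq k i) => [->|]; first by rewrite (negbTE ij); lia.
by lia.
Qed.

Lemma wdegp_csub c i : (0 < cf c i)%N -> (wdegp (csub c i) + i.+1)%N = wdegp c.
Proof. by move=> ci; rewrite -{2}(csubK ci) wdegpD wdegpXn. Qed.
End Weights.

(** * Creation and annihilation operators *)

Section Heisenberg.
Variable F : fieldType.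
Local Notation R := (fcar (free_mod F {poly nat})).
Implicit Types (l k : int) (f g : R) (c : {poly nat}).

(* [xop l] is multiplication by x_l and [aop l] is 2 l d/dx_l; both are 0 for l <= 0, which
   lets sums run over all integers. *)
Definition xop l : R -> R :=
  lext (fun c => if 0 < l then mon (c + 'X^(`|l|.-1)) else 0).
Definition aop l : R -> R :=
  lext (fun c => if 0 < l then (2 * `|l| * (cf c `|l|.-1))%:R *: mon (csub c `|l|.-1) else 0).
HB.instance Definition _ l := GRing.Linear.copy (xop l) (lext _).
HB.instance Definition _ l := GRing.Linear.copy (aop l) (lext _).

Lemma xop0 l : xop l 0 = 0. Proof. exact: linear0. Qed.
Lemma aop0 l : aop l 0 = 0. Proof. exact: linear0. Qed.
Lemma xopZ l a f : xop l (a *: f) = a *: xop l f. Proof. exact: linearZ. Qed.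
Lemma aopZ l a f : aop l (a *: f) = a *: aop l f. Proof. exact: linearZ. Qed.
Lemma xopD l f g : xop l (f + g) = xop l f + xop l g. Proof. exact: linearD. Qed.
Lemma aopD l f g : aop l (f + g) = aop l f + aop l g. Proof. exact: linearD. Qed.

Lemma xop_le0 l f : l <= 0 -> xop l f = 0.
Proof.
move=> l0; rewrite /xop /lext; apply: big1 => c _.
by rewrite ifF ?scaler0 //; lia.
Qed.

Lemma aop_le0 l f : l <= 0 -> aop l f = 0.
Proof.
move=> l0; rewrite /aop /lext; apply: big1 => c _.
by rewrite ifF ?scaler0 //; lia.
Qed.

Lemma xopU l (l0 : 0 < l) c : xop l (mon c) = mon (c + 'X^(`|l|.-1)).
Proof. by rewrite /xop lext_mon l0. Qed.

Lemma aopU l (l0 : 0 < l) c :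
  aop l (mon c) = (2 * `|l| * (cf c `|l|.-1))%:R *: mon (csub c `|l|.-1).
Proof. by rewrite /aop lext_mon l0. Qed.

Lemma xopC l k f : xop l (xop k f) = xop k (xop l f).
Proof.
have [l0|l0] := lerP l 0; first by rewrite !(xop_le0 _ l0) xop0.
have [k0|k0] := lerP k 0; first by rewrite !(xop_le0 _ k0) xop0.
apply: (eq_linear_mon (A := xop l \o xop k) (B := xop k \o xop l)) => c /=.
by rewrite !(xopU k0, xopU l0) -!addrA (addrC 'X^_).
Qed.

Lemma aopC l k f : aop l (aop k f) = aop k (aop l f).
Proof.
have [l0|l0] := lerP l 0; first by rewrite !(aop_le0 _ l0) aop0.
have [k0|k0] := lerP k 0; first by rewrite !(aop_le0 _ k0) aop0.
have [->//|kl] := eqVneq l k.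
apply: (eq_linear_mon (A := aop l \o aop k) (B := aop k \o aop l)) => c /=.
rewrite !(aopU l0, aopU k0, aopZ) !scalerA csubC !cf_csub -!natrM.
have -> : (`|l|.-1 == `|k|.-1)%N = false by lia.
have -> : (`|k|.-1 == `|l|.-1)%N = false by lia.
by rewrite !subn0 mulnC.
Qed.

(** The Heisenberg relation; the constant is l (alpha, alpha) = 2 l. *)
Lemma aop_xop l k f : 0 < l ->
  aop l (xop k f) = xop k (aop l f) + (if k == l then (2 * l)%:~R else 0) *: f.
Proof.
move=> l0; have [k0|k0] := lerP k 0.
  by rewrite !(xop_le0 _ k0) aop0 ifF ?scale0r ?addr0 //; lia.
pose z : F := if k == l then (2 * l)%:~R else 0.
apply: (eq_linear_mon (A := aop l \o xop k) (B := (xop k \o aop l) \+ (z \*: idfun))).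
move=> c /=; rewrite {}/z.
rewrite (xopU k0) !(aopU l0) xopZ (xopU k0) cfD cfXn.
case: (eqVneq k l) => [->|kl].
  rewrite addXnK eqxx.
  have -> : (2 * l)%:~R = (2 * `|l|)%:R :> F by rewrite [RHS]pmulrn; congr (_ *~ _); lia.
  case: (posnP (cf c `|l|.-1)) => [c0|/csubK->].
    by rewrite c0 muln0 scale0r add0r muln1.
  by rewrite -scalerDl -natrD; congr (_%:R *: _); lia.
have -> : (`|l|.-1 == `|k|.-1)%N = false by lia.
rewrite scale0r !addr0.
case: (posnP (cf c `|l|.-1)) => [->|c0]; first by rewrite muln0 !scale0r.
have nlk : `|l|.-1 != `|k|.-1 :> nat by lia.
by rewrite (csub_addXn nlk c0) addn0.
Qed.

(** A bound on the weight is all that finiteness needs: annihilation lowers the bound, and a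
    negative bound forces the vector to vanish. This makes the sums over all integers below finitely
    supported. *)
Definition fil (w : int) f := forall c, mcoef c f != 0 -> (wdegp c)%:Z <= w.

Lemma fil0 w : fil w 0.
Proof. by move=> c; rewrite mcoef0 eqxx. Qed.

Lemma filP w a f g : fil w f -> fil w g -> fil w (a *: f + g).
Proof.
move=> wf wg c; rewrite mcoefP.
case: (eqVneq (mcoef c f) 0) => [->|/wf//]; rewrite mulr0 add0r; exact: wg.
Qed.

Lemma filD w f g : fil w f -> fil w g -> fil w (f + g).
Proof. by move=> wf; rewrite -[f]scale1r; apply: filP. Qed.

Lemma filZ w a f : fil w f -> fil w (a *: f).
Proof. by move=> wf; rewrite -[_ *: _]addr0; apply: filP => //; apply: fil0. Qed.

Lemma fil_mon c : fil (wdegp c)%:Z (mon c).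
Proof. by move=> d; rewrite mcoef_mon; case: (eqVneq c d) => [->//|_]; rewrite eqxx. Qed.

Lemma fil_sum I (r : seq I) (P : pred I) (E : I -> R) w :
  (forall i, P i -> fil w (E i)) -> fil w (\sum_(i <- r | P i) E i).
Proof. by move=> h; apply: big_ind => //; [exact: fil0 | exact: filD]. Qed.

Lemma fil_lext w w' (phi : {poly nat} -> R) f :
  (forall c, (wdegp c)%:Z <= w -> fil w' (phi c)) -> fil w f -> fil w' (lext phi f).
Proof.
move=> hphi wf; rewrite /lext big_seq; apply: fil_sum => c cf.
by apply: filZ; apply: hphi; apply: wf; rewrite -mem_supp.
Qed.

Lemma fil_le w w' f : w <= w' -> fil w f -> fil w' f.
Proof. by move=> le wf c /wf h; lia. Qed.

Lemma fil_lt0 w f : w < 0 -> fil w f -> f = 0.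
Proof.
move=> w0 wf; apply: eq_mcoef => c; rewrite mcoef0.
by apply/eqP; apply/negPn/negP => /wf; lia.
Qed.

Lemma fil_ex f : exists2 w : int, 0 <= w & fil w f.
Proof.
elim/mon_ind: f => [|c a f [w w0 wf]]; first by exists 0 => //; apply: fil0.
exists ((wdegp c)%:Z + w); first by lia.
by apply: filP; [apply: fil_le (@fil_mon c) | apply: fil_le wf]; lia.
Qed.

Lemma fil_aop w l f : fil w f -> fil (w - l) (aop l f).
Proof.
have [l0 _|l0] := lerP l 0; first by rewrite aop_le0 //; apply: fil0.
apply: fil_lext => c cw; rewrite l0.
case: (posnP (cf c `|l|.-1)) => [->|c0]; first by rewrite muln0 scale0r; apply: fil0.
by apply: filZ; apply: fil_le (@fil_mon _); have := wdegp_csub c0; lia.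
Qed.
End Heisenberg.
Arguments xopU {F l} l0 c.
Arguments aopU {F l} l0 c.

(** * Enumeration of exponent vectors *)

Section ExponentVectors.
Implicit Types (c : {poly nat}) (e a b : seq nat).

Lemma cf_Poly e i : cf (Poly e) i = nth 0%N e i.
Proof. exact: coef_Poly. Qed.

Lemma wdegp_Poly e : wdegp (Poly e) = wdeg e.
Proof.
rewrite (@wdegpE (size e)) ?size_Poly // /wdeg big_mkord.
by apply: eq_bigr => i _; rewrite cf_Poly.
Qed.

Lemma size_le_wdegp c : (size c <= wdegp c)%N.
Proof.
have [->|c0] := posnP (size c) => //.
have lt : ((size c).-1 < size c)%N by rewrite prednK.
rewrite /wdegp (bigD1 (Ordinal lt)) //= prednK //.
suff h : (0 < cf c (size c).-1)%N.
  by apply: leq_trans (leq_addr _ _); apply: leq_pmulr.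
by rewrite lt0n /cf -/(lead_coef c) lead_coef_eq0 -size_poly_eq0 -lt0n.
Qed.

Lemma subvecs_cons x e :
  subvecs (x :: e) = [seq y :: t | y <- iota 0 x.+1, t <- subvecs e].
Proof. by []. Qed.

Lemma subvecsP e a : reflect (size a = size e /\ forall i, (nth 0 a i <= nth 0 e i)%N)
                             (a \in subvecs e).
Proof.
apply: (iffP idP).
  elim: e a => [|x e IH] a; first by rewrite inE => /eqP->.
  rewrite subvecs_cons => /allpairsPdep[y [t [+ /IH[st ht] ->]]] /=.
  by rewrite mem_iota => hy; split => [|[|i]] /=; rewrite ?st //; lia.
elim: e a => [|x e IH] [|y t] [] // [st] h.
rewrite subvecs_cons; apply/allpairsPdep; exists y, t; split => //.
  by rewrite mem_iota; have := h 0%N => /=; lia.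
by apply: IH; split => // i; apply: (h i.+1).
Qed.

Lemma subvecs_uniq e : uniq (subvecs e).
Proof.
elim: e => // x e IH; rewrite subvecs_cons.
apply: allpairs_uniq => //; first exact: iota_uniq.
by move=> [a b] [c d] _ _ /= [-> ->].
Qed.

Lemma wdeg_nth_le e i : (i.+1 * nth 0 e i <= wdeg e)%N.
Proof.
case: (ltnP i (size e)) => hi; last by rewrite nth_default ?muln0.
by rewrite /wdeg big_mkord (bigD1 (Ordinal hi)) //= leq_addr.
Qed.

(** Vectors are padded to length N, so each monomial of weight N is listed once. *)
Lemma partsP N b : reflect (size b = N /\ wdeg b = N) (b \in parts N).
Proof.
rewrite mem_filter andbC; apply: (iffP andP).
  by case=> /subvecsP[+ _] /eqP; rewrite size_map size_iota.
move=> [sb wb]; rewrite wb; split => //; apply/subvecsP.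
rewrite size_map size_iota; split => // i.
case: (ltnP i N) => hi; last by rewrite nth_default // sb.
rewrite (nth_map 0%N) ?size_iota // nth_iota // add0n leq_divRL // mulnC.
by have := wdeg_nth_le b i; rewrite wb.
Qed.

Lemma parts_uniq N : uniq (parts N).
Proof. exact/filter_uniq/subvecs_uniq. Qed.

Lemma wdegp_csub_eq c i : (0 < cf c i)%N -> wdegp (csub c i) = (wdegp c - i.+1)%N.
Proof. by move/wdegp_csub; lia. Qed.
End ExponentVectors.

(** * Coefficients of the exponential and of the shift *)

Section Exponentials.
Variable F : fieldType.
Hypothesis charF : forall n : nat, (n.+1%:R : F) != 0.
Local Notation R := (fcar (free_mod F {poly nat})).
Implicit Types (s : F) (f g : R) (c d : {poly nat}).

Lemma coef_xop l g c : 0 < l ->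
  mcoef c (xop l g) = if (0 < cf c `|l|.-1)%N then mcoef (csub c `|l|.-1) g else 0.
Proof.
move=> l0; set i := `|l|.-1; elim/mon_ind: g => [|c' a g IH].
  by rewrite xop0 !mcoef0 if_same.
rewrite xopD xopZ (xopU l0) -/i !mcoefD !mcoefZ IH !mcoef_mon.
case: ltnP => hc; last first.
  rewrite addr0; case: eqP => [cE|]; last by rewrite mulr0.
  by move: hc; rewrite -cE cfD cfXn eqxx; lia.
congr (a * _%:R + _); congr nat_of_bool; apply/eqP/eqP => [<-|->].
  by rewrite addXnK.
by rewrite csubK.
Qed.

Lemma coef_aop l g c : 0 < l ->
  mcoef c (aop l g) = (2 * `|l| * (cf c `|l|.-1).+1)%:R * mcoef (c + 'X^(`|l|.-1)) g.
Proof.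
move=> l0; set i := `|l|.-1; elim/mon_ind: g => [|c' a g IH].
  by rewrite aop0 !mcoef0 mulr0.
rewrite aopD aopZ (aopU l0) -/i !mcoefD !mcoefZ IH !mcoef_mon mulrDr.
congr (_ + _); rewrite [RHS]mulrCA; congr (a * _).
case: (eqVneq c' (c + 'X^i)) => [->|hc].
  by rewrite addXnK eqxx cfD cfXn eqxx addn1.
rewrite mulr0; case: eqP => [cE|]; last by rewrite mulr0.
case: (posnP (cf c' i)) => [->|c0]; first by rewrite muln0 mul0r.
by move: hc; rewrite -cE csubK // eqxx.
Qed.

(** The coefficient of x^c in exp(s sum_k x_k / k). *)
Definition expc s c : F :=
  \prod_(i < size c) ((s / i.+1%:R) ^+ cf c i / (cf c i)`!%:R).

Lemma expcE n s c : (size c <= n)%N ->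
  expc s c = \prod_(i < n) ((s / i.+1%:R) ^+ cf c i / (cf c i)`!%:R).
Proof.
move=> le_cn; rewrite /expc.
rewrite -!(big_mkord xpredT (fun i => (s / i.+1%:R) ^+ cf c i / (cf c i)`!%:R)).
rewrite [RHS](@big_cat_nat _ _ _ (size c)) //= [X in _ = _ * X]big_nat.
rewrite [X in _ = _ * X]big1 ?mulr1 // => i /andP[hi _].
by rewrite cf_ge_size // expr0 fact0 divr1.
Qed.

Lemma fact_neq0 n : (n`!%:R : F) != 0.
Proof. by have := fact_gt0 n; case: n`! => // m _; apply: charF. Qed.

Lemma expc_csub s c i : (0 < cf c i)%N ->
  s * expc s (csub c i) = (i.+1 * cf c i)%:R * expc s c.
Proof.
move=> ci; pose n := (size c + i).+1.
rewrite (@expcE n s c); last by rewrite /n; lia.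
rewrite (@expcE n s (csub c i)); last first.
  by rewrite (leq_trans (size_poly _ _)) // /n; lia.
have hi : (i < n)%N by rewrite /n; lia.
rewrite (bigD1 (Ordinal hi)) //= [in RHS](bigD1 (Ordinal hi)) //= !mulrA.
congr (_ * _).
  rewrite cf_csub eqxx; move: ci; case: (cf c i) => // m _.
  rewrite subn1 /= factS !natrM exprS.
  have := charF i; have := charF m; have := fact_neq0 m.
  move: (i.+1%:R) (m.+1%:R) (m`!%:R) => x y z z0 y0 x0.
  by set t := (_ ^+ m); field; rewrite ?x0 ?y0 ?z0.
apply: eq_bigr => j; rewrite -val_eqE /= => ji.
by rewrite cf_csub (negbTE ji) subn0.
Qed.

Definition Svec s N : R := \sum_(b <- parts N) expc s (Poly b) *: mon (Poly b).

Lemma coef_Svec s N c : mcoef c (Svec s N) = if wdegp c == N then expc s c else 0.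
Proof.
rewrite /Svec mcoef_sum.
under eq_bigr do rewrite mcoefZ mcoef_mon.
have [wc|wc] := eqVneq (wdegp c) N; last first.
  rewrite big_seq big1 // => b /partsP[_ wb]; case: eqP => [cE|]; last by rewrite mulr0.
  by move: wc; rewrite -cE wdegp_Poly wb eqxx.
pose b0 := mkseq (cf c) N.
have szc : (size c <= N)%N by rewrite -wc size_le_wdegp.
have b0E : Poly b0 = c.
  apply: eq_expo => i; rewrite cf_Poly /b0; case: (ltnP i N) => hi.
    by rewrite nth_mkseq.
  by rewrite nth_default ?size_mkseq // cf_ge_size //; lia.
rewrite (bigD1_seq b0) ?parts_uniq //=; last first.
  by apply/partsP; rewrite size_mkseq -wdegp_Poly b0E wc.
rewrite b0E eqxx mulr1 big_seq_cond big1 ?addr0 // => b /andP[/partsP[sb _] /eqP nb].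
case: eqP => [bE|]; last by rewrite mulr0.
case: nb; apply: (@eq_from_nth _ 0%N); first by rewrite size_mkseq.
by move=> i hi; rewrite nth_mkseq -?sb // -bE cf_Poly.
Qed.

(** The coefficient form of z d/dz S_s(z) = s (sum_k x_k z^k) S_s(z). On a monomial c it says that
    the numbers (i+1) c_i add up to the weight of c. *)
Lemma Svec_rec s N :
  N%:R *: Svec s N = s *: \sum_(i < N) xop i.+1%:Z (Svec s (N - i.+1)).
Proof.
apply: eq_mcoef => c; rewrite !mcoefZ coef_Svec mcoef_sum.
under eq_bigr => i _ do rewrite coef_xop // coef_Svec /=.
rewrite mulr_sumr; case: eqP => [wc|/eqP wc]; last first.
  rewrite mulr0 big1 // => i _; case: ltnP => [ci|]; last by rewrite mulr0.
  rewrite ifF ?mulr0 //; have := wdegp_csub ci; have := ltn_ord i.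
  by move=> hi wi; apply/negP => /eqP h; case/eqP: wc; lia.
transitivity (\sum_(i < N) (i.+1 * cf c i)%:R * expc s c).
  by rewrite -mulr_suml -natr_sum -wdegpE // -wc // size_le_wdegp.
apply: eq_bigr => i _; case: ltnP => [ci|]; last first.
  by rewrite leqn0 => /eqP->; rewrite muln0 mul0r mulr0.
by rewrite wdegp_csub_eq // wc eqxx expc_csub.
Qed.

(* Coefficient of x^d in the shifted monomial prod_i (x_i - 2 s)^(c_i), at z = 1. *)
Definition shc s c d : F :=
  \prod_(i < maxn (size c) (size d)) ('C(cf c i, cf d i)%:R * (- 2 * s) ^+ (cf c i - cf d i)).

Lemma shcE n s c d : (size c <= n)%N -> (size d <= n)%N ->
  shc s c d = \prod_(i < n) ('C(cf c i, cf d i)%:R * (- 2 * s) ^+ (cf c i - cf d i)).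
Proof.
move=> cn dn; rewrite /shc.
rewrite -!(big_mkord xpredT (fun i => 'C(cf c i, cf d i)%:R * (- 2 * s) ^+ (cf c i - cf d i))).
rewrite [RHS](@big_cat_nat _ _ _ (maxn (size c) (size d))) //= ?geq_max ?cn //.
rewrite [X in _ = _ * X]big_nat [X in _ = _ * X]big1 ?mulr1 // => i /andP[hi _].
by move: hi; rewrite geq_max => /andP[ci di]; rewrite !cf_ge_size // bin0 expr0 mulr1.
Qed.

Lemma shc_eq0 s c d i : (cf c i < cf d i)%N -> shc s c d = 0.
Proof.
move=> cd; have hi : (i < size d)%N.
  by rewrite ltnNge; apply/negP => /cf_ge_size di; move: cd; rewrite di.
have hi' : (i < maxn (size c) (size d))%N by rewrite leq_max hi orbT.
by rewrite /shc (bigD1 (Ordinal hi')) //= bin_small // !mul0r.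
Qed.

(** Comes from (y + 1) C(x, y + 1) = (x - y) C(x, y); it is the coefficient form of differentiating
    the shift, used in [Qop_rec]. *)
Lemma shc_addXn s c d i :
  - s * (2 * i.+1 * (cf d i).+1)%:R * shc s c (d + 'X^i) =
  (i.+1 * (cf c i - cf d i))%:R * shc s c d.
Proof.
pose n := (size c + size d + i).+1.
have cn : (size c <= n)%N by rewrite /n; lia.
have dn : (size d <= n)%N by rewrite /n; lia.
have din : (size (d + 'X^i)%R <= n)%N.
  by rewrite (leq_trans (size_polyD _ _)) // size_polyXn /n; lia.
rewrite (shcE s cn dn) (shcE s cn din).
have hi : (i < n)%N by rewrite /n; lia.
rewrite (bigD1 (Ordinal hi)) //= [in RHS](bigD1 (Ordinal hi)) //= !mulrA.
congr (_ * _); last first.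
  apply: eq_bigr => j; rewrite -val_eqE /= => ji.
  by rewrite cfD cfXn (negbTE ji) addn0.
rewrite cfD cfXn eqxx addn1; move: (cf c i) (cf d i) => x y.
case: (leqP x y) => [xy|yx].
  have /eqP -> : (x - y == 0)%N by rewrite subn_eq0.
  by rewrite bin_small // !(mulr0, muln0, mul0r).
have binE : (y.+1%:R * 'C(x, y.+1)%:R = (x - y)%:R * 'C(x, y)%:R :> F).
  by rewrite -!natrM mul_bin_left.
have -> : (x - y = (x - y.+1).+1)%N by lia.
move: binE; rewrite !natrM exprS; have -> : (x - y = (x - y.+1).+1)%N by lia.
set A := ('C(x, y.+1)%:R); set B := ('C(x, y)%:R); move=> binE.
transitivity (- (2 * s) * i.+1%:R * (y.+1%:R * A) * (-2 * s) ^+ (x - y.+1)); first by ring.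
by rewrite binE; ring.
Qed.

(** Written as a sum over [subvecs], like [emode], so that the two can be compared; [coef_Qvec]
    gives the closed form used in calculations. *)
Definition Qvec s (e : seq nat) N : R :=
  \sum_(a <- subvecs e | wdeg a == N)
    (\prod_(i < size a) ('C(nth 0 e i, nth 0 a i)%:R * (- 2 * s) ^+ nth 0%N a i)) *:
    mon (Poly (mkseq (fun i => nth 0 e i - nth 0 a i)%N (size e))).

Lemma coef_Qvec s e N d :
  mcoef d (Qvec s e N) = if (wdegp d + N)%N == wdegp (Poly e) then shc s (Poly e) d else 0.
Proof.
pose c : {poly nat} := Poly e; rewrite -/c.
have nthE i : nth 0%N e i = cf c i by rewrite cf_Poly.
have cf_ge i : (size e <= i)%N -> cf c i = 0%N by move=> h; rewrite -nthE nth_default.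
rewrite /Qvec mcoef_sum.
under eq_bigr do rewrite mcoefZ mcoef_mon.
set res := fun a => Poly (mkseq (fun i => nth 0 e i - nth 0 a i)%N (size e)).
have cf_res a i : cf (res a) i = (cf c i - nth 0%N a i)%N.
  rewrite cf_Poly; case: (ltnP i (size e)) => hi; first by rewrite nth_mkseq // nthE.
  by rewrite nth_default ?size_mkseq // cf_ge.
have [/forallP le_dc|] := boolP [forall i : 'I_(size d), (cf d i <= cf c i)%N]; last first.
  rewrite negb_forall => /existsP[i]; rewrite -ltnNge => lt_cd.
  rewrite (shc_eq0 _ lt_cd) if_same big1 // => a _.
  case: eqP => [cE|]; last by rewrite mulr0.
  by have := cf_res a i; rewrite [res a]cE; move: lt_cd; lia.
have {}le_dc i : (cf d i <= cf c i)%N.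
  case: (ltnP i (size d)) => hi; first exact: (le_dc (Ordinal hi)).
  by rewrite cf_ge_size.
(* The only subvector of e whose removal leaves d. *)
pose a0 := mkseq (fun i => cf c i - cf d i)%N (size e).
have nth_a0 i : nth 0%N a0 i = (cf c i - cf d i)%N.
  case: (ltnP i (size e)) => hi; first by rewrite nth_mkseq.
  by rewrite nth_default ?size_mkseq // cf_ge.
have dE : res a0 = d by apply: eq_expo => i; rewrite cf_res nth_a0 subKn.
have wa0 : (wdegp d + wdeg a0)%N = wdegp c.
  rewrite -wdegp_Poly -wdegpD; congr wdegp; apply: eq_expo => i.
  by rewrite cfD cf_Poly nth_a0 subnKC.
have uniq_a0 a : a \in subvecs e -> res a = d -> a = a0.
  case/subvecsP => sa ha aE; apply: (@eq_from_nth _ 0%N); first by rewrite size_mkseq.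
  move=> i _; rewrite nth_a0 -aE cf_res subKn // -nthE; exact: ha.
have [wd|wd] := eqVneq (wdegp d + N)%N (wdegp c); last first.
  rewrite big_seq_cond big1 // => a /andP[ha /eqP wa].
  case: eqP => [/(uniq_a0 _ ha) aE|]; last by rewrite mulr0.
  by move: wd; rewrite -wa aE wa0 eqxx.
have a0in : a0 \in subvecs e.
  by apply/subvecsP; rewrite size_mkseq; split => // i; rewrite nth_a0 nthE leq_subr.
rewrite -big_filter (bigD1_seq a0) ?filter_uniq ?subvecs_uniq //=; last first.
  by rewrite mem_filter a0in andbT; apply/eqP; lia.
rewrite -/(res a0) dE eqxx mulr1 [X in _ + X]big_seq_cond [X in _ + X]big1 ?addr0; last first.
  move=> a /andP[]; rewrite mem_filter => /andP[_ ha] /eqP na.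
  by case: eqP => [/(uniq_a0 _ ha)//|]; rewrite mulr0.
have szd : (size d <= size e)%N.
  rewrite leqNgt; apply/negP => lt; have := le_dc (size d).-1.
  rewrite (cf_ge (size d).-1); last by lia.
  have : lead_coef d != 0 by rewrite lead_coef_eq0 -size_poly_eq0; lia.
  by move/eqP => h; rewrite leqn0 => /eqP.
rewrite size_mkseq (shcE (n := size e)) ?size_Poly //; apply: eq_bigr => i _.
by rewrite nth_a0 nthE bin_sub.
Qed.
End Exponentials.

(** * Exponential operators *)

(* [Sop s a] is the coefficient of z^a in exp(s sum_k x_k z^k / k), and [Qop s b] that of
   z^(-b) in the shift x_k -> x_k - 2 s z^(-k). *)
HB.lock Definition Sop (F : fieldType) (s : F) (a : int) :
    fcar (free_mod F {poly nat}) -> fcar (free_mod F {poly nat}) :=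
  lext (fun e => if a is Posz N then lext (fun c => mon (e + c)) (Svec s N) else 0).

HB.lock Definition Qop (F : fieldType) (s : F) (b : int) :
    fcar (free_mod F {poly nat}) -> fcar (free_mod F {poly nat}) :=
  lext (fun e : {poly nat} => if b is Posz N then Qvec s (polyseq e) N else 0).

Section ExponentialOperators.
Variable F : fieldType.
Hypothesis charF : forall n : nat, (n.+1%:R : F) != 0.
Local Notation R := (fcar (free_mod F {poly nat})).
Implicit Types (s : F) (f g : R) (c d : {poly nat}) (a b l k : int).

Lemma Sop_is_linear s a : linear (Sop s a).
Proof. by rewrite Sop.unlock; apply: lext_is_linear. Qed.
HB.instance Definition _ s a := GRing.isLinear.Build F R R *:%R (Sop s a) (Sop_is_linear s a).

Lemma Qop_is_linear s a : linear (Qop s a).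
Proof. by rewrite Qop.unlock; apply: lext_is_linear. Qed.
HB.instance Definition _ s a := GRing.isLinear.Build F R R *:%R (Qop s a) (Qop_is_linear s a).

Lemma SopZ s a x f : Sop s a (x *: f) = x *: Sop s a f. Proof. exact: linearZ. Qed.
Lemma SopD s a f g : Sop s a (f + g) = Sop s a f + Sop s a g. Proof. exact: linearD. Qed.
Lemma Sop0 s a : Sop s a 0 = 0. Proof. exact: linear0. Qed.
Lemma QopZ s a x f : Qop s a (x *: f) = x *: Qop s a f. Proof. exact: linearZ. Qed.
Lemma QopD s a f g : Qop s a (f + g) = Qop s a f + Qop s a g. Proof. exact: linearD. Qed.
Lemma Qop0 s a : Qop s a 0 = 0. Proof. exact: linear0. Qed.

Lemma Sop_mon s N e : Sop s (Posz N) (mon e) = lext (fun c => mon (e + c)) (Svec s N).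
Proof. by rewrite Sop.unlock lext_mon. Qed.

Lemma Qop_mon s N e : Qop s (Posz N) (mon e) = Qvec s e N.
Proof. by rewrite Qop.unlock lext_mon. Qed.

Lemma Sop_lt0 s a f : a < 0 -> Sop s a f = 0.
Proof.
case: a => // n _; rewrite Sop.unlock /lext; apply: big1 => c _.
by rewrite scaler0.
Qed.

Lemma Qop_lt0 s a f : a < 0 -> Qop s a f = 0.
Proof.
case: a => // n _; rewrite Qop.unlock /lext; apply: big1 => c _.
by rewrite scaler0.
Qed.

Lemma xopS n c : xop (Posz n.+1) (mon c : R) = mon (c + 'X^n).
Proof. exact: xopU. Qed.

Lemma xop_translate l e f :
  xop l (lext (fun c => mon (e + c)) f) = lext (fun c => mon (e + c)) (xop l f) :> R.
Proof.
have [l0|l0] := lerP l 0; first by rewrite !(xop_le0 _ l0) linear0.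
apply: (eq_linear_mon (A := xop l \o lext (fun c => mon (e + c)))
                      (B := lext (fun c => mon (e + c)) \o xop l)) => c /=.
by rewrite !lext_mon !(xopU l0) lext_mon addrA.
Qed.

Lemma lsum_xop (G : int -> R) N : (forall a, a < 0 -> G a = 0) ->
  lsum (fun l => xop l (G (N%:Z - l))) = \sum_(i < N) xop i.+1%:Z (G (N - i.+1)%N%:Z).
Proof.
move=> G0; rewrite (@lsum_range _ _ 1 N); last first.
  move=> i hi; case: (lerP i 0) => [|i0]; first exact: xop_le0.
  by rewrite G0 ?xop0 //; lia.
apply: eq_bigr => i _; have := ltn_ord i => hi; congr (xop _ (G _)); lia.
Qed.

Lemma lsum_aop (G : int -> R) N : (forall a, a < 0 -> G a = 0) ->
  lsum (fun l => aop l (G (N%:Z - l))) = \sum_(i < N) aop i.+1%:Z (G (N - i.+1)%N%:Z).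
Proof.
move=> G0; rewrite (@lsum_range _ _ 1 N); last first.
  move=> i hi; case: (lerP i 0) => [|i0]; first exact: aop_le0.
  by rewrite G0 ?aop0 //; lia.
apply: eq_bigr => i _; have := ltn_ord i => hi; congr (aop _ (G _)); lia.
Qed.

Lemma lsum_rec_lt0 (A : int -> R -> R) (G : int -> R) a : a < 0 ->
  (forall l f, l <= 0 -> A l f = 0) -> (forall l, A l 0 = 0) ->
  (forall a, a < 0 -> G a = 0) -> lsum (fun l => A l (G (a - l))) = 0.
Proof.
move=> a0 A0 Al0 G0; apply: lsum0 => l.
case: (lerP l 0) => l0; first exact: A0.
by rewrite G0 //; lia.
Qed.

Lemma Sop_rec s a f : a%:~R *: Sop s a f = s *: lsum (fun l => xop l (Sop s (a - l) f)).
Proof.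
have SN b g : b < 0 -> Sop s b g = 0 := @Sop_lt0 s b g.
case: a => [N|n]; last first.
  rewrite (@lsum_rec_lt0 (fun l => xop l) (fun b => Sop s b f)) ?Sop_lt0 ?scaler0 //.
  - by move=> l g; apply: xop_le0.
  - by move=> l; apply: xop0.
  by move=> b; apply: Sop_lt0.
rewrite (@lsum_xop (fun b => Sop s b f)); last by move=> b; apply: Sop_lt0.
elim/mon_ind: f => [|c x f IH].
  rewrite Sop0 scaler0 big1 ?scaler0 // => i _; by rewrite Sop0 xop0.
rewrite SopD scalerDr IH.
under [in RHS]eq_bigr do rewrite SopD xopD.
rewrite big_split scalerDr; congr (_ + _).
under [in RHS]eq_bigr do rewrite SopZ xopZ.
rewrite -scaler_sumr SopZ !scalerA ![_ * x]mulrC -!scalerA; congr (_ *: _).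
under [in RHS]eq_bigr do rewrite Sop_mon xop_translate.
rewrite Sop_mon -linear_sum -!linearZ /=; congr (lext _ _).
exact: Svec_rec.
Qed.

Lemma wdegp_eq0 c : wdegp c = 0%N -> c = 0.
Proof.
by move=> c0; apply/eqP; rewrite -size_poly_eq0 -leqn0 -c0 size_le_wdegp.
Qed.

Lemma Sop_0 s f : Sop s 0 f = f.
Proof.
apply: (eq_linear_mon (A := Sop s 0) (B := idfun)) => c /=.
rewrite (Sop_mon s 0).
suff -> : Svec s 0 = mon 0 by rewrite lext_mon addr0.
apply: eq_mcoef => d; rewrite coef_Svec mcoef_mon.
rewrite [0 == d]eq_sym; have [->|d0] := eqVneq d 0.
  by rewrite /wdegp size_poly0 big_ord0 eqxx /expc size_poly0 big_ord0.
by case: eqP => // /wdegp_eq0 de; rewrite de eqxx in d0.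
Qed.

Lemma expo_subP c d : (forall i, cf d i <= cf c i)%N -> exists r, c = d + r.
Proof.
move=> dc; exists (Poly (mkseq (fun i => cf c i - cf d i)%N (size c))).
apply: eq_expo => i; rewrite cfD cf_Poly.
have := dc i; case: (ltnP i (size c)) => hi; first by rewrite nth_mkseq //; lia.
by rewrite nth_default ?size_mkseq // (cf_ge_size hi); lia.
Qed.

Lemma shcP s c d : (exists r, c = d + r) \/ shc s c d = 0.
Proof.
have [/forallP h|] := boolP [forall i : 'I_(size d), (cf d i <= cf c i)%N].
  left; apply: expo_subP => i; case: (ltnP i (size d)) => hi; first exact: (h (Ordinal hi)).
  by rewrite cf_ge_size.
rewrite negb_forall => /existsP[i]; rewrite -ltnNge => h.
by right; apply: shc_eq0 h.
Qed.

Lemma Qop_0 s f : Qop s 0 f = f.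
Proof.
apply: (eq_linear_mon (A := Qop s 0) (B := idfun)) => c /=.
rewrite (Qop_mon s 0); apply: eq_mcoef => d; rewrite coef_Qvec polyseqK mcoef_mon addn0.
have [->|cd] := eqVneq c d.
  rewrite eqxx /shc big1 // => i _.
  by rewrite binn subnn expr0 mulr1.
case: eqP => // wd; case: (shcP s c d) => [[r cE]|->] //.
have r0 : r = 0 by apply: wdegp_eq0; move: wd; rewrite cE wdegpD; lia.
by rewrite cE r0 addr0 eqxx in cd.
Qed.

Lemma Qop_rec s a f : a%:~R *: Qop s a f = - s *: lsum (fun l => aop l (Qop s (a - l) f)).
Proof.
case: a => [N|n]; last first.
  rewrite (@lsum_rec_lt0 (fun l => aop l) (fun b => Qop s b f)) ?Qop_lt0 ?scaler0 //.
  - by move=> l g; apply: aop_le0.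
  - by move=> l; apply: aop0.
  by move=> b; apply: Qop_lt0.
rewrite (@lsum_aop (fun b => Qop s b f)); last by move=> b; apply: Qop_lt0.
elim/mon_ind: f => [|c x f IH].
  rewrite Qop0 scaler0 big1 ?scaler0 // => i _; by rewrite Qop0 aop0.
rewrite QopD scalerDr IH.
under [in RHS]eq_bigr do rewrite QopD aopD.
rewrite big_split scalerDr; congr (_ + _).
under [in RHS]eq_bigr do rewrite QopZ aopZ.
rewrite -scaler_sumr QopZ !scalerA ![_ * x]mulrC -!scalerA; congr (_ *: _).
under [in RHS]eq_bigr do rewrite Qop_mon.
rewrite Qop_mon; apply: eq_mcoef => d; rewrite !mcoefZ coef_Qvec polyseqK mcoef_sum.
under [in RHS]eq_bigr => i _ do rewrite coef_aop // coef_Qvec polyseqK wdegpD wdegpXn.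
have wE (i : 'I_N) : (wdegp d + i.+1 + (N - i.+1) = wdegp d + N)%N.
  by have := ltn_ord i; lia.
under [in RHS]eq_bigr => i _ do rewrite wE.
case: eqP => [wd|_]; last by rewrite mulr0 big1 ?mulr0 // => i _; rewrite mulr0.
rewrite mulr_sumr; under [in RHS]eq_bigr => i _ do rewrite mulrA shc_addXn //.
(* Only c = d + r contributes, and then the sum of the (i+1)(c_i - d_i) is the weight N of r. *)
rewrite -mulr_suml; case: (shcP s c d) => [[r cE]|->]; last by rewrite !mulr0.
congr (_ * _); rewrite -natr_sum; congr _%:R.
have wr : wdegp r = N by move: wd; rewrite cE wdegpD; lia.
rewrite -[LHS]wr (@wdegpE N) -?wr ?size_le_wdegp //.
by rewrite wr; apply: eq_bigr => i _; rewrite cE cfD addKn.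
Qed.
End ExponentialOperators.

(* Operators satisfying the Newton type recursion a P_a = c sum_l Y_l P_(a-l) are determined
   by it; the identities between [Sop] and [Qop] are all obtained in this way. *)
Section Recursions.
Variables (F : fieldType) (R : lmodType F).
Hypothesis charF : forall n : nat, (n.+1%:R : F) != 0.
Implicit Types (s : F) (f g : R) (a b l k : int).

Lemma intF_neq0 a : a != 0 -> (a%:~R : F) != 0.
Proof.
case: a => [[//|n]|n] _; first exact: charF.
by rewrite NegzE mulrNz oppr_eq0; apply: charF.
Qed.

Lemma int_scaleI a f g : a != 0 -> a%:~R *: f = a%:~R *: g -> f = g.
Proof. by move=> a0; apply: scalerI; apply: intF_neq0. Qed.

(** As Y_l vanishes for l <= 0, the right side involves smaller indices only, and a > 0 can be
    divided out. The inhomogeneous term I is there for commutators, as in [aop_Sop]. *)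
Lemma rec_uniq (Y : int -> R -> R) (c : F) (I U V : int -> R) :
  (forall l f, l <= 0 -> Y l f = 0) ->
  (forall a, a <= 0 -> U a = V a) ->
  (forall a, a%:~R *: U a = c *: lsum (fun l => Y l (U (a - l))) + I a) ->
  (forall a, a%:~R *: V a = c *: lsum (fun l => Y l (V (a - l))) + I a) ->
  forall a, U a = V a.
Proof.
move=> Y0 UV0 Urec Vrec.
suff h : forall (N : nat) a, a <= N%:Z -> U a = V a.
  by move=> a; apply: (h `|a|%N); lia.
elim=> [|N IH] a aN; first exact: UV0.
have [a0|a0] := lerP a 0; first exact: UV0.
apply: (@int_scaleI a); first by lia.
rewrite Urec Vrec; congr (_ *: _ + _); apply: eq_lsum => l.
have [l0|l0] := lerP l 0; first by rewrite !Y0.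
by rewrite IH //; lia.
Qed.

Lemma fsupp_rec (Y : int -> {linear R -> R}) (G : int -> R) a b :
  (forall l f, l <= 0 -> Y l f = 0) -> (forall b', b' < b -> G b' = 0) ->
  fsupp (fun l => Y l (G (a - l))).
Proof.
move=> Y0 G0; apply: (@fsuppI _ _ 1 (a - b)) => l hl; first by apply: Y0; lia.
by rewrite G0 ?linear0 //; lia.
Qed.

(** * Exponentials in the abstract: S with c s = s, and Q with c s = - s *)

Section Exponential.
Variables (Y : int -> {linear R -> R}) (P : F -> int -> {linear R -> R}).
Variable (c : F -> F).
Hypothesis Y_le0 : forall l f, l <= 0 -> Y l f = 0.
Hypothesis YC : forall l k f, Y l (Y k f) = Y k (Y l f).
Hypothesis P_lt0 : forall s a f, a < 0 -> P s a f = 0.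
Hypothesis P_0 : forall s f, P s 0 f = f.
Hypothesis P_rec : forall s a f,
  a%:~R *: P s a f = c s *: lsum (fun l => Y l (P s (a - l) f)).
Hypothesis cD : forall s s', c (s + s') = c s + c s'.

Lemma fsupp_YP s a f : fsupp (fun l => Y l (P s (a - l) f)).
Proof.
by apply: (@fsupp_rec _ (fun b => P s b f) a 0) => // b; apply: P_lt0.
Qed.

Lemma rec_YP s k a f : Y k (P s a f) = P s a (Y k f).
Proof.
move: a; apply: (@rec_uniq (fun l => Y l) (c s) (fun=> 0)) => //.
- move=> a; rewrite le_eqVlt => /orP[/eqP->|a0]; first by rewrite !P_0.
  by rewrite !P_lt0 ?linear0.
- move=> a; rewrite addr0 -linearZ_LR P_rec linearZ_LR raddf_lsum; last exact: fsupp_YP.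
  by congr (_ *: _); apply: eq_lsum => l /=; rewrite YC.
- by move=> a; rewrite addr0.
Qed.

Lemma rec_PP s a s' b f : P s a (P s' b f) = P s' b (P s a f).
Proof.
move: a; apply: (@rec_uniq (fun l => Y l) (c s) (fun=> 0)) => //.
- move=> a; rewrite le_eqVlt => /orP[/eqP->|a0]; first by rewrite !P_0.
  by rewrite !(P_lt0 s) ?linear0.
- by move=> a; rewrite addr0.
- move=> a; rewrite addr0 -linearZ_LR P_rec linearZ_LR raddf_lsum; last exact: fsupp_YP.
  by congr (_ *: _); apply: eq_lsum => l /=; rewrite [RHS]rec_YP.
Qed.

(** The exponential law. By the product rule for z d/dz the factor a splits as i + (a - i); the two
    parts produce c s ([E1]) and c s' ([E2]). *)
Lemma rec_conv s s' a f : P (s + s') a f = lsum (fun i => P s i (P s' (a - i) f)).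
Proof.
have fs2 b : fsupp (fun i => P s i (P s' (b - i) f)).
  apply: (@fsuppI _ _ 0 b) => i hi; first by rewrite P_lt0.
  by rewrite (P_lt0 s') ?linear0 //; lia.
move: a; apply: (@rec_uniq (fun l => Y l) (c (s + s')) (fun=> 0)) => //.
- move=> a; rewrite le_eqVlt => /orP[/eqP->|a0].
    rewrite P_0 (@lsum1 _ _ 0) ?subr0 ?P_0 // => i i0.
    have [h|h] := lerP 0 i; last by rewrite P_lt0.
    by rewrite (P_lt0 s') ?linear0 //; lia.
  rewrite P_lt0 // lsum0 // => i; have [h|h] := lerP 0 i; last by rewrite P_lt0.
  by rewrite (P_lt0 s') ?linear0 //; lia.
- by move=> a; rewrite addr0.
move=> a; rewrite addr0.
pose G l i := Y l (P s i (P s' (a - l - i) f)).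
have fsG l : fsupp (G l).
  apply: (@fsuppI _ _ 0 (a - l)) => i hi; first by rewrite /G P_lt0 ?linear0.
  by rewrite /G (P_lt0 s') ?linear0 //; lia.
have fs2G : fsupp2 (fun l i => G l i).
  apply: (@fsupp2I _ _ 1 a 0 a) => l i hi; rewrite /G.
  - by apply: Y_le0; lia.
  - have [h|h] := lerP 0 i; last by rewrite P_lt0 ?linear0.
    by rewrite (P_lt0 s') ?linear0 //; lia.
  - by rewrite P_lt0 ?linear0.
  - have [h|h] := lerP l 0; first exact: Y_le0.
    by rewrite (P_lt0 s') ?linear0 //; lia.
have fs2G' : fsupp2 (fun l i => G l (i - l)).
  apply: (@fsupp2I _ _ 1 a 0 a) => l i hi; rewrite /G.
  - by apply: Y_le0; lia.
  - have [h|h] := lerP l i; last by rewrite P_lt0 ?linear0 //; lia.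
    by rewrite (P_lt0 s') ?linear0 //; lia.
  - have [h|h] := lerP l 0; first exact: Y_le0.
    by rewrite P_lt0 ?linear0 //; lia.
  - have [h|h] := lerP l 0; first exact: Y_le0.
    by rewrite (P_lt0 s') ?linear0 //; lia.
have RE : lsum (fun l => Y l (lsum (fun i => P s i (P s' (a - l - i) f)))) =
          lsum (fun l => lsum (G l)).
  by apply: eq_lsum => l; rewrite raddf_lsum.
have E1 : lsum (fun i => i%:~R *: P s i (P s' (a - i) f)) = c s *: lsum (fun l => lsum (G l)).
  have GE l : lsum (G l) = lsum (fun i => G l (i - l)).
    by rewrite -(@lsum_shift _ (G l) (- l)).
  rewrite (eq_lsum GE) exchange_lsum //.
  have fsE : fsupp (fun i => lsum (fun l => G l (i - l))).
    apply: (@fsuppI _ _ 0 a) => i hi; apply: lsum0 => l; rewrite /G;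
    (have [h|h] := lerP l 0; first exact: Y_le0).
      by rewrite P_lt0 ?linear0 //; lia.
    by rewrite (P_lt0 s') ?linear0 //; lia.
  rewrite -[_ *: lsum _]/(( *:%R (c s)) (lsum _)) raddf_lsum //.
  apply: eq_lsum => i /=; rewrite P_rec; congr (_ *: _); apply: eq_lsum => l.
  by rewrite /G; congr (Y _ (P _ _ (P _ _ _))); lia.
have E2 : lsum (fun i => (a - i)%:~R *: P s i (P s' (a - i) f)) =
          c s' *: lsum (fun l => lsum (G l)).
  rewrite exchange_lsum //.
  have fsE : fsupp (fun i => lsum (fun l => G l i)).
    apply: (@fsuppI _ _ 0 a) => i hi; apply: lsum0 => l; rewrite /G;
    (have [h|h] := lerP l 0; first exact: Y_le0).
      by rewrite P_lt0 ?linear0 //; lia.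
    by rewrite (P_lt0 s') ?linear0 //; lia.
  rewrite -[_ *: lsum _]/(( *:%R (c s')) (lsum _)) raddf_lsum //.
  apply: eq_lsum => i /=; rewrite -linearZ_LR P_rec linearZ_LR raddf_lsum; last exact: fsupp_YP.
  congr (_ *: _); apply: eq_lsum => l.
  by rewrite /G [RHS]rec_YP; have -> : a - l - i = a - i - l by lia.
rewrite RE cD scalerDl -E1 -E2 -lsumD.
- rewrite -[_ *: lsum _]/(( *:%R (a%:~R)) (lsum _)) raddf_lsum //.
  by apply: eq_lsum => i /=; rewrite -scalerDl -intrD; congr (_%:~R *: _); lia.
- have [N hN] := fs2 a; exists N => i /hN /= ->; exact: scaler0.
- have [N hN] := fs2 a; exists N => i /hN /= ->; exact: scaler0.
Qed.
End Exponential.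
End Recursions.

Lemma scaler_lsum (F : fieldType) (R : lmodType F) (c : F) (G : int -> R) :
  fsupp G -> c *: lsum G = lsum (fun i => c *: G i).
Proof. by move=> fG; rewrite -[LHS]/(( *:%R c) (lsum G)) raddf_lsum. Qed.

Lemma fsuppZ (F : fieldType) (R : lmodType F) (c : F) (G : int -> R) :
  fsupp G -> fsupp (fun i => c *: G i).
Proof. by case=> N h; exists N => i /h->; rewrite scaler0. Qed.

Lemma fsuppD (V : zmodType) (G H : int -> V) :
  fsupp G -> fsupp H -> fsupp (fun i => G i + H i).
Proof.
case=> N h [M k]; exists (maxn N M) => i; rewrite geq_max => /andP[hN hM].
by rewrite h // k // addr0.
Qed.

Lemma fsuppN (V : zmodType) (G : int -> V) : fsupp G -> fsupp (fun i => - G i).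
Proof. by case=> N h; exists N => i /h->; rewrite oppr0. Qed.

Lemma lsumN (V : zmodType) (G : int -> V) :
  fsupp G -> lsum (fun i => - G i) = - lsum G.
Proof. by move=> fG; rewrite -[RHS]/(-%R (lsum G)) raddf_lsum. Qed.

Lemma fsupp_shift (V : zmodType) (G : int -> V) k : fsupp G -> fsupp (fun i => G (i + k)).
Proof. by case=> N h; exists (N + `|k|)%N => i hi; apply: h; lia. Qed.

(** * Contractions between annihilation and creation exponentials *)

Section Commutation.
Variable F : fieldType.
Hypothesis charF : forall n : nat, (n.+1%:R : F) != 0.
Local Notation R := (fcar (free_mod F {poly nat})).
Implicit Types (s : F) (f g : R) (c d : {poly nat}) (a b l k w : int).

Let X l : {linear R -> R} := xop l.
Let A l : {linear R -> R} := aop l.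
Let S s a : {linear R -> R} := Sop s a.
Let Q s a : {linear R -> R} := Qop s a.

Lemma xop_Sop s k a f : xop k (Sop s a f) = Sop s a (xop k f).
Proof.
apply: (@rec_YP F R charF X S id).
- by move=> *; apply: xop_le0.
- by move=> *; apply: xopC.
- by move=> *; apply: Sop_lt0.
- by move=> *; apply: Sop_0.
- by move=> *; apply: Sop_rec.
Qed.

Lemma SopC s a s' b f : Sop s a (Sop s' b f) = Sop s' b (Sop s a f).
Proof.
apply: (@rec_PP F R charF X S id).
- by move=> *; apply: xop_le0.
- by move=> *; apply: xopC.
- by move=> *; apply: Sop_lt0.
- by move=> *; apply: Sop_0.
- by move=> *; apply: Sop_rec.
Qed.

Lemma Sop_conv s s' a f : Sop (s + s') a f = lsum (fun i => Sop s i (Sop s' (a - i) f)).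
Proof.
apply: (@rec_conv F R charF X S id).
- by move=> *; apply: xop_le0.
- by move=> *; apply: xopC.
- by move=> *; apply: Sop_lt0.
- by move=> *; apply: Sop_0.
- by move=> *; apply: Sop_rec.
- by [].
Qed.

Lemma aop_Qop s k a f : aop k (Qop s a f) = Qop s a (aop k f).
Proof.
apply: (@rec_YP F R charF A Q (fun s => - s)).
- by move=> *; apply: aop_le0.
- by move=> *; apply: aopC.
- by move=> *; apply: Qop_lt0.
- by move=> *; apply: Qop_0.
- by move=> *; apply: Qop_rec.
Qed.

Lemma QopC s a s' b f : Qop s a (Qop s' b f) = Qop s' b (Qop s a f).
Proof.
apply: (@rec_PP F R charF A Q (fun s => - s)).
- by move=> *; apply: aop_le0.
- by move=> *; apply: aopC.
- by move=> *; apply: Qop_lt0.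
- by move=> *; apply: Qop_0.
- by move=> *; apply: Qop_rec.
Qed.

Lemma Qop_conv s s' a f : Qop (s + s') a f = lsum (fun i => Qop s i (Qop s' (a - i) f)).
Proof.
apply: (@rec_conv F R charF A Q (fun s => - s)).
- by move=> *; apply: aop_le0.
- by move=> *; apply: aopC.
- by move=> *; apply: Qop_lt0.
- by move=> *; apply: Qop_0.
- by move=> *; apply: Qop_rec.
- by move=> *; apply: opprD.
Qed.

Lemma fsupp_xS s a f : fsupp (fun l => xop l (Sop s (a - l) f)).
Proof.
apply: (@fsupp_rec F R X (fun b => Sop s b f) a 0) => [*|b b0]; first exact: xop_le0.
exact: Sop_lt0.
Qed.

Lemma fsupp_aQ s a f : fsupp (fun l => aop l (Qop s (a - l) f)).
Proof.
apply: (@fsupp_rec F R A (fun b => Qop s b f) a 0) => [*|b b0]; first exact: aop_le0.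
exact: Qop_lt0.
Qed.

(** Applying 2 l d/dx_l to the exponent s x_l z^l / l gives 2 s z^l. *)
Lemma aop_Sop s l a f :
  aop l (Sop s a f) = Sop s a (aop l f) + (if 0 < l then 2 * s else 0) *: Sop s (a - l) f.
Proof.
have [l0|l0] := ltrP 0 l; last by rewrite !aop_le0 // Sop0 scale0r addr0.
move: a; apply: (@rec_uniq F R charF (fun l => xop l) s
    (fun a => (s * (2 * l)%:~R) *: Sop s (a - l) f)) => //.
- by move=> *; apply: xop_le0.
- move=> a; rewrite le_eqVlt => /orP[/eqP->|a0].
    by rewrite !Sop_0 Sop_lt0 ?scaler0 ?addr0 //; lia.
  by rewrite !Sop_lt0 ?scaler0 ?addr0 ?aop0 //; lia.
- move=> a; rewrite -aopZ Sop_rec // aopZ raddf_lsum; last exact: fsupp_xS.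
  rewrite -scalerA -scalerDr; congr (_ *: _).
  under eq_lsum => k do rewrite /= aop_xop //.
  rewrite lsumD.
  + congr (_ + _); rewrite (@lsum1 _ _ l) ?eqxx // => k kl.
    by rewrite (negbTE kl) scale0r.
  + apply: (@fsupp_rec F R X (fun b => aop l (Sop s b f)) a 0) => [*|b b0].
      exact: xop_le0.
    by rewrite Sop_lt0 // aop0.
  + exists (`|l| + 1)%N => k hk; rewrite ifF ?scale0r //; lia.
- move=> a.
  have -> : lsum (fun k => xop k (Sop s (a - k) (aop l f) + (2 * s) *: Sop s (a - k - l) f)) =
     lsum (fun k => xop k (Sop s (a - k) (aop l f))) +
     (2 * s) *: lsum (fun k => xop k (Sop s (a - l - k) f)).
    rewrite scaler_lsum; last exact: fsupp_xS.
    rewrite -lsumD; [|exact: fsupp_xS|by apply: fsuppZ; apply: fsupp_xS].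
    by apply: eq_lsum => k; rewrite xopD xopZ; have -> : a - k - l = a - l - k by lia.
  rewrite [s *: (_ + _)]scalerDr [s *: ((2 * s) *: _)]scalerA [s * (2 * s)]mulrC.
  rewrite -[(2 * s * s) *: _]scalerA scalerDr -!Sop_rec // -addrA; congr (_ + _).
  by rewrite !scalerA -scalerDl; congr (_ *: _); rewrite !intrM intrD rmorphN /=; ring.
Qed.

(** The contraction of Q_s(y) with S_{s'}(z) is exp(- 2 s s' sum_k (z/y)^k / k) = (1 - z/y)^(2 s
    s'); the hypothesis makes the exponent one. *)
Lemma Qop_Sop s s' b a f : 2 * s * s' = 1 ->
  Qop s b (Sop s' a f) = Sop s' a (Qop s b f) - Sop s' (a - 1) (Qop s (b - 1) f).
Proof.
move=> ss'; move: b; apply: (@rec_uniq F R charF (fun l => aop l) (- s) (fun=> 0)).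
- by move=> *; apply: aop_le0.
- move=> b; rewrite le_eqVlt => /orP[/eqP->|b0].
    by rewrite !Qop_0 Qop_lt0 // Sop0 subr0.
  by rewrite !Qop_lt0 ?Sop0 ?subr0 //; lia.
- by move=> b; rewrite addr0 Qop_rec.
move=> b; rewrite addr0.
pose K l := if 0 < l then Sop s' (a - l) (Qop s (b - l) f) else 0.
pose K' l := if 0 < l then Sop s' (a - 1 - l) (Qop s (b - 1 - l) f) else 0.
have fK : fsupp K.
  apply: (@fsuppI _ _ 0 b) => l hl; rewrite /K; first by rewrite ifF //; lia.
  by case: ifP => // _; rewrite Qop_lt0 ?Sop0 //; lia.
have fK' : fsupp K'.
  apply: (@fsuppI _ _ 0 b) => l hl; rewrite /K'; first by rewrite ifF //; lia.
  by case: ifP => // _; rewrite Qop_lt0 ?Sop0 //; lia.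
(* K and K' collect the contraction terms of the two summands. They are the same geometric series in
   z/y up to a shift, so all but the first term cancels. *)
have KK' : lsum K = Sop s' (a - 1) (Qop s (b - 1) f) + lsum K'.
  rewrite -(lsum_shift (-1) fK').
  pose D l := if l == 1 then Sop s' (a - 1) (Qop s (b - 1) f) else 0.
  have <- : lsum D = Sop s' (a - 1) (Qop s (b - 1) f).
    by rewrite (@lsum1 _ _ 1) /D ?eqxx // => i /negbTE->.
  rewrite -lsumD; last exact: fsupp_shift.
    apply: eq_lsum => l; rewrite /K /K' /D.
    case: (eqVneq l 1) => [->|l1]; first by rewrite addr0.
    rewrite add0r; have -> : (0 < l - 1) = (0 < l) by lia.
    by case: ifP => // _; congr (Sop _ _ (Qop _ _ _)); lia.
  by exists 2%N => i hi; rewrite /D ifF //; lia.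
have fB a' b' : fsupp (fun l => Sop s' a' (aop l (Qop s (b' - l) f))).
  have [N hN] := fsupp_aQ s b' f; exists N => i /hN /= ->; exact: Sop0.
have E a' b' : lsum (fun l => Sop s' a' (aop l (Qop s (b' - l) f))) =
    Sop s' a' (lsum (fun l => aop l (Qop s (b' - l) f))).
  by rewrite raddf_lsum //; apply: fsupp_aQ.
have -> : lsum (fun l => aop l (Sop s' a (Qop s (b - l) f) - Sop s' (a - 1) (Qop s (b - l - 1) f)))
   = lsum (fun l => (Sop s' a (aop l (Qop s (b - l) f)) -
                     Sop s' (a - 1) (aop l (Qop s (b - 1 - l) f))) +
           (2 * s') *: (K l - K' l)).
  apply: eq_lsum => l; rewrite linearB /= !aop_Sop /K /K'.
  have -> : b - l - 1 = b - 1 - l by lia.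
  case: ifP => _; last by rewrite !scale0r subr0 !addr0 scaler0 addr0.
  by rewrite opprD addrACA -scalerBr.
have fKK : fsupp (fun l => K l - K' l) by apply: fsuppD => //; apply: fsuppN.
rewrite lsumD; [|apply: fsuppD => //; exact: fsuppN|exact: fsuppZ].
rewrite lsumD //; last exact: fsuppN.
rewrite lsumN // !E -scaler_lsum // lsumD //; last exact: fsuppN.
rewrite lsumN // KK' addrK [- s *: _]scalerDr [- s *: (_ *: _)]scalerA.
have -> : - s * (2 * s') = - 1 by rewrite -[in RHS]ss'; ring.
rewrite [- s *: (_ - _)]scalerBr -!SopZ -!Qop_rec // !SopZ scaleN1r scalerBr -addrA; congr (_ + _).
by rewrite -opprD -{3}[Sop _ _ _]scale1r -scalerDl; congr (- (_ *: _)); rewrite intrD; ring.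
Qed.

(** Q_1 is the product of two copies of Q_{1/2}, each contributing a factor 1 - z/y. *)
Lemma Qop_Sop2 a b f :
  Qop 1 b (Sop 1 a f) = Sop 1 a (Qop 1 b f)
     - 2 *: Sop 1 (a - 1) (Qop 1 (b - 1) f) + Sop 1 (a - 2) (Qop 1 (b - 2) f).
Proof.
pose t : F := 2^-1.
have two0 : (2 : F) != 0 by exact: (charF 1).
have tt : t + t = 1 by rewrite /t; field.
have t1 : 2 * t * 1 = 1 by rewrite /t; field.
rewrite -{1}tt Qop_conv.
have fT b' g : fsupp (fun i => Qop t i (Qop t (b' - i) g)).
  apply: (@fsuppI _ _ 0 b') => i hi; first by rewrite Qop_lt0.
  have -> : Qop t (b' - i) g = 0 by apply: Qop_lt0; lia.
  exact: Qop0.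
have E a' b' g : Sop 1 a' (Qop 1 b' g) = lsum (fun i => Sop 1 a' (Qop t i (Qop t (b' - i) g))).
  by rewrite -{2}tt Qop_conv raddf_lsum.
have fS a' b' g : fsupp (fun i => Sop 1 a' (Qop t i (Qop t (b' - i) g))).
  by have [N hN] := fT b' g; exists N => i /hN /= ->; exact: Sop0.
have E' a' b' g : Sop 1 a' (Qop 1 (b' - 1) g) =
    lsum (fun i => Sop 1 a' (Qop t (i - 1) (Qop t (b' - i) g))).
  rewrite E -(lsum_shift (-1)) //; apply: eq_lsum => i.
  by congr (Sop _ _ (Qop _ _ (Qop _ _ _))); lia.
have fS' a' b' g : fsupp (fun i => Sop 1 a' (Qop t (i - 1) (Qop t (b' - i) g))).
  have [N hN] := fsupp_shift (-1) (fS a' (b' - 1) g); exists N => i /hN /= <-.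
  by congr (Sop _ _ (Qop _ _ (Qop _ _ _))); lia.
have -> : lsum (fun i => Qop t i (Qop t (b - i) (Sop 1 a f))) =
  lsum (fun i => (Sop 1 a (Qop t i (Qop t (b - i) f))
               - Sop 1 (a - 1) (Qop t (i - 1) (Qop t (b - i) f)))
               + (- Sop 1 (a - 1) (Qop t i (Qop t (b - 1 - i) f))
               + Sop 1 (a - 2) (Qop t (i - 1) (Qop t (b - 1 - i) f)))).
  apply: eq_lsum => i; rewrite (Qop_Sop _ _ _ t1) linearB /= !(Qop_Sop _ _ _ t1).
  have -> : b - i - 1 = b - 1 - i by lia.
  have -> : a - 1 - 1 = a - 2 by lia.
  by rewrite opprD opprK.
rewrite lsumD; [|by apply: fsuppD => //; apply: fsuppN|by apply: fsuppD => //; apply: fsuppN].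
rewrite !lsumD //; try exact: fsuppN.
rewrite !lsumN // -!E -!E'; have -> : b - 1 - 1 = b - 2 by lia.
by rewrite !addrA; congr (_ + _); rewrite -addrA -opprD scaler_nat mulr2n.
Qed.

Lemma fil_Qop s b w f : fil w f -> fil (w - b) (Qop s b f).
Proof.
have [b0|b0] := ltrP b 0; first by rewrite Qop_lt0 // => _; apply: fil0.
rewrite Qop.unlock; apply: fil_lext => c cw; case: b b0 => // N _ d.
rewrite coef_Qvec polyseqK; case: ifP => [/eqP wd _|_]; last by rewrite eqxx.
by lia.
Qed.
End Commutation.

Lemma lsum_opp (V : zmodType) (G : int -> V) : fsupp G -> lsum (fun i => G (- i)) = lsum G.
Proof.
move=> [N GN]; rewrite (lsum_window GN) (@lsum_window _ _ N); last first.
  by move=> i hi; apply: GN; lia.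
rewrite (reindex_inj rev_ord_inj); apply: eq_bigr => i _ /=.
by congr G; have := ltn_ord i; lia.
Qed.

Lemma lsum_sum (V : zmodType) I (r : seq I) (P : pred I) (G : I -> int -> V) :
  (forall i, P i -> fsupp (G i)) ->
  lsum (fun l => \sum_(i <- r | P i) G i l) = \sum_(i <- r | P i) lsum (G i).
Proof.
move=> fG.
suff [//] : lsum (fun l => \sum_(i <- r | P i) G i l) = \sum_(i <- r | P i) lsum (G i)
   /\ fsupp (fun l => \sum_(i <- r | P i) G i l).
elim: r => [|i r [IH IHf]].
  split; last by exists 0%N => l _; rewrite big_nil.
  by rewrite big_nil; apply: lsum0 => l; rewrite big_nil.
case: (boolP (P i)) => Pi; last first.
  have E : (fun l => \sum_(j <- i :: r | P j) G j l) =1 (fun l => \sum_(j <- r | P j) G j l).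
    by move=> l; rewrite big_cons (negbTE Pi).
  rewrite (eq_lsum E) big_cons (negbTE Pi) IH; split => //.
  by case: IHf => N hN; exists N => l /hN; rewrite E.
have E : (fun l => \sum_(j <- i :: r | P j) G j l) =1
         (fun l => G i l + \sum_(j <- r | P j) G j l).
  by move=> l; rewrite big_cons Pi.
rewrite (eq_lsum E) big_cons Pi lsumD ?IH //; last exact: fG.
split => //; have [N hN] := fsuppD (fG i Pi) IHf.
by exists N => l /hN; rewrite E.
Qed.

Section LinearSums.
Variables (F : fieldType) (R : lmodType F).

Lemma lin_lsum_subproof (G : int -> {linear R -> R}) :
  (forall f, fsupp (fun i => G i f)) -> linear (fun f => lsum (fun i => G i f)).
Proof.
move=> fG a f g; rewrite scaler_lsum // -lsumD //; last exact: fsuppZ.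
by apply: eq_lsum => i; rewrite linearP.
Qed.

Definition lin_lsum (G : int -> {linear R -> R}) (fG : forall f, fsupp (fun i => G i f)) :
    {linear R -> R} :=
  HB.pack (fun f => lsum (fun i => G i f))
    (GRing.isLinear.Build F R R *:%R (fun f => lsum (fun i => G i f)) (lin_lsum_subproof fG)).

Lemma lin_lsumE G fG f : @lin_lsum G fG f = lsum (fun i => G i f).
Proof. by []. Qed.
End LinearSums.

Section GeneralizedBinomials.
Variable F : fieldType.
Hypothesis charF : forall n : nat, (n.+1%:R : F) != 0.
Implicit Types (n a b : int) (k : nat).

(** The coefficient of w^k in (1 + w)^n; negative n occurs when (z + w)^n is expanded in w. *)
Definition binz n k : F := (\prod_(i < k) (n - i%:Z)%:~R) / k`!%:R.

Lemma factF_neq0 k : (k`!%:R : F) != 0.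
Proof. by have := fact_gt0 k; case: k`! => // m _; apply: charF. Qed.

Lemma binz0 n : binz n 0 = 1.
Proof. by rewrite /binz big_ord0 fact0 divr1. Qed.

Lemma mul_binz_diag n k : k.+1%:R * binz n k.+1 = n%:~R * binz (n - 1) k.
Proof.
rewrite /binz big_ord_recl subr0 factS natrM.
have -> : \prod_(i < k) (n - (lift ord0 i)%:Z)%:~R = \prod_(i < k) (n - 1 - i%:Z)%:~R :> F.
  by apply: eq_bigr => i _; rewrite lift0; congr _%:~R; lia.
have := charF k; have := factF_neq0 k.
move: (\prod_(i < k) _) (k.+1%:R) (k`!%:R) (n%:~R) => p x y z y0 x0.
by field; rewrite ?x0 ?y0.
Qed.

Lemma binz_nat m k : binz (Posz m) k = 'C(m, k)%:R.
Proof.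
elim: k m => [|k IH] m; first by rewrite binz0 bin0.
apply: (mulfI (charF k)); rewrite mul_binz_diag -natrM.
case: m => [|m]; first by rewrite mul0r bin0n muln0.
have -> : m.+1%:Z - 1 = m%:Z by lia.
by rewrite IH -[_%:~R]/(m.+1%:R) -natrM mul_bin_diag.
Qed.

Lemma Vandermonde_binz a b k :
  binz (a + b) k = \sum_(j < k.+1) binz a j * binz b (k - j).
Proof.
elim: k a b => [|k IH] a b; first by rewrite big_ord1 !binz0 mulr1.
apply: (mulfI (charF k)); rewrite mul_binz_diag intrD mulrDl.
have E1 : binz (a + b - 1) k = \sum_(j < k.+1) binz (a - 1) j * binz b (k - j).
  by rewrite -IH; congr binz; lia.
have E2 : binz (a + b - 1) k = \sum_(j < k.+1) binz a j * binz (b - 1) (k - j).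
  by rewrite -IH; congr binz; lia.
rewrite {1}E1 E2 {E1 E2}.
rewrite !mulr_sumr.
(* The product rule for (1 + w)^a (1 + w)^b; the weights j and k + 1 - j add up to k + 1. *)
transitivity (\sum_(j < k.+2) (j%:R * binz a j) * binz b (k.+1 - j) +
              \sum_(j < k.+2) binz a j * ((k.+1 - j)%:R * binz b (k.+1 - j))).
  congr (_ + _).
    rewrite [RHS]big_ord_recl /= mulr0n !mul0r add0r; apply: eq_bigr => j _.
    by rewrite /bump add1n subSS mul_binz_diag mulrA.
  rewrite [RHS]big_ord_recr /= subnn mul0r mulr0 addr0; apply: eq_bigr => j _ /=.
  by rewrite subSn ?mul_binz_diag ?(mulrCA _ b%:~R) //; have := ltn_ord j.
rewrite -big_split; apply: eq_bigr => j _ /=.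
have -> : k.+1%:R = j%:R + (k.+1 - j)%:R :> F.
  by rewrite -natrD subnKC //; have := ltn_ord j.
by ring.
Qed.

Lemma binz_neg l k : binz (- l%:Z - 1) k = (-1) ^+ k * 'C(k + l, l)%:R.
Proof.
elim: k l => [|k IH] l; first by rewrite binz0 expr0 mul1r add0n binn.
apply: (mulfI (charF k)); rewrite mul_binz_diag.
have -> : - l%:Z - 1 - 1 = - l.+1%:Z - 1 by lia.
rewrite IH.
have -> : (- l%:Z - 1)%:~R = - l.+1%:R :> F.
  by have -> : - l%:Z - 1 = - l.+1%:Z by lia; rewrite mulrNz.
rewrite exprS mulN1r !mulNr !mulrN; congr (- _).
rewrite mulrCA -natrM [RHS]mulrCA -natrM; congr (_ * _%:R).
by rewrite addnS -addSn mul_bin_left addnK.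
Qed.
End GeneralizedBinomials.

(** * Formal fields *)

Section Fields.
Variable F : fieldType.
Hypothesis charF : forall n : nat, (n.+1%:R : F) != 0.
Local Notation R := (fcar (free_mod F {poly nat})).
Implicit Types (s : F) (f g : R) (a b l m n j w r kap : int) (k i : nat).

(* [fm B j] is the coefficient of z^j in B(z), i.e. the mode of index -j-1; [fbd] witnesses
   that B(z) f has only finitely many negative powers of z. *)
Record vfield := VField {
  fm :> int -> {linear R -> R};
  fbd : int;
  fvan : forall j w f, fil w f -> j + w + fbd < 0 -> fm j f = 0
}.

(** Setting both variables near z sums over n with n + m fixed. The bounds on n and on m make this
    sum finite, and the bound on n + m truncates the resulting field. *)
Record bifield := BiField {
  bm :> int -> int -> {linear R -> R};
  bbd1 : int; bbd2 : int; bbd3 : int;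
  bvan1 : forall n m w f, fil w f -> n + w + bbd1 < 0 -> bm n m f = 0;
  bvan2 : forall n m w f, fil w f -> m + w + bbd2 < 0 -> bm n m f = 0;
  bvan3 : forall n m w f, fil w f -> n + m + w + bbd3 < 0 -> bm n m f = 0
}.
Implicit Types (B : vfield) (X : bifield).

Definition eqf B B' := forall j f, B j f = B' j f.

(* The mode alpha(l), l >= 0, on charge r. *)
Definition az r l f : R := if l == 0 then (2 * r)%:~R *: f else aop l f.

Lemma az_is_linear r l : linear (az r l).
Proof.
move=> a f g; rewrite /az; case: eqP => _; last by rewrite linearP.
by rewrite scalerDr !scalerA mulrC.
Qed.
HB.instance Definition _ r l := GRing.isLinear.Build F R R *:%R (az r l) (az_is_linear r l).

Lemma az_gt0 r l f : 0 < l -> az r l f = aop l f.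
Proof. by move=> l0; rewrite /az ifF //; lia. Qed.

Lemma az0 r f : az r 0 f = (2 * r)%:~R *: f.
Proof. by []. Qed.

Lemma azC r r' l n f : az r l (az r' n f) = az r' n (az r l f).
Proof.
rewrite /az; case: eqP => _; case: eqP => _; rewrite ?aopZ //; last exact: aopC.
by rewrite !scalerA mulrC.
Qed.

Lemma fil_az r l w f : fil w f -> fil (w - l) (az r l f).
Proof.
move=> wf; rewrite /az; case: eqP => [->|_]; last exact: fil_aop.
by rewrite subr0; apply: filZ.
Qed.

Lemma fil_azN r l w f : fil w f -> fil (w + l) (az r (- l) f).
Proof. by move=> wf; rewrite -[X in w + X]opprK; apply: fil_az. Qed.

(** The normally ordered product of alpha(-l) and T: creation acts after T, the zero mode and
    annihilation before it. *)
Definition Lop r l (T : {linear R -> R}) : {linear R -> R} :=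
  if 0 < l then (xop l \o T : {linear R -> R}) else (T \o az r (- l) : {linear R -> R}).

Lemma LopE r l (T : {linear R -> R}) f :
  Lop r l T f = if 0 < l then xop l (T f) else T (az r (- l) f).
Proof. by rewrite /Lop; case: ifP. Qed.

(** Creation and annihilation stay on opposite sides of T, so no Heisenberg commutator arises. *)
Lemma LopC r l l' (T T' T'' : {linear R -> R}) f :
  (forall g, T' g = Lop r l' T g) -> (forall g, T'' g = Lop r l T g) ->
  Lop r l T' f = Lop r l' T'' f.
Proof.
move=> E' E''; rewrite !LopE !E' !E'' !LopE.
case: ifP => l0; case: ifP => l'0 //; first by rewrite xopC.
by rewrite azC.
Qed.

Lemma Nop_fsupp r k B j f :
  fsupp (fun l => (binz F (l - 1) k.-1 \*: Lop r l (B (j + k%:Z - l))) f).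
Proof.
have [w w0 wf] := fil_ex f.
apply: (@fsuppI _ _ (- w) (`|j|%N%:Z + k%:Z + w + `|fbd B|%N%:Z)) => l hl /=; rewrite LopE.
  rewrite ifF; last by lia.
  have -> : az r (- l) f = 0 by apply: (@fil_lt0 _ (w + l)); [lia|apply: fil_azN].
  by rewrite linear0 scaler0.
rewrite ifT; last by lia.
by rewrite (@fvan B _ w) ?xop0 ?scaler0 //; lia.
Qed.

Lemma Nop_van r k B j w f : fil w f -> j + w + (fbd B + k%:Z) < 0 ->
  lin_lsum (Nop_fsupp r k B j) f = 0.
Proof.
move=> wf h; apply: lsum0 => l /=; rewrite LopE; case: ifP => l0.
  by rewrite (@fvan B _ w) ?xop0 ?scaler0 //; lia.
rewrite (@fvan B _ (w + l)) ?scaler0 //; last by lia.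
exact: fil_azN.
Qed.

(* The field of alpha(-k) b on charge r, when B is the field of b. *)
Definition Nop r k B : vfield := VField (@Nop_van r k B).

(** The binomial coefficients come from the derivative of order k - 1 of alpha(z), divided by
    (k-1)!, which is sum_l C(l-1, k-1) alpha(-l) z^(l-k). *)
Lemma NopE r k B j f :
  Nop r k B j f = lsum (fun l => binz F (l - 1) k.-1 *: Lop r l (B (j + k%:Z - l)) f).
Proof. by []. Qed.

Lemma NP_fsupp s kap B n m f :
  fsupp (fun b => (Sop s (n + b - kap) \o B m \o Qop s b : {linear R -> R}) f).
Proof.
have [w w0 wf] := fil_ex f.
apply: (@fsuppI _ _ 0 w) => b hb /=; first by rewrite Qop_lt0 // linear0 Sop0.
have -> : Qop s b f = 0 by apply: (@fil_lt0 _ (w - b)); [lia|apply: fil_Qop].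
by rewrite linear0 Sop0.
Qed.

Lemma NP_van1 s kap B n m w f : fil w f -> n + w - kap < 0 ->
  lin_lsum (NP_fsupp s kap B n m) f = 0.
Proof.
move=> wf h; apply: lsum0 => b /=.
case: (ltrP w b) => hb; last by rewrite Sop_lt0 //; lia.
have -> : Qop s b f = 0 by apply: (@fil_lt0 _ (w - b)); [lia|apply: fil_Qop].
by rewrite linear0 Sop0.
Qed.

Lemma NP_van2 s kap B n m w f : fil w f -> m + w + fbd B < 0 ->
  lin_lsum (NP_fsupp s kap B n m) f = 0.
Proof.
move=> wf h; apply: lsum0 => b /=.
case: (ltrP b 0) => hb; first by rewrite Qop_lt0 // linear0 Sop0.
by rewrite (@fvan B _ (w - b)) ?Sop0 //; [apply: fil_Qop | lia].
Qed.

Lemma NP_van3 s kap B n m w f : fil w f -> n + m + w + (fbd B - kap) < 0 ->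
  lin_lsum (NP_fsupp s kap B n m) f = 0.
Proof.
move=> wf h; apply: lsum0 => b /=.
case: (ltrP (n + b - kap) 0) => hb; first by rewrite Sop_lt0.
by rewrite (@fvan B _ (w - b)) ?Sop0 //; [apply: fil_Qop | lia].
Qed.

(* The normally ordered product t^kap S_s(t) B(z) Q_s(t). *)
Definition NP s kap B : bifield := @BiField (fun n m => lin_lsum (NP_fsupp s kap B n m))
  (- kap) (fbd B) (fbd B - kap) (@NP_van1 s kap B) (@NP_van2 s kap B) (@NP_van3 s kap B).

Lemma NPE s kap B n m f :
  NP s kap B n m f = lsum (fun b => Sop s (n + b - kap) (B m (Qop s b f))).
Proof. by []. Qed.

Lemma Res_fsupp k X j f : fsupp (fun n => (binz F n k \*: X n (j - n + k%:Z)) f).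
Proof.
have [w w0 wf] := fil_ex f.
apply: (@fsuppI _ _ (- w - bbd1 X) (j + k%:Z + w + bbd2 X)) => n hn /=.
  by rewrite (@bvan1 X _ _ w) ?scaler0 //; lia.
by rewrite (@bvan2 X _ _ w) ?scaler0 //; lia.
Qed.

Lemma Res_van k X j w f : fil w f -> j + w + (bbd3 X + k%:Z) < 0 ->
  lin_lsum (Res_fsupp k X j) f = 0.
Proof.
move=> wf h; apply: lsum0 => n /=.
by rewrite (@bvan3 X _ _ w) ?scaler0 //; lia.
Qed.

(* The coefficient of w^k in X(z + w, z), expanded in nonnegative powers of w. *)
Definition Res k X : vfield := VField (@Res_van k X).

Lemma ResE k X j f : Res k X j f = lsum (fun n => binz F n k *: X n (j - n + k%:Z) f).
Proof. by []. Qed.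

Lemma eqf_Nop r k B B' : eqf B B' -> eqf (Nop r k B) (Nop r k B').
Proof.
by move=> E j f; rewrite !NopE; apply: eq_lsum => l; rewrite !LopE !E.
Qed.

End Fields.

(** * Differential equation of normally ordered exponentials *)

Section FieldIdentities.
Variable F : fieldType.
Hypothesis charF : forall n : nat, (n.+1%:R : F) != 0.
Local Notation R := (fcar (free_mod F {poly nat})).
Implicit Types (s : F) (f g : R) (a b l m n j w r kap : int) (k i : nat).
Implicit Types (B : vfield F) (X : bifield F).

Lemma fsupp_Lop_bi r X n m f : fsupp (fun l => Lop r l (X (n - l) m) f).
Proof.
have [w w0 wf] := fil_ex f.
apply: (@fsuppI _ _ (- w) (`|n|%N%:Z + w + `|bbd1 X|%N%:Z)) => l hl; rewrite LopE.
  rewrite ifF; last by lia.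
  have -> : az r (- l) f = 0 by apply: (@fil_lt0 _ (w + l)); [lia|apply: fil_azN].
  by rewrite linear0.
rewrite ifT; last by lia.
by rewrite (@bvan1 _ X _ _ w) ?xop0 //; lia.
Qed.

(** Applying t d/dt to X = t^kap S_s(t) B(z) Q_s(t) multiplies it by s t alpha(t), normally ordered.
    The condition on kap says that t^kap accounts for the zero mode alpha(0) = 2 r. *)
Lemma NP_deriv s kap r B n m f : kap%:~R = 2 * r%:~R * s :> F ->
  n%:~R *: NP s kap B n m f = s *: lsum (fun l => Lop r l (NP s kap B (n - l) m) f).
Proof.
move=> kapE.
have [w w0 wf] := fil_ex f.
have Qw b : w < b -> Qop s b f = 0.
  by move=> hb; apply: (@fil_lt0 _ (w - b)); [lia|apply: fil_Qop].
have fs0 : fsupp (fun b => Sop s (n + b - kap) (B m (Qop s b f))).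
  exact: (NP_fsupp s kap B n m f).
pose U b := Sop s (n + b - kap) (B m (Qop s b f)).
have fU : fsupp U := fs0.
pose G1 l b := xop l (Sop s (n + b - kap - l) (B m (Qop s b f))).
pose G2 l b := Sop s (n + b - kap) (B m (aop l (Qop s (b - l) f))).
have fG1 : fsupp2 (fun l b => G1 l b).
  apply: (@fsupp2I _ _ 1 (n + w - kap) 0 w) => l b h; rewrite /G1.
  - by apply: xop_le0; lia.
  - case: (lerP b w) => hb; last by rewrite Qw // linear0 Sop0 xop0.
    by rewrite Sop_lt0 ?xop0 //; lia.
  - by rewrite Qop_lt0 // linear0 Sop0 xop0.
  - by rewrite Qw // linear0 Sop0 xop0.
have fG2 : fsupp2 (fun l b => G2 l b).
  have Gw l b : w < b -> G2 l b = 0.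
    move=> hb; rewrite /G2; have -> : aop l (Qop s (b - l) f) = 0.
      by apply: (@fil_lt0 _ (w - (b - l) - l)); [lia | apply/fil_aop/fil_Qop].
    by rewrite linear0 Sop0.
  apply: (@fsupp2I _ _ 1 w 1 w) => l b h //.
  - by rewrite /G2 aop_le0 ?linear0 ?Sop0 //; lia.
  - case: (lerP b w) => hb; last exact: Gw.
    by rewrite /G2 Qop_lt0 ?aop0 ?linear0 ?Sop0 //; lia.
  - rewrite /G2; case: (lerP l 0) => l0; first by rewrite aop_le0 ?linear0 ?Sop0.
    by rewrite Qop_lt0 ?aop0 ?linear0 ?Sop0 //; lia.
  - exact: Gw.
(* The factor n is split as (n + b - kap) + (- b) + kap; the parts give the creation operators, the
   annihilation operators and the zero mode. *)
have E1 : lsum (fun b => (n + b - kap)%:~R *: U b) = s *: lsum (fun l => lsum (G1 l)).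
  rewrite exchange_lsum // scaler_lsum; last first.
    case: fG1 => N hN; exists N => b hb; apply: lsum0 => l; apply: hN; rewrite hb.
    by rewrite orbT.
  by apply: eq_lsum => b; rewrite /U Sop_rec.
have E2 : lsum (fun b => (- b)%:~R *: U b) = s *: lsum (fun l => lsum (G2 l)).
  rewrite exchange_lsum // scaler_lsum; last first.
    case: fG2 => N hN; exists N => b hb; apply: lsum0 => l; apply: hN; rewrite hb.
    by rewrite orbT.
  apply: eq_lsum => b; rewrite /U mulrNz scaleNr.
  have -> : b%:~R *: Sop s (n + b - kap) (B m (Qop s b f)) =
            Sop s (n + b - kap) (B m (b%:~R *: Qop s b f)) by rewrite linearZ_LR SopZ.
  rewrite Qop_rec // scaleNr linearN linearZ_LR raddf_lsum; last exact: fsupp_aQ.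
  rewrite linearN /= opprK SopZ raddf_lsum //.
  by have [N hN] := fsupp_aQ s b f; exists N => l /hN ->; apply: linear0.
have E3 : lsum (fun b => kap%:~R *: U b) = s *: (NP s kap B n m (az r 0 f)).
  rewrite az0 linearZ_LR NPE scalerA -scaler_lsum //; congr (_ *: _).
  by rewrite kapE intrM; ring.
have LE : lsum (fun l => Lop r l (NP s kap B (n - l) m) f) =
  lsum (fun l => lsum (G1 l)) + lsum (fun l => lsum (G2 l)) + NP s kap B n m (az r 0 f).
  pose D l := if l == 0 then NP s kap B n m (az r 0 f) else 0.
  have DE : lsum D = NP s kap B n m (az r 0 f).
    by rewrite (@lsum1 _ _ 0) /D ?eqxx // => l /negbTE->.
  have fD : fsupp D by exists 1%N => l hl; rewrite /D ifF //; lia.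
  have f1 : fsupp (fun l => lsum (G1 l)).
    by case: fG1 => N hN; exists N => l hl; apply: lsum0 => b; apply: hN; rewrite hl.
  have f2 : fsupp (fun l => lsum (G2 l)).
    by case: fG2 => N hN; exists N => l hl; apply: lsum0 => b; apply: hN; rewrite hl.
  have f2' : fsupp (fun l => lsum (G2 (- l))).
    by case: f2 => N hN; exists N => l hl; apply: hN; rewrite abszN.
  rewrite -(lsum_opp f2) -DE -!lsumD //; last exact: fsuppD.
  apply: eq_lsum => l; rewrite LopE /D; case: ifP => l0.
    rewrite ifF; last by lia.
    rewrite addr0 [lsum (G2 _)]lsum0 ?addr0; last first.
      by move=> b; rewrite /G2 aop_le0 ?linear0 ?Sop0 //; lia.
    rewrite NPE raddf_lsum; last exact: (NP_fsupp s kap B (n - l) m f).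
    by apply: eq_lsum => b; rewrite /G1; congr (xop _ (Sop _ _ _)); lia.
  rewrite [lsum (G1 _)]lsum0 ?add0r; last first.
    by move=> b; rewrite /G1 xop_le0 //; lia.
  case: eqP => [->|/eqP nl0].
    rewrite subr0 oppr0 [lsum (G2 _)]lsum0 ?add0r // => b.
    by rewrite /G2 aop_le0 ?linear0 ?Sop0 //; lia.
  rewrite addr0 az_gt0; last by lia.
  rewrite NPE.
  have fs : fsupp (fun b => Sop s (n - l + b - kap) (B m (Qop s b (aop (- l) f)))).
    exact: (NP_fsupp s kap B (n - l) m (aop (- l) f)).
  rewrite -(lsum_shift l fs); apply: eq_lsum => b; rewrite /G2 opprK aop_Qop //.
  by congr (Sop _ _ (B _ (Qop _ _ _))); lia.
rewrite LE !scalerDr -E1 -E2 -E3 NPE scaler_lsum // -!lsumD; first last.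
- have [N hN] := fU; exists N => b /hN ->; exact: scaler0.
- have [N hN] := fU; exists N => b /hN ->; exact: scaler0.
- exact: fsuppZ.
- apply: fsuppD; have [N hN] := fU; exists N => b /hN ->; exact: scaler0.
apply: eq_lsum => b; rewrite -/(U b) -!scalerDl -!intrD; congr (_%:~R *: _); lia.
Qed.

(** By hypothesis d/dw X(z + w, z) is s times the normally ordered product of alpha(z + w) and X(z +
    w, z), and the coefficient of w^i in alpha(z + w) is the field of alpha(-i-1). *)
Lemma Res_rec s r X : (forall n m f,
    n%:~R *: X n m f = s *: lsum (fun l => Lop r l (X (n - l) m) f)) ->
  forall k j f, k.+1%:R *: Res k.+1 X j f =
    s *: \sum_(i < k.+1) Nop r i.+1 (Res (k - i) X) j f.
Proof.
move=> Xd k j f.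
have [w w0 wf] := fil_ex f.
pose H l n := Lop r l (X n (j + k%:Z + 1 - l - n)) f.
have Xlo n m l : n + w + bbd1 X < 0 -> l <= 0 -> X n m (az r (- l) f) = 0.
  by move=> hn l0; apply: (@bvan1 _ X _ _ (w + l)); [apply: fil_azN | lia].
have az0' l : l < - w -> az r (- l) f = 0.
  by move=> hl; apply: (@fil_lt0 _ (w + l)); [lia|apply: fil_azN].
have Hl l n : l < - w -> H l n = 0.
  by move=> hl; rewrite /H LopE ifF ?az0' ?linear0 //; lia.
have Hn l n : n < - w - bbd1 X -> H l n = 0.
  move=> hn; rewrite /H LopE; case: ifP => l0; last by rewrite Xlo //; lia.
  by rewrite (@bvan1 _ X _ _ w) ?xop0 //; lia.
pose T := `|j|%N%:Z + k%:Z + w + 1 + `|bbd2 X|%N%:Z + `|bbd1 X|%N%:Z + w.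
have Hln l n : T < l + n -> H l n = 0.
  rewrite /T => hn; rewrite /H LopE; case: ifP => l0.
    by rewrite (@bvan2 _ X _ _ w) ?xop0 //; lia.
  by apply: (@bvan2 _ X _ _ (w + l)); [apply: fil_azN | lia].
have fH l : fsupp (H l).
  apply: (@fsuppI _ _ (- w - bbd1 X) (T - l)) => n hn; first exact: Hn.
  by apply: Hln; lia.
have fH2 : fsupp2 H.
  apply: (@fsupp2I _ _ (- w) (T + w + bbd1 X) (- w - bbd1 X) (T + w)) => l n h.
  - exact: Hl.
  - by case: (ltrP n (- w - bbd1 X)) => hn; [apply: Hn | apply: Hln; lia].
  - exact: Hn.
  - by case: (ltrP l (- w)) => hl; [apply: Hl | apply: Hln; lia].
have fZH2 (c : int -> int -> F) : fsupp2 (fun l n => c l n *: H l n).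
  by case: fH2 => N hN; exists N => l n /hN->; rewrite scaler0.
have fZH (c : int -> F) l : fsupp (fun n => c n *: H l n).
  by case: (fH l) => N hN; exists N => n /hN->; rewrite scaler0.
have LHS_E : k.+1%:R *: Res k.+1 X j f =
    s *: lsum (fun l => lsum (fun n => binz F (n + l - 1) k *: H l n)).
  rewrite ResE scaler_lsum; last exact: (Res_fsupp k.+1 X j f).
  transitivity (lsum (fun n => s *: lsum (fun l => binz F (n - 1) k *: H l (n - l)))).
    apply: eq_lsum => n.
    rewrite scalerA mul_binz_diag // mulrC -scalerA Xd scalerA mulrC -scalerA.
    rewrite scaler_lsum; last exact: fsupp_Lop_bi.
    congr (_ *: _); apply: eq_lsum => l; congr (_ *: _); rewrite /H.
    by congr (Lop r l (X _ _) f); lia.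
  have fs2 : fsupp2 (fun l n => binz F (n - 1) k *: H l (n - l)).
    apply: (@fsupp2I _ _ (- w) (T + w + bbd1 X) (- w - bbd1 X - w) T) => l n h.
    - by rewrite Hl ?scaler0.
    - rewrite [H _ _](_ : _ = 0) ?scaler0 //.
      by case: (ltrP (n - l) (- w - bbd1 X)) => hn; [apply: Hn | apply: Hln; lia].
    - rewrite [H _ _](_ : _ = 0) ?scaler0 //.
      by case: (ltrP l (- w)) => hl; [apply: Hl | apply: Hn; lia].
    - by rewrite Hln ?scaler0 //; lia.
  rewrite -scaler_lsum; last first.
    by case: fs2 => N hN; exists N => n hn; apply: lsum0 => l; apply: hN; rewrite hn orbT.
  congr (_ *: _); rewrite -(exchange_lsum fs2); apply: eq_lsum => l.
  rewrite -[RHS](lsum_shift (- l)); last exact: fZH.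
  by apply: eq_lsum => n; congr (binz F _ k *: _); lia.
rewrite LHS_E; congr (_ *: _).
(* [Vandermonde_binz] expands the two factors in w separately. *)
transitivity (lsum (fun l => \sum_(i < k.+1)
    binz F (l - 1) i *: lsum (fun n => binz F n (k - i) *: H l n))).
  apply: eq_lsum => l.
  under eq_bigr => i _ do rewrite scaler_lsum //.
  rewrite -lsum_sum; last by move=> i _; apply/fsuppZ/fZH.
  apply: eq_lsum => n; have -> : n + l - 1 = (l - 1) + n by lia.
  by rewrite Vandermonde_binz // scaler_suml; apply: eq_bigr => i _; rewrite scalerA.
rewrite lsum_sum; last first.
  move=> i _; apply: (@fsuppI _ _ (- w) (T + w + bbd1 X)) => l hl.
    by rewrite lsum0 ?scaler0 // => n; rewrite Hl ?scaler0.
  rewrite lsum0 ?scaler0 // => n.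
  rewrite [H _ _](_ : _ = 0) ?scaler0 //.
  by case: (ltrP n (- w - bbd1 X)) => hn; [apply: Hn | apply: Hln; lia].
apply: eq_bigr => i _; rewrite NopE /=; apply: eq_lsum => l; congr (_ *: _).
have lt_i := ltn_ord i.
rewrite LopE; case: ifP => l0.
  rewrite lin_lsumE raddf_lsum; last exact: (Res_fsupp (k - i) X (j + i.+1%:Z - l) f).
  apply: eq_lsum => n /=; rewrite xopZ /H LopE l0; congr (_ *: xop _ (X _ _ _)); lia.
rewrite lin_lsumE; apply: eq_lsum => n /=; rewrite /H LopE l0.
by congr (_ *: X _ _ _); lia.
Qed.
End FieldIdentities.

Lemma exchange_lsum3 (V : zmodType) (G : int -> int -> int -> V) (N : nat) :
  (forall a b c, [|| N <= `|a|, N <= `|b| | N <= `|c|]%N -> G a b c = 0) ->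
  lsum (fun a => lsum (fun b => lsum (fun c => G a b c))) =
  lsum (fun c => lsum (fun b => lsum (fun a => G a b c))).
Proof.
move=> G0.
transitivity (lsum (fun a => lsum (fun c => lsum (fun b => G a b c)))).
  apply: eq_lsum => a; apply: exchange_lsum; exists N => b c h; apply: G0.
  by rewrite h orbT.
rewrite exchange_lsum; last first.
  exists N => a c h; apply: lsum0 => b; apply: G0.
  by case/orP: h => ->; rewrite ?orbT.
apply: eq_lsum => c; apply: exchange_lsum; exists N => a b h; apply: G0.
by case/orP: h => ->; rewrite ?orbT.
Qed.

(** * Products of fields *)

Section FieldProducts.
Variable F : fieldType.
Hypothesis charF : forall n : nat, (n.+1%:R : F) != 0.
Local Notation R := (fcar (free_mod F {poly nat})).
Implicit Types (s : F) (f g : R) (a b l m n j w r kap M : int) (k i : nat).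
Implicit Types (B : vfield F) (X : bifield F).

Lemma Lop_scale r l (c : F) (T : {linear R -> R}) f : Lop r l (c \*: T) f = c *: Lop r l T f.
Proof. by rewrite !LopE; case: ifP => //= _; rewrite xopZ. Qed.

Lemma Lop_lsum r l (G : int -> {linear R -> R}) (fG : forall f, fsupp (fun a => G a f)) f :
  Lop r l (lin_lsum fG) f = lsum (fun a => Lop r l (G a) f).
Proof.
rewrite LopE lin_lsumE; case: ifP => l0.
  by rewrite raddf_lsum //; apply: eq_lsum => a; rewrite LopE l0.
by rewrite lin_lsumE; apply: eq_lsum => a; rewrite LopE l0.
Qed.

Lemma fsupp2_Lop_bi r X M f : fsupp2 (fun l n => Lop r l (X n (M - l - n)) f).
Proof.
have [w w0 wf] := fil_ex f.
pose H l n := Lop r l (X n (M - l - n)) f.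
have Hl l n : l < - w -> H l n = 0.
  move=> hl; rewrite /H LopE ifF; last by lia.
  have -> : az r (- l) f = 0 by apply: (@fil_lt0 _ (w + l)); [lia|apply: fil_azN].
  exact: linear0.
have Hn l n : n < - w - bbd1 X -> H l n = 0.
  move=> hn; rewrite /H LopE; case: ifP => l0.
    by rewrite (@bvan1 _ X _ _ w) ?xop0 //; lia.
  by apply: (@bvan1 _ X _ _ (w + l)); [apply: fil_azN | lia].
pose T := `|M|%N%:Z + w + `|bbd2 X|%N%:Z + `|bbd1 X|%N%:Z + w.
have Hln l n : T < l + n -> H l n = 0.
  rewrite /T => hn; rewrite /H LopE; case: ifP => l0.
    by rewrite (@bvan2 _ X _ _ w) ?xop0 //; lia.
  by apply: (@bvan2 _ X _ _ (w + l)); [apply: fil_azN | lia].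
apply: (@fsupp2I _ _ (- w) (T + w + bbd1 X) (- w - bbd1 X) (T + w)) => l n h; rewrite -/(H l n).
- exact: Hl.
- by case: (ltrP n (- w - bbd1 X)) => hn; [apply: Hn | apply: Hln; lia].
- exact: Hn.
- by case: (ltrP l (- w)) => hl; [apply: Hl | apply: Hln; lia].
Qed.

Lemma fsupp2_Lop_Lop r B M f : fsupp2 (fun l l' => Lop r l (Lop r l' (B (M - l - l'))) f).
Proof.
have [w w0 wf] := fil_ex f.
pose H l l' := Lop r l (Lop r l' (B (M - l - l'))) f.
have Hl l l' : l < - w -> H l l' = 0.
  move=> hl; rewrite /H LopE ifF; last by lia.
  have -> : az r (- l) f = 0 by apply: (@fil_lt0 _ (w + l)); [lia|apply: fil_azN].
  exact: linear0.
have Hl' l l' : l' < - w -> H l l' = 0.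
  move=> hl; rewrite /H LopE; case: ifP => l0; rewrite LopE ifF; try by lia.
    have -> : az r (- l') f = 0 by apply: (@fil_lt0 _ (w + l')); [lia|apply: fil_azN].
    by rewrite linear0 xop0.
  have -> : az r (- l') (az r (- l) f) = 0.
    by apply: (@fil_lt0 _ (w + l + l')); [lia|apply/fil_azN/fil_azN].
  exact: linear0.
pose T := `|M|%N%:Z + w + `|fbd B|%N%:Z.
have Hll l l' : T < l + l' -> H l l' = 0.
  rewrite /T => hn; rewrite /H LopE; case: ifP => l0; rewrite LopE; case: ifP => l0'.
  - by rewrite (@fvan _ B _ w) ?xop0 //; lia.
  - by rewrite (@fvan _ B _ (w + l')) ?xop0 //; [apply: fil_azN | lia].
  - by rewrite (@fvan _ B _ (w + l)) ?xop0 //; [apply: fil_azN | lia].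
  - lia.
apply: (@fsupp2I _ _ (- w) (T + w) (- w) (T + w)) => l l' h; rewrite -/(H l l').
- exact: Hl.
- by case: (ltrP l' (- w)) => hn; [apply: Hl' | apply: Hll; lia].
- exact: Hl'.
- by case: (ltrP l (- w)) => hl; [apply: Hl | apply: Hll; lia].
Qed.

Lemma Nop_Nop r k k' B j f : Nop r k (Nop r k' B) j f =
  lsum (fun l => lsum (fun l' => (binz F (l - 1) k.-1 * binz F (l' - 1) k'.-1) *:
     Lop r l (Lop r l' (B (j + k%:Z + k'%:Z - l - l'))) f)).
Proof.
rewrite NopE; apply: eq_lsum => l.
rewrite Lop_lsum scaler_lsum; last first.
  have [N hN] := fsupp2_Lop_Lop r B (j + k%:Z + k'%:Z) f.
  exists N => l' hl'; rewrite Lop_scale.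
  have -> : j + k%:Z - l + k'%:Z - l' = j + k%:Z + k'%:Z - l - l' by lia.
  by rewrite hN ?hl' ?orbT ?scaler0.
apply: eq_lsum => l'; rewrite Lop_scale scalerA.
by have -> : j + k%:Z - l + k'%:Z - l' = j + k%:Z + k'%:Z - l - l' by lia.
Qed.

Lemma NopC r k k' B : eqf (Nop r k (Nop r k' B)) (Nop r k' (Nop r k B)).
Proof.
move=> j f; rewrite !Nop_Nop.
pose c l l' := binz F (l - 1) k.-1 * binz F (l' - 1) k'.-1.
have [N hN] := fsupp2_Lop_Lop r B (j + k%:Z + k'%:Z) f.
rewrite exchange_lsum; last by exists N => l l' /hN ->; rewrite scaler0.
apply: eq_lsum => l'; apply: eq_lsum => l; rewrite mulrC; congr (_ *: _).
have -> : j + k%:Z + k'%:Z - l - l' = j + k'%:Z + k%:Z - l' - l by lia.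
exact: LopC.
Qed.

Lemma az_Qop r l s b f : az r l (Qop s b f) = Qop s b (az r l f).
Proof. by rewrite /az; case: eqP => _; rewrite ?QopZ ?aop_Qop. Qed.

Lemma Lop_NP r l s kap B n m f : Lop r l (NP s kap B n m) f =
  lsum (fun b => Sop s (n + b - kap) (Lop r l (B m) (Qop s b f))).
Proof.
rewrite /NP /= Lop_lsum; apply: eq_lsum => b; rewrite !LopE /=.
by case: ifP => l0; rewrite ?xop_Sop // az_Qop.
Qed.

Lemma NP_Nop s kap r k B n m f : NP s kap (Nop r k B) n m f =
  lsum (fun l => binz F (l - 1) k.-1 *: Lop r l (NP s kap B n (m + k%:Z - l)) f).
Proof.
have [w w0 wf] := fil_ex f.
have Qw b : w < b -> Qop s b f = 0.
  by move=> hb; apply: (@fil_lt0 _ (w - b)); [lia|apply: fil_Qop].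
rewrite NPE.
pose H l b := Sop s (n + b - kap)
  (binz F (l - 1) k.-1 *: Lop r l (B (m + k%:Z - l)) (Qop s b f)).
have H0 l b : (b < 0) || (w < b) -> H l b = 0.
  by case/orP => hb; rewrite /H; [rewrite Qop_lt0 //|rewrite Qw //];
    rewrite linear0 scaler0 Sop0.
transitivity (lsum (fun b => lsum (fun l => H l b))).
  apply: eq_lsum => b; rewrite /H NopE raddf_lsum //.
  exact: (Nop_fsupp r k B m (Qop s b f)).
rewrite exchange_lsum; last first.
  apply: (@fsupp2I _ _ 0 w (- w) (`|m|%N%:Z + k%:Z + w + `|fbd B|%N%:Z)) => b l hb.
  - by apply: H0; rewrite hb.
  - by apply: H0; rewrite hb orbT.
  - case: (ltrP b 0) => b0; first by apply: H0; rewrite b0.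
    rewrite /H LopE ifF; last by lia.
    have -> : az r (- l) (Qop s b f) = 0.
      by apply: (@fil_lt0 _ (w - b + l)); [lia|apply/fil_azN/fil_Qop].
    by rewrite linear0 scaler0 Sop0.
  - case: (ltrP b 0) => b0; first by apply: H0; rewrite b0.
    rewrite /H LopE ifT; last by lia.
    rewrite (@fvan _ B _ (w - b)) ?xop0 ?scaler0 ?Sop0 //; last by lia.
    exact: fil_Qop.
apply: eq_lsum => l; rewrite Lop_NP scaler_lsum; last first.
  apply: (@fsuppI _ _ 0 w) => b hb; last by rewrite Qw ?linear0 ?Sop0.
  by rewrite Qop_lt0 // linear0 Sop0.
by apply: eq_lsum => b; rewrite /H SopZ.
Qed.

Lemma Nop_ResNP r k i s kap B :
  eqf (Nop r k (Res i (NP s kap B))) (Res i (NP s kap (Nop r k B))).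
Proof.
move=> j f; rewrite NopE ResE.
set X := NP s kap B; pose M := j + k%:Z + i%:Z.
have [N hN] := fsupp2_Lop_bi r X M f.
pose H l n := (binz F (l - 1) k.-1 * binz F n i) *: Lop r l (X n (M - l - n)) f.
have fH : fsupp2 H by exists N => l n /hN; rewrite /H => ->; rewrite scaler0.
transitivity (lsum (fun l => lsum (H l))).
  apply: eq_lsum => l; rewrite /= Lop_lsum scaler_lsum.
    apply: eq_lsum => n; rewrite Lop_scale scalerA /H /M.
    by congr (_ *: Lop r l (X _ _) f); lia.
  exists N => n hn; rewrite Lop_scale.
  have -> : j + k%:Z - l - n + i%:Z = M - l - n by rewrite /M; lia.
  by rewrite hN ?hn ?orbT ?scaler0.
rewrite exchange_lsum //; apply: eq_lsum => n; rewrite NP_Nop scaler_lsum.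
  apply: eq_lsum => l; rewrite scalerA mulrC /H /M.
  by congr (_ *: Lop r l (X _ _) f); lia.
exists N => l hl; have -> : j - n + i%:Z + k%:Z - l = M - l - n by rewrite /M; lia.
by rewrite hN ?hl ?scaler0.
Qed.

Definition idf_mode j : {linear R -> R} :=
  if j == 0 then (idfun : {linear R -> R}) else (\0 : {linear R -> R}).

Lemma idf_van j w f : fil w f -> j + w + 0 < 0 -> idf_mode j f = 0.
Proof.
rewrite /idf_mode => wf h; case: eqP => // j0.
by apply: (fil_lt0 _ wf); lia.
Qed.

Definition idf : vfield F := VField idf_van.

Lemma idfE j f : idf j f = if j == 0 then f else 0.
Proof. by rewrite /= /idf_mode; case: eqP. Qed.

Lemma fbd_Nop r k B : fbd (Nop r k B) = fbd B + k%:Z. Proof. by []. Qed.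

(** The field z^kap S_s(z) Q_s(z), in the shape of a residue to which [comb_Sop] applies. For s = p
    and kap = 2 p r it is the field of e^{p alpha} on charge r. *)
Definition efield s kap : vfield F := Res 0 (NP s kap idf).

Lemma fbd_efield s kap : fbd (efield s kap) = - kap.
Proof. by rewrite /efield /Res /NP /= add0r addr0. Qed.

Lemma efieldE s kap j f : efield s kap j f = lsum (fun b => Sop s (j + b - kap) (Qop s b f)).
Proof.
rewrite ResE (@lsum1 _ _ j).
  rewrite binz0 scale1r NPE; apply: eq_lsum => b.
  by rewrite idfE ifT //; apply/eqP; lia.
move=> n nj; rewrite NPE lsum0 ?scaler0 // => b.
by rewrite idfE ifF ?Sop0 //; lia.
Qed.

(** Normally ordered exponentials at the same point multiply; both sides are brought to one triple
    sum G by [Sop_conv] and [Qop_conv]. *)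
Lemma efieldD s s' kap kap' :
  eqf (Res 0 (NP s kap (efield s' kap'))) (efield (s + s') (kap + kap')).
Proof.
move=> j f; have [w w0 wf] := fil_ex f.
pose G b (i : int) c := Sop s i (Sop s' (j + c - kap - kap' - i) (Qop s' (c - b) (Qop s b f))).
pose N := (`|w| + `|j| + `|kap| + `|kap'| + 1)%N.
have G0 b (i : int) c : [|| N <= `|b|, N <= `|i| | N <= `|c|]%N -> G b i c = 0.
  rewrite /N /G => h.
  case: (ltrP b 0) => b0; first by rewrite (Qop_lt0 s) // Qop0 !Sop0.
  case: (ltrP (c - b) 0) => cb; first by rewrite (Qop_lt0 s') // !Sop0.
  case: (ltrP w c) => wc.
    have -> : Qop s' (c - b) (Qop s b f) = 0.
      by apply: (@fil_lt0 _ (w - b - (c - b))); [lia|apply/fil_Qop/fil_Qop].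
    by rewrite !Sop0.
  case: (ltrP i 0) => i0; first by rewrite Sop_lt0.
  by rewrite (Sop_lt0 s') ?Sop0 //; lia.
transitivity (lsum (fun b => lsum (fun i : int => lsum (fun c => G b i c)))); last first.
  rewrite (exchange_lsum3 G0) efieldE; apply: eq_lsum => c.
  rewrite Sop_conv //.
  apply: eq_lsum => i; rewrite Qop_conv //.
  have fQ : fsupp (fun b => Qop s b (Qop s' (c - b) f)).
    apply: (@fsuppI _ _ 0 c) => b hb; first by rewrite Qop_lt0.
    by rewrite (Qop_lt0 s') ?Qop0 //; lia.
  rewrite raddf_lsum //.
  have fSQ : fsupp (fun b => Sop s' (j + c - (kap + kap') - i) (Qop s b (Qop s' (c - b) f))).
    by have [K hK] := fQ; exists K => b /hK ->; apply: Sop0.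
  rewrite raddf_lsum //; apply: eq_lsum => b; rewrite /G QopC //.
  by congr (Sop _ _ (Sop _ _ _)); lia.
have fB n m g : fsupp (fun b => Sop s (n + b - kap) (efield s' kap' m (Qop s b g))).
  exact: (NP_fsupp s kap (efield s' kap') n m g).
have fQQ b a c : fsupp (fun b' => Sop s' (a + b' - c) (Qop s' b' (Qop s b f))).
  apply: (@fsuppI _ _ 0 (`|w|%N%:Z + `|b|%N%:Z)) => b' hb; first by rewrite Qop_lt0 // Sop0.
  have -> : Qop s' b' (Qop s b f) = 0.
    by apply: (@fil_lt0 _ (w - b - b')); [lia|apply/fil_Qop/fil_Qop].
  exact: Sop0.
pose H n b := Sop s (n + b - kap) (efield s' kap' (j - n) (Qop s b f)).
have HE n b : H n b = lsum (fun c => G b (n + b - kap) c).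
  rewrite /H efieldE raddf_lsum; last exact: fQQ.
  rewrite -[RHS](lsum_shift b).
    apply: eq_lsum => b'; rewrite /G; congr (Sop _ _ (Sop _ _ (Qop _ _ _))); lia.
  by exists N => c hc; apply: G0; rewrite hc !orbT.
transitivity (lsum (fun n => lsum (fun b => H n b))).
  rewrite ResE; apply: eq_lsum => n; rewrite binz0 scale1r NPE.
  by apply: eq_lsum => b; rewrite /H addr0.
rewrite exchange_lsum.
  apply: eq_lsum => b.
  under eq_lsum => n do rewrite HE.
  rewrite -[RHS](lsum_shift (b - kap)).
    by apply: eq_lsum => n; rewrite addrA.
  by exists N => i hi; apply: lsum0 => c; apply: G0; rewrite hi !orbT.
exists (N + `|kap| + N)%N => n b h; rewrite HE; apply: lsum0 => c; apply: G0.
lia.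
Qed.
End FieldProducts.

Opaque Nop Res NP idf efield.

Section Modes.
Implicit Types (c : {poly nat}).

Definition modesp c : seq nat := modes (polyseq c).

Lemma count_modes (e : seq nat) x :
  count_mem x (modes e) = if x is y.+1 then nth 0%N e y else 0%N.
Proof.
rewrite /modes count_flatten -map_comp.
have E i : (count_mem x \o (fun i => nseq (nth 0%N e i) i.+1)) i =
           (if x == i.+1 then nth 0%N e i else 0)%N.
  by rewrite /= count_nseq /= eq_sym; case: eqP => _; rewrite ?mul1n ?mul0n.
rewrite (eq_map E) sumnE big_map; case: x {E} => [|y]; first by rewrite big1.
have -> : iota 0 (size e) = index_iota 0 (size e) by rewrite /index_iota subn0.
case: (ltnP y (size e)) => hy.
  rewrite (bigD1_seq y) ?iota_uniq ?mem_index_iota //= eqxx big1 ?addn0 // => i iy.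
  by rewrite eqSS eq_sym (negbTE iy).
rewrite nth_default // big_nat big1 // => i hi; rewrite eqSS ifF //.
by apply/eqP; lia.
Qed.

Lemma perm_modesp c i : perm_eq (modesp (c + 'X^i)) (i.+1 :: modesp c).
Proof.
apply/allP => x _ /=; apply/eqP; rewrite !count_modes.
case: x => [|y] //; rewrite -/(cf (c + 'X^i) y) -/(cf c y) cfD cfXn eqSS eq_sym.
by rewrite addnC.
Qed.

Lemma modesp0 : modesp 0 = [::].
Proof. by rewrite /modesp polyseq0. Qed.
End Modes.

(** * Vertex operators *)

Section VertexOperators.
Variable F : fieldType.
Hypothesis charF : forall n : nat, (n.+1%:R : F) != 0.
Local Notation R := (fcar (free_mod F {poly nat})).
Implicit Types (s : F) (f g : R) (a b l m n j w r p kap M : int) (k i : nat) (c : {poly nat}).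
Implicit Types (B : vfield F) (X : bifield F).

Lemma eqf_trans B B' B'' : eqf B B' -> eqf B' B'' -> eqf B B''.
Proof. by move=> h h' j f; rewrite h h'. Qed.

(* The vertex operator of alpha(-k_1) ... alpha(-k_n) e^{p alpha} on charge r. *)
Definition Yf r p (ks : seq nat) : vfield F :=
  foldr (Nop r) (efield p%:~R (2 * p * r)) ks.

Lemma fbd_Yf r p ks : fbd (Yf r p ks) = (sumn ks)%:Z - 2 * p * r.
Proof.
elim: ks => [|k ks IH]; first by rewrite [LHS]fbd_efield add0r.
have -> : fbd (Yf r p (k :: ks)) = fbd (Yf r p ks) + k%:Z := fbd_Nop r k _.
by rewrite IH /=; lia.
Qed.

Lemma Yf_van r p ks j w f : fil w f -> j + w + (sumn ks)%:Z < 2 * p * r ->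
  Yf r p ks j f = 0.
Proof. by move=> wf h; apply: (@fvan _ (Yf r p ks) _ w) => //; rewrite fbd_Yf; lia. Qed.

Lemma Yf_insert r p ks1 k ks2 :
  eqf (Yf r p (ks1 ++ k :: ks2)) (Nop r k (Yf r p (ks1 ++ ks2))).
Proof.
elim: ks1 => [|k1 ks1 IH] //=; apply: eqf_trans (eqf_Nop _ _ IH) _.
exact: NopC.
Qed.

Lemma Yf_perm r p ks ks' : perm_eq ks ks' -> eqf (Yf r p ks) (Yf r p ks').
Proof.
elim: ks ks' => [|k ks IH] ks'.
  by move/perm_size/esym/size0nil=> ->.
move=> pk; have kin : k \in ks' by rewrite -(perm_mem pk) mem_head.
case/splitPr: kin pk => ks1 ks2 pk j f.
rewrite Yf_insert /=; apply: eqf_Nop; apply: IH.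
by rewrite -(perm_cons k) (perm_trans pk) // -cat1s perm_catCA.
Qed.

Definition comb f (Bc : {poly nat} -> vfield F) B :=
  forall j g, lext (fun c => Bc c j g) f = B j g.

Lemma lext_lsum (V : lmodType F) (G : {poly nat} -> int -> V) f :
  (forall c, fsupp (G c)) ->
  lext (fun c => lsum (G c)) f = lsum (fun n => lext (fun c => G c n) f).
Proof.
move=> fG; rewrite /lext lsum_sum; last by move=> c _; apply: fsuppZ.
by apply: eq_bigr => c _; rewrite scaler_lsum.
Qed.

Lemma linear_lext (A : {linear R -> R}) (phi : {poly nat} -> R) f :
  A (lext phi f) = lext (fun c => A (phi c)) f.
Proof. by rewrite /lext linear_sum; apply: eq_bigr => c _; rewrite linearZ_LR. Qed.

Lemma lextZ (x : F) (phi : {poly nat} -> R) f :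
  lext (fun c => x *: phi c) f = x *: lext phi f.
Proof.
rewrite /lext scaler_sumr; apply: eq_bigr => c _.
by rewrite !scalerA mulrC.
Qed.

Lemma eq_lext (V : lmodType F) (phi psi : {poly nat} -> V) f :
  phi =1 psi -> lext phi f = lext psi f.
Proof. by move=> E; apply: eq_bigr => c _; rewrite E. Qed.

Lemma comb_Nop r k f Bc B : comb f Bc B -> comb f (fun c => Nop r k (Bc c)) (Nop r k B).
Proof.
move=> BE j g; rewrite NopE.
rewrite (eq_lext _ (fun c => NopE r k (Bc c) j g)) lext_lsum; last first.
  by move=> c; exact: (Nop_fsupp r k (Bc c) j g).
apply: eq_lsum => l; rewrite lextZ; congr (_ *: _).
rewrite (eq_lext _ (fun c => LopE r l (Bc c (j + k%:Z - l)) g)) LopE.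
by case: ifP => _; rewrite -BE // (linear_lext (xop l)).
Qed.

Lemma comb_ResNP s kap k f Bc B : comb f Bc B ->
  comb f (fun c => Res k (NP s kap (Bc c))) (Res k (NP s kap B)).
Proof.
move=> BE j g; rewrite ResE.
rewrite (eq_lext _ (fun c => ResE k (NP s kap (Bc c)) j g)) lext_lsum; last first.
  by move=> c; exact: (Res_fsupp k (NP s kap (Bc c)) j g).
apply: eq_lsum => n; rewrite lextZ; congr (_ *: _).
rewrite NPE (eq_lext _ (fun c => NPE s kap (Bc c) n (j - n + k%:Z) g)) lext_lsum; last first.
  by move=> c; exact: (NP_fsupp s kap (Bc c) n (j - n + k%:Z) g).
by apply: eq_lsum => b; rewrite -BE (linear_lext (Sop s (n + b - kap))).
Qed.

Definition Yc r p c := Yf r p (modesp c).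

(** A new factor x_{i+1} enters the sorted list of modes somewhere in the middle; [Yf_perm] brings
    it to the front. *)
Lemma Yv_xop r p i f j g :
  lext (fun c => Yc r p c j g) (xop i.+1%:Z f) =
  lext (fun c => Nop r i.+1 (Yc r p c) j g) f.
Proof.
apply: (eq_linear_mon (A := lext (fun c => Yc r p c j g) \o xop i.+1%:Z)
                      (B := lext (fun c => Nop r i.+1 (Yc r p c) j g))) => c /=.
rewrite xopS !lext_mon; exact: (@Yf_perm r p _ _ (perm_modesp c i)).
Qed.

(* The fields of the vectors [Sop s k (mon c0)] and the residues [Res k] satisfy the same
   Newton type recursion in k. *)
Lemma comb_Sop s kap r p B c0 : kap%:~R = 2 * r%:~R * s :> F ->
  eqf (Yc r p c0) (Res 0 (NP s kap B)) ->
  forall k, comb (Sop s k%:Z (mon c0)) (Yc r p) (Res k (NP s kap B)).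
Proof.
move=> kapE B0 k.
suff h : forall N k, (k <= N)%N -> comb (Sop s k%:Z (mon c0)) (Yc r p) (Res k (NP s kap B)).
  exact: (h k).
elim=> [|N IH] {}k.
  rewrite leqn0 => /eqP-> j g; rewrite Sop_0 lext_mon; exact: B0.
case: k => [_|k kN]; first exact: (IH 0%N).
move=> j g; apply: (scalerI (charF k)).
rewrite (Res_rec charF (s := s) (r := r)); last by move=> n m f; apply: NP_deriv.
have -> : k.+1%:R *: lext (fun c => Yc r p c j g) (Sop s k.+1%:Z (mon c0)) =
          lext (fun c => Yc r p c j g) (k.+1%:Z%:~R *: Sop s k.+1%:Z (mon c0)).
  by rewrite linearZ_LR.
rewrite Sop_rec // linearZ_LR; congr (_ *: _).
rewrite (@lsum_xop _ (fun b => Sop s b (mon c0))); last by move=> b; apply: Sop_lt0.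
rewrite linear_sum; apply: eq_bigr => i _ /=; rewrite Yv_xop subSS.
have le_kiN : (k - i <= N)%N by lia.
exact: (comb_Nop r i.+1 (IH (k - i)%N le_kiN) j g).
Qed.

(* The vertex operator of [hvec ks] e^{n alpha}, n = size ks, on charge r: see [comb_Gamma]. *)
Definition Gammaf r (ks : seq nat) : vfield F :=
  foldr (fun k B => Res k (NP 1 (2 * r) B)) (idf F) ks.

Definition hvec (ks : seq nat) : R := foldr (fun k f => Sop 1 k%:Z f) (mon 0) ks.

Lemma Sop_s0 a f : a != 0 -> Sop 0 a f = 0.
Proof.
move=> a0; apply: (int_scaleI charF a0).
by rewrite Sop_rec // scale0r scaler0.
Qed.

Lemma efield00 : eqf (efield 0 0) (idf F).
Proof.
move=> j f; rewrite efieldE (@lsum1 _ _ 0).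
  rewrite Qop_0 addr0 subr0 idfE; case: eqP => [->|/eqP j0]; first by rewrite Sop_0.
  exact: Sop_s0.
move=> b b0; suff -> : Qop 0 b f = 0 by rewrite Sop0.
apply: (int_scaleI charF b0); by rewrite Qop_rec // oppr0 scale0r scaler0.
Qed.

(** Multiplication by S_1 and Q_1 passes through the normally ordered factors alpha, which reduces
    the claim to exponentials. *)
Lemma Yf_succ r p ks : eqf (Yf r (p + 1) ks) (Res 0 (NP 1 (2 * r) (Yf r p ks))).
Proof.
elim: ks => [|k ks IH] /=.
  move=> j f; rewrite /Yf /= efieldD //.
  have -> : 2 * r + 2 * p * r = 2 * (p + 1) * r by ring.
  by rewrite intrD addrC.
apply: eqf_trans (eqf_Nop _ _ IH) _; exact: Nop_ResNP.
Qed.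

(** Each h_k e^alpha contributes the coefficient of w^k in S_1(z + w) Q_1(z + w): [Yf_succ] is the
    case k = 0, and [comb_Sop] with s = 1 gives the others. *)
Lemma comb_Gamma r ks : comb (hvec ks) (Yc r (size ks)%:Z) (Gammaf r ks).
Proof.
elim: ks => [|k ks IH] j g.
  rewrite lext_mon /Yc modesp0 /Yf /= mulr0 mul0r; exact: efield00.
have -> : hvec (k :: ks) = Sop 1 k%:Z (hvec ks) by [].
have -> : Gammaf r (k :: ks) = Res k (NP 1 (2 * r) (Gammaf r ks)) by [].
have -> : (size (k :: ks))%:Z = (size ks)%:Z + 1 by rewrite /=; lia.
rewrite -(comb_ResNP 1 (2 * r) k IH).
apply: (eq_linear_mon (A := lext (fun c => Yc r ((size ks)%:Z + 1) c j g) \o Sop 1 k%:Z)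
   (B := lext (fun c => Res k (NP 1 (2 * r) (Yc r (size ks)%:Z c)) j g))) => c /=.
rewrite lext_mon; apply: comb_Sop; last exact: Yf_succ.
by rewrite mulr1 intrM.
Qed.

Definition fhalf : F := 2^-1.

Lemma two_neq0 : (2 : F) != 0. Proof. exact: (charF 1). Qed.
Lemma half2 : fhalf + fhalf = 1. Proof. by rewrite /fhalf; have h := two_neq0; field. Qed.
Lemma half1 : 2 * fhalf * 1 = 1. Proof. by rewrite /fhalf; have h := two_neq0; field. Qed.
Lemma half1' : 2 * 1 * fhalf = 1. Proof. by rewrite /fhalf; have h := two_neq0; field. Qed.

(* The vertex operator of c^N on charge r: see [comb_cfield]. *)
Definition cfield r N : vfield F := Res N (NP fhalf r (efield fhalf r)).

Lemma comb_cfield r N : comb (Sop fhalf N%:Z (mon 0)) (Yc r 1) (cfield r N).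
Proof.
apply: comb_Sop.
  have h : 2 * fhalf = 1 by rewrite -[LHS]mulr1 half1.
  by rewrite mulrAC h mul1r.
move=> j f; rewrite efieldD // /Yc modesp0 /Yf /= half2.
by have -> : 2 * 1 * r = r + r by ring.
Qed.
End VertexOperators.

(** * Commutation with the half-lattice operators *)

Section Commutant.
Variable F : fieldType.
Hypothesis charF : forall n : nat, (n.+1%:R : F) != 0.
Local Notation R := (fcar (free_mod F {poly nat})).
Local Notation hf := (fhalf F).
Implicit Types (s : F) (f g : R) (a b l m n i j w r p kap M : int) (k : nat) (c : {poly nat}).
Implicit Types (B : vfield F) (X : bifield F).

(** The coefficient of y^i in S_{1/2}(y) T Q_{1/2}(y). *)
Definition conjS i (T : {linear R -> R}) f : R :=
  lsum (fun b => Sop hf (i + b) (T (Qop hf b f))).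

Lemma fsupp_Qop s (G : int -> R -> R) f : (forall b, G b 0 = 0) ->
  fsupp (fun b => G b (Qop s b f)).
Proof.
move=> G0; have [w w0 wf] := fil_ex f.
apply: (@fsuppI _ _ 0 w) => b hb; first by rewrite Qop_lt0.
by have -> : Qop s b f = 0 by [apply: (@fil_lt0 _ (w - b)); [lia|apply: fil_Qop]]; apply: G0.
Qed.

(** The contraction of Q_{1/2}(y_1) with S_1(t) adds a factor 1 - t/y_1 to the one that T picks up
    already. It is used first for T the identity and T' = 0, then for T a coefficient of
    S_{1/2}(y_2) Q_{1/2}(y_2). *)
Lemma conjS_Sop i a (T T' : {linear R -> R}) f :
  (forall a g, T (Sop 1 a g) = Sop 1 a (T g) - Sop 1 (a - 1) (T' g)) ->
  conjS i T (Sop 1 a f) = Sop 1 a (conjS i T f)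
     - Sop 1 (a - 1) (conjS i T' f + conjS (i + 1) T f) + Sop 1 (a - 2) (conjS (i + 1) T' f).
Proof.
move=> TE.
have fs (U : {linear R -> R}) n : fsupp (fun b => Sop hf (n + b) (U (Qop hf b f))).
  by apply: (@fsupp_Qop hf (fun b g => Sop hf (n + b) (U g))) => b; rewrite linear0 Sop0.
have fsS (U : {linear R -> R}) n a' :
    fsupp (fun b => Sop 1 a' (Sop hf (n + b) (U (Qop hf b f)))).
  by have [N hN] := fs U n; exists N => b /hN ->; apply: Sop0.
have SE (U : {linear R -> R}) n a' : Sop 1 a' (conjS n U f) =
    lsum (fun b => Sop 1 a' (Sop hf (n + b) (U (Qop hf b f)))).
  by rewrite /conjS raddf_lsum.
have SE1 (U : {linear R -> R}) n a' : Sop 1 a' (conjS (n + 1) U f) =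
    lsum (fun b => Sop 1 a' (Sop hf (n + b) (U (Qop hf (b - 1) f)))).
  rewrite SE -(lsum_shift (-1)) //; apply: eq_lsum => b.
  by congr (Sop _ _ (Sop _ _ _)); lia.
have fsS1 (U : {linear R -> R}) n a' :
    fsupp (fun b => Sop 1 a' (Sop hf (n + b) (U (Qop hf (b - 1) f)))).
  have [N hN] := fsupp_shift (-1) (fsS U (n + 1) a'); exists N => b /hN /= <-.
  by congr (Sop _ _ (Sop _ _ _)); lia.
rewrite SopD opprD !SE1 !SE /conjS.
transitivity (lsum (fun b =>
   ((Sop 1 a (Sop hf (i + b) (T (Qop hf b f))) +
    (- Sop 1 (a - 1) (Sop hf (i + b) (T' (Qop hf b f)))
     - Sop 1 (a - 1) (Sop hf (i + b) (T (Qop hf (b - 1) f)))))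
    + Sop 1 (a - 2) (Sop hf (i + b) (T' (Qop hf (b - 1) f)))))).
  apply: eq_lsum => b; rewrite (Qop_Sop charF _ _ _ (half1 charF)) linearB !TE /= !linearB /=.
  rewrite !(SopC charF 1); have -> : a - 1 - 1 = a - 2 by lia.
  by rewrite !addrA opprD opprK !addrA.
have fN U : fsupp U -> fsupp (fun b : int => - U b : R) := @fsuppN _ U.
rewrite lsumD //; last first.
  by apply: fsuppD => //; apply: fsuppD; apply: fN.
rewrite lsumD //; last by apply: fsuppD; apply: fN.
rewrite lsumD; [|exact: fN|exact: fN].
by rewrite !lsumN.
Qed.

Lemma conjS_Qop i a (T T' : {linear R -> R}) f :
  (forall a g, Qop 1 a (T g) = T (Qop 1 a g) - T' (Qop 1 (a - 1) g)) ->
  Qop 1 a (conjS i T f) = conjS i T (Qop 1 a f)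
     - (conjS i T' (Qop 1 (a - 1) f) + conjS (i - 1) T (Qop 1 (a - 1) f))
     + conjS (i - 1) T' (Qop 1 (a - 2) f).
Proof.
move=> TE.
have fs (U : {linear R -> R}) n g : fsupp (fun b => Sop hf (n + b) (U (Qop hf b g))).
  by apply: (@fsupp_Qop hf (fun b g => Sop hf (n + b) (U g))) => b; rewrite linear0 Sop0.
rewrite {1}/conjS raddf_lsum //= opprD.
transitivity (lsum (fun b =>
   ((Sop hf (i + b) (T (Qop hf b (Qop 1 a f))) +
    (- Sop hf (i + b) (T' (Qop hf b (Qop 1 (a - 1) f)))
     - Sop hf (i - 1 + b) (T (Qop hf b (Qop 1 (a - 1) f)))))
    + Sop hf (i - 1 + b) (T' (Qop hf b (Qop 1 (a - 2) f)))))).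
  apply: eq_lsum => b; rewrite (Qop_Sop charF _ _ _ (half1' charF)) !TE /= !linearB /=.
  rewrite !(QopC charF 1); have -> : a - 1 - 1 = a - 2 by lia.
  have -> : i + b - 1 = i - 1 + b by lia.
  by rewrite !addrA opprD opprK !addrA.
have fN U : fsupp U -> fsupp (fun b : int => - U b : R) := @fsuppN _ U.
rewrite lsumD //; last first.
  by apply: fsuppD => //; apply: fsuppD; apply: fN.
rewrite lsumD //; last by apply: fsuppD; apply: fN.
rewrite lsumD; [|exact: fN|exact: fN].
by rewrite !lsumN.
Qed.

(** The coefficient of y_1^i y_2^j in C(y_1, y_2) without the power (y_1 y_2)^r, which [NP_efield]
    restores as a shift of the indices. *)
Definition Cop i j : {linear R -> R} := NP hf 0 (efield hf 0) i j.

Lemma efield_conjS j f : efield hf 0 j f = conjS j idfun f.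
Proof. by rewrite efieldE; apply: eq_lsum => b; rewrite subr0. Qed.

Lemma Cop_conjS i j f : Cop i j f = conjS i (efield hf 0 j) f.
Proof. by rewrite /Cop NPE; apply: eq_lsum => b; rewrite subr0. Qed.

Lemma conjS0 i f : conjS i \0 f = 0.
Proof. by apply: lsum0 => b; rewrite Sop0. Qed.

Lemma efield_Sop j a f :
  efield hf 0 j (Sop 1 a f) = Sop 1 a (efield hf 0 j f) - Sop 1 (a - 1) (efield hf 0 (j + 1) f).
Proof.
rewrite !efield_conjS (@conjS_Sop _ _ idfun \0).
  by rewrite !conjS0 add0r Sop0 addr0.
by move=> b g; rewrite Sop0 subr0.
Qed.

Lemma Qop_efield j a f :
  Qop 1 a (efield hf 0 j f) = efield hf 0 j (Qop 1 a f) - efield hf 0 (j - 1) (Qop 1 (a - 1) f).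
Proof.
rewrite !efield_conjS (@conjS_Qop _ _ idfun \0).
  by rewrite !conjS0 add0r addr0.
by move=> b g; rewrite subr0.
Qed.

(* C(y_1, y_2) S_1(t) = (1 - t/y_1)(1 - t/y_2) S_1(t) C(y_1, y_2); likewise [Qop_Cop] says
   Q_1(t) C(y_1, y_2) = (1 - y_1/t)(1 - y_2/t) C(y_1, y_2) Q_1(t). *)
Lemma Cop_Sop i j a f : Cop i j (Sop 1 a f) = Sop 1 a (Cop i j f)
  - Sop 1 (a - 1) (Cop i (j + 1) f + Cop (i + 1) j f) + Sop 1 (a - 2) (Cop (i + 1) (j + 1) f).
Proof.
by rewrite !Cop_conjS (@conjS_Sop _ _ _ (efield hf 0 (j + 1))) // => *; apply: efield_Sop.
Qed.

Lemma Qop_Cop i j a f : Qop 1 a (Cop i j f) = Cop i j (Qop 1 a f)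
  - (Cop i (j - 1) (Qop 1 (a - 1) f) + Cop (i - 1) j (Qop 1 (a - 1) f))
  + Cop (i - 1) (j - 1) (Qop 1 (a - 2) f).
Proof.
by rewrite !Cop_conjS (@conjS_Qop _ _ _ (efield hf 0 (j - 1))) // => *; apply: Qop_efield.
Qed.

Lemma NP_efield r n m f : NP hf r (efield hf r) n m f = Cop (n - r) (m - r) f.
Proof.
rewrite /Cop !NPE; apply: eq_lsum => b; rewrite !efieldE.
have -> : n - r + b - 0 = n + b - r by lia.
by congr (Sop _ _ _); apply: eq_lsum => b'; congr (Sop _ _ _); lia.
Qed.
Opaque Cop.

Lemma linear2_rearrange (A B : {linear R -> R}) (u v v' w : R) :
  A (B u) + (- A (B (v + v')) + A (B w)) = A (B (w - (v' + v) + u)).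
Proof.
rewrite (addrC v'); move: (v + v') => {v v'} v.
rewrite (linearD B) (linearB B) (linearD A) (linearB A) /=.
by rewrite addrC (addrC (- _)).
Qed.

(** Passing S_1(t), C times y_1 y_2 gains (y_1 - t)(y_2 - t). Passing Q_1(t) gains (1 - y_1/t)(1 -
    y_2/t), and the charge raised by one supplies t^2. The two factors agree. *)
Lemma NP_Cop r p B B' :
  (forall i j m f, Cop (i - p) (j - p) (B m f) = B' m (Cop i j f)) ->
  forall i j n m f, Cop (i - (p + 1)) (j - (p + 1)) (NP 1 (2 * r) B n m f) =
                    NP 1 (2 * (r + 1)) B' n m (Cop i j f).
Proof.
move=> BB i j n m f; rewrite (NPE 1 (2 * r)) (NPE 1 (2 * (r + 1))).
have fs (G : int -> R -> R) : (forall b, G b 0 = 0) -> fsupp (fun b => G b (Qop 1 b f)).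
  exact: fsupp_Qop.
rewrite raddf_lsum; last first.
  by apply: (@fs (fun b g => Sop 1 _ (B m g))) => b; rewrite linear0 Sop0.
pose K1 b := Sop 1 (n + b - 2 * r) (B' m (Cop (i - 1) (j - 1) (Qop 1 b f))).
pose K2 b := Sop 1 (n + b - 2 * r - 1) (B' m (Cop (i - 1) j (Qop 1 b f) +
   Cop i (j - 1) (Qop 1 b f))).
pose K3 b := Sop 1 (n + b - 2 * r - 2) (B' m (Cop i j (Qop 1 b f))).
have f1 : fsupp K1.
  by apply: (@fs (fun b g => Sop 1 _ (B' m (Cop _ _ g)))) => b; rewrite !linear0.
have f2 : fsupp K2.
  by apply: (@fs (fun b g => Sop 1 _ (B' m (Cop _ _ g + Cop _ _ g)))) => b;
     rewrite !linear0 addr0 !linear0.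
have f3 : fsupp K3.
  by apply: (@fs (fun b g => Sop 1 _ (B' m (Cop _ _ g)))) => b; rewrite !linear0.
transitivity (lsum (fun b => (K1 b + - K2 b) + K3 b)).
  apply: eq_lsum => b /=; rewrite Cop_Sop.
  have -> : i - (p + 1) = i - 1 - p by lia.
  have -> : j - (p + 1) = j - 1 - p by lia.
  have -> : i - 1 - p + 1 = i - p by lia.
  have -> : j - 1 - p + 1 = j - p by lia.
  rewrite (BB (i - 1) (j - 1)) (BB (i - 1) j) (BB i (j - 1)) (BB i j).
  by rewrite /K1 /K2 /K3 [B' m (_ + _)]linearD.
rewrite lsumD //; last by apply: fsuppD => //; apply: fsuppN.
rewrite lsumD //; last exact: fsuppN.
(* The shifts of b align the three terms with those of [Qop_Cop]. *)
rewrite lsumN // -(lsum_shift (-2) f1) -(lsum_shift (-1) f2).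
have fK3 : fsupp (fun b => - K2 (b - 1) + K3 b).
  by apply: fsuppD => //; apply: fsuppN; apply: (fsupp_shift (-1) f2).
rewrite -lsumN; last exact: (fsupp_shift (-1) f2).
rewrite -addrA -lsumD //; last by apply: fsuppN; apply: (fsupp_shift (-1) f2).
rewrite -lsumD //; last exact: (fsupp_shift (-2) f1).
apply: eq_lsum => b; rewrite Qop_Cop /K1 /K2 /K3.
have -> : n + (b - 2) - 2 * r = n + b - 2 * (r + 1) by lia.
have -> : n + (b - 1) - 2 * r - 1 = n + b - 2 * (r + 1) by lia.
have -> : n + b - 2 * r - 2 = n + b - 2 * (r + 1) by lia.
exact: (linear2_rearrange (Sop 1 _) (B' m)).
Qed.

Lemma Gamma_Cop ks r i j m f :
  Cop (i - (size ks)%:Z) (j - (size ks)%:Z) (Gammaf F r ks m f) =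
  Gammaf F (r + 1) ks m (Cop i j f).
Proof.
elim: ks i j m f => [|k ks IH] i j m f.
  by rewrite /= !idfE !subr0; case: eqP => _; rewrite ?linear0.
have -> : (size (k :: ks))%:Z = (size ks)%:Z + 1 by rewrite /=; lia.
rewrite /= !ResE raddf_lsum; last exact: (Res_fsupp k (NP 1 (2 * r) (Gammaf F r ks)) m f).
by apply: eq_lsum => n /=; rewrite linearZ_LR (NP_Cop r IH).
Qed.

Lemma cfield_Cop r N n f :
  cfield F r N n f = lsum (fun q => binz F q N *: Cop (q - r) (n - q + N%:Z - r) f).
Proof.
by rewrite /cfield ResE; apply: eq_lsum => q; rewrite NP_efield.
Qed.

(** On charge r + n, n the length of ks, C carries the extra power (y_1 y_2)^n; this is the index
    shift of [Gamma_Cop]. *)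
Lemma Gamma_cfield ks r N m n f :
  cfield F (r + (size ks)%:Z) N n (Gammaf F r ks m f) =
  Gammaf F (r + 1) ks m (cfield F r N n f).
Proof.
rewrite !cfield_Cop raddf_lsum; last first.
  have := Res_fsupp N (NP hf r (efield hf r)) n f.
  by case=> K hK; exists K => q /hK <- /=; rewrite NP_efield.
apply: eq_lsum => q /=; rewrite linearZ_LR /=.
have -> : q - (r + (size ks)%:Z) = q - r - (size ks)%:Z by lia.
have -> : n - q + N%:Z - (r + (size ks)%:Z) = n - q + N%:Z - r - (size ks)%:Z by lia.
by rewrite (Gamma_Cop ks r (q - r) (n - q + N%:Z - r)).
Qed.
End Commutant.

Section BinomialIndependence.
Variables (F : fieldType) (V : lmodType F).

(** Taking differences in N removes u_0 and, by Pascal's rule, turns C(N + l + 1, l + 1) into C(N +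
    1 + l, l), so M decreases. *)
Lemma binomial_indep M (u : nat -> V) N0 :
  (forall N, (N0 <= N)%N -> \sum_(l < M) 'C(N + l, l)%:R *: u l = 0) ->
  forall l, (l < M)%N -> u l = 0.
Proof.
elim: M u N0 => // M IH u N0 u0.
have uS l : (l < M)%N -> u l.+1 = 0.
  apply: (IH (fun l => u l.+1) N0.+1) => -[|N] // hN.
  have hN' : (N0 <= N)%N by [].
  have h1 := u0 N hN'; have h2 := u0 N.+1 (leqW hN').
  rewrite big_ord_recl /= bin0 in h1; rewrite big_ord_recl /= bin0 in h2.
  have : \sum_(i < M) 'C(N.+1 + i.+1, i.+1)%:R *: u i.+1 -
         \sum_(i < M) 'C(N + i.+1, i.+1)%:R *: u i.+1 = 0.
    by have /addrI -> := etrans h2 (esym h1); rewrite subrr.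
  move=> E; rewrite -[RHS]E -sumrB; apply: eq_bigr => i _.
  by rewrite -scalerBl !addSn !addnS binS natrD addrC addKr.
move=> [_|l]; last by rewrite ltnS; apply: uS.
have := u0 N0 (leqnn _); rewrite big_ord_recl /= bin0 scale1r big1 ?addr0 // => i _.
by rewrite uS ?scaler0.
Qed.
End BinomialIndependence.

(** * The degree bound *)

Section Detection.
Variable F : fieldType.
Hypothesis charF : forall n : nat, (n.+1%:R : F) != 0.
Local Notation R := (fcar (free_mod F {poly nat})).
Local Notation hf := (fhalf F).
Local Notation one := (mon 0 : R).
Implicit Types (s : F) (f g : R) (a b l m i j w r p kap : int) (n k N : nat) (c : {poly nat}).

(** Recovers single coefficients of the bilocal field from its residues. In fixed total degree d and
    for large N, C(q, N) vanishes on the q >= 0 in the support; the q = - l - 1 remain, with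
    coefficients (-1)^N C(N + l, l), which are independent. *)
Lemma NP_efield_eq0 r f : (forall N j, j < 0 -> cfield F r N j f = 0) ->
  forall n m : int, n < 0 -> Cop F (n - r) (m - r) f = 0.
Proof.
move=> cf0 n m n0; pose d := n + m.
have [w w0 wf] := fil_ex f.
pose X q := NP hf r (efield hf r) q (d - q) f.
rewrite -NP_efield; have -> : m = d - n by rewrite /d; lia.
rewrite -/(X n).
pose M := (`|w| + `|d| + `|r| + `|n| + 1
           + `|bbd1 (NP hf r (efield hf r))| + `|bbd2 (NP hf r (efield hf r))|)%N.
have X0 q : (M <= `|q|)%N -> X q = 0.
  rewrite /M => hq; have [q0|q0] := lerP 0 q.
    by apply: (@bvan2 _ _ _ _ w) => //; lia.
  by apply: (@bvan1 _ _ _ _ w) => //; lia.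
suff h : forall l : nat, (l < M)%N -> X (- l%:Z - 1) = 0.
  have -> : n = - (`|n|.-1)%:Z - 1 by lia.
  by apply: h; rewrite /M; lia.
(* The threshold ensures both d - N < 0 and C(q, N) = 0 for 0 <= q < M. *)
apply: (@binomial_indep _ _ M (fun l : nat => X (- l%:Z - 1)) (`|d| + M).+1) => N hN.
have := cf0 N (d - N%:Z); rewrite /cfield ResE => /(_ _)/eqP.
have E q : NP hf r (efield hf r) q (d - N%:Z - q + N%:Z) f = X q.
  by rewrite /X; have -> : d - N%:Z - q + N%:Z = d - q by lia.
under eq_lsum => q do rewrite E.
rewrite (@lsum_range _ _ (- M%:Z) M); last first.
  move=> q hq; have [q0|q0] := ltrP q 0; first by rewrite X0 ?scaler0 //; lia.
  have [hM|hM] := leqP M `|q|; first by rewrite X0 ?scaler0.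
  have -> : q = `|q|%N%:Z by lia.
  by rewrite binz_nat // bin_small ?scale0r //; lia.
rewrite (reindex_inj rev_ord_inj) /=.
have -> : \sum_(k < M) binz F (- M%:Z + (M - k.+1)%N%:Z) N *: X (- M%:Z + (M - k.+1)%N%:Z) =
   (-1) ^+ N *: \sum_(l < M) 'C(N + l, l)%:R *: X (- l%:Z - 1).
  rewrite scaler_sumr; apply: eq_bigr => l _.
  have -> : - M%:Z + (M - l.+1)%N%:Z = - l%:Z - 1 by have := ltn_ord l; lia.
  by rewrite binz_neg // scalerA.
move=> h; have {h} := h ltac:(lia).
by rewrite scaler_eq0 signr_eq0 /= => /eqP.
Qed.

Lemma max_Qop s f b : Qop s b f != 0 ->
  exists2 b0, b <= b0 & Qop s b0 f != 0 /\ forall b', b0 < b' -> Qop s b' f = 0.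
Proof.
move=> bf; have [w w0 wf] := fil_ex f.
have Q0 b' : w < b' -> Qop s b' f = 0.
  by move=> h; apply: (@fil_lt0 _ (w - b')); [lia | apply: fil_Qop].
have [n hn] : exists n : nat, (w - b) <= n%:Z by exists `|w - b|%N; lia.
elim: n b bf hn => [|n IH] b bf hn.
  exists b => //; split=> // b' hb'; apply: Q0; lia.
have [|none] := boolP [exists i : 'I_n.+1, Qop s (b + i.+1%:Z) f != 0].
  case/existsP => i hi; have [|b0 hb0 h0] := IH _ hi; first by lia.
  by exists b0 => //; lia.
exists b => //; split => // b' hb'.
have [hb|hb] := lerP b' w; last exact: Q0.
have hi : (`|b' - b|.-1 < n.+1)%N by lia.
move: none; rewrite negb_exists => /forallP/(_ (Ordinal hi)) /=.
rewrite negbK => /eqP <-; congr (Qop _ _ _); lia.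
Qed.

(** To the lowest power of y_1 only S_0 = 1 contributes. *)
Lemma Cop_top i b f : (forall b', b < b' -> Qop hf b' f = 0) ->
  Cop F (- b) i f = efield hf 0 i (Qop hf b f).
Proof.
move=> bmax; rewrite Cop_conjS /conjS (@lsum1 _ _ b) ?addNr ?Sop_0 // => b' bb'.
have [h|h] := ltrP b b'; first by rewrite bmax // linear0 Sop0.
by rewrite Sop_lt0 //; lia.
Qed.

Lemma efield_top b f : (forall b', b < b' -> Qop hf b' f = 0) ->
  efield hf 0 (- b) f = Qop hf b f.
Proof.
move=> bmax; rewrite efield_conjS /conjS (@lsum1 _ _ b) ?addNr ?Sop_0 // => b' bb'.
have [h|h] := ltrP b b'; first by rewrite bmax //= Sop0.
by rewrite Sop_lt0 //; lia.
Qed.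

(* The top coefficient of Q_{1/2}(y_1) f would be killed by the whole of S_{1/2}(y_2) Q_{1/2}(y_2),
   whose own top coefficient on it is nonzero. *)
Lemma cfield_detect r f : (forall N j, j < 0 -> cfield F r N j f = 0) ->
  forall b, r < b -> Qop hf b f = 0.
Proof.
move=> /NP_efield_eq0 C0 b rb; apply/eqP/negPn/negP => bf.
have [b0 hb0 [b0f b0max]] := max_Qop bf.
have E0 j : efield hf 0 j (Qop hf b0 f) = 0.
  rewrite -Cop_top //; have -> : - b0 = (r - b0) - r by lia.
  by have -> : j = j + r - r by [lia]; apply: C0; lia.
(* Since Q_0 = 1, there is a nonzero coefficient from which [max_Qop] can start. *)
have q0 : Qop hf 0 (Qop hf b0 f) != 0 by rewrite Qop_0.
have [b1 hb1 [b1f b1max]] := max_Qop q0.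
by move: b1f; rewrite -efield_top // E0 eqxx.
Qed.

(** The span D_n, stated as its own induction principle. *)
Definition Dspan n f := forall P : R -> Prop, P 0 ->
  (forall (x : F) f g, P f -> P g -> P (x *: f + g)) ->
  (forall ks, size ks = n -> P (hvec F ks)) -> P f.

Lemma Dspan0 n : Dspan n 0. Proof. by move=> P. Qed.

Lemma DspanP n (x : F) f g : Dspan n f -> Dspan n g -> Dspan n (x *: f + g).
Proof. by move=> Df Dg P P0 PS Ph; apply: (PS); [exact: (Df P P0 PS Ph) | exact: (Dg P P0 PS Ph)]. Qed.

Lemma Dspan_hvec ks : Dspan (size ks) (hvec F ks).
Proof. by move=> P _ _; apply. Qed.

Lemma Qop_one s b : 0 < b -> Qop s b one = 0.
Proof.
move=> b0; have := @fil_Qop F s b _ _ (@fil_mon F 0).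
rewrite (_ : wdegp 0 = 0%N); last by rewrite /wdegp size_poly0 big_ord0.
by apply: fil_lt0; lia.
Qed.

(** Q_{1/2}(y) multiplies the generating function of the products by prod_i (1 - t_i/y), of degree n
    in 1/y. *)
Lemma Qop_hvec_gt b ks : (size ks)%:Z < b -> Qop hf b (hvec F ks) = 0.
Proof.
elim: ks b => [|k ks IH] b hb; first by apply: Qop_one.
move: hb => /= hb; rewrite (Qop_Sop charF _ _ _ (half1 charF)).
by rewrite !IH ?Sop0 ?subr0 //; lia.
Qed.

(** The top coefficient of prod_i (1 - t_i/y) is (-1)^n prod_i t_i, which lowers every index by
    one. *)
Lemma Qop_hvec_top ks :
  Qop hf (size ks)%:Z (hvec F (map succn ks)) = (-1) ^+ size ks *: hvec F ks.
Proof.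
elim: ks => [|k ks IH]; first by rewrite /= expr0 scale1r Qop_0.
rewrite /= (Qop_Sop charF _ _ _ (half1 charF)) Qop_hvec_gt ?Sop0 ?sub0r; last first.
  by rewrite size_map; lia.
have -> : (size ks).+1%:Z - 1 = (size ks)%:Z by lia.
have -> : k.+1%:Z - 1 = k%:Z by lia.
by rewrite IH SopZ exprS mulN1r scaleNr.
Qed.

Lemma Dspan_lift n g : Dspan n g -> exists f, [/\ Dspan n f, Qop hf n%:Z f = g
  & forall b, n%:Z < b -> Qop hf b f = 0].
Proof.
move=> Dg; apply: (Dg (fun g => exists f, [/\ Dspan n f, Qop hf n%:Z f = g
  & forall b, n%:Z < b -> Qop hf b f = 0])).
- by exists 0; split=> [||b _]; rewrite ?Qop0 //; apply: Dspan0.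
- move=> x g1 g2 [f1 [D1 E1 Z1]] [f2 [D2 E2 Z2]].
  exists (x *: f1 + f2); split=> [||b hb]; first exact: DspanP.
    by rewrite QopD QopZ E1 E2.
  by rewrite QopD QopZ Z1 // Z2 // scaler0 addr0.
move=> ks <-; exists ((-1) ^+ size ks *: hvec F (map succn ks)); split=> [||b hb].
- rewrite -[X in Dspan _ X]addr0; apply: DspanP; last exact: Dspan0.
  by rewrite -(size_map succn); apply: Dspan_hvec.
- by rewrite QopZ Qop_hvec_top scalerA -exprMn mulrNN mulr1 expr1n scale1r.
by rewrite QopZ Qop_hvec_gt ?scaler0 // size_map.
Qed.

(** In [Qop_rec] only the term l = b survives, so every derivative of f vanishes and f is a
    constant. *)
Lemma Qop_const f : (forall b, 0 < b -> Qop hf b f = 0) -> Dspan 0 f.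
Proof.
move=> f0; have hf0 : hf != 0.
  by apply/eqP => h0; have := half1 charF; rewrite h0 mulr0 mul0r => /esym/eqP; rewrite oner_eq0.
have a0 b : 0 < b -> aop b f = 0.
  move=> b0; have := Qop_rec hf b f; rewrite f0 // scaler0 (@lsum1 _ _ b).
    rewrite subrr Qop_0 // => /esym/eqP; rewrite scaler_eq0 oppr_eq0 (negbTE hf0) /=.
    by move/eqP.
  move=> l lb; have [l0|l0] := lerP l 0; first exact: aop_le0.
  have [h|h] := ltrP b l; first by rewrite Qop_lt0 ?aop0 //; lia.
  by rewrite f0 ?aop0 //; lia.
have -> : f = mcoef 0 f *: hvec F [::] + 0.
  rewrite addr0; apply: eq_mcoef => c; rewrite mcoefZ mcoef_mon.
  have [<-|c0] := eqVneq 0 c; first by rewrite mulr1.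
  rewrite mulr0; have [i ci] : exists i : nat, (0 < cf c i)%N.
    exists (size c).-1; rewrite lt0n; apply: contra c0 => h.
    by rewrite eq_sym -lead_coef_eq0.
  have := congr1 (mcoef (csub c i)) (@a0 i.+1%:Z isT).
  rewrite coef_aop // mcoef0 csubK //= => /eqP; rewrite mulf_eq0 => /orP[|/eqP//].
  by rewrite -[(_ * _)%N]prednK ?(negbTE (charF _)) // !muln_gt0.
by apply: DspanP; [exact: (@Dspan_hvec [::]) | exact: Dspan0].
Qed.

(** Because h_0 = 1. *)
Lemma Dspan_pad n f : Dspan n f -> Dspan n.+1 f.
Proof.
move=> Df; apply: (Df (Dspan n.+1)) => [|x g h Dg Dh|ks <-].
- exact: Dspan0.
- exact: DspanP Dg Dh.
have -> : hvec F ks = hvec F (0%N :: ks) by rewrite /= Sop_0.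
exact: (@Dspan_hvec (0%N :: ks)).
Qed.

(** Outer induction on the degree bound, inner induction on the order of nilpotency of Q_{n+1} on f.
    The top coefficient of f lies in D_{n+1} by the inner induction; subtracting a lift of it lowers
    the degree. *)
Lemma Qop_bounded_Dspan n f : (forall b, n%:Z < b -> Qop hf b f = 0) -> Dspan n f.
Proof.
elim: n f => [|n IHn] f fb; first exact: Qop_const.
have [j] : exists j : nat, iter j (Qop hf n.+1%:Z) f = 0.
  have [w w0 wf] := fil_ex f; exists `|w|.+1%N.
  have h (i : nat) : fil (w - i%:Z * n.+1%:Z) (iter i (Qop hf n.+1%:Z) f).
    elim: i => [|i IH] /=; first by rewrite mul0r subr0.
    have := @fil_Qop F hf n.+1%:Z _ _ IH.
    by have -> : w - i%:Z * n.+1%:Z - n.+1%:Z = w - i.+1%:Z * n.+1%:Z by lia.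
  by apply: fil_lt0 (h _); nia.
elim: j f fb => [|j IHj] f fb /= fj; first by rewrite fj; apply: Dspan0.
have [|f' [Df' f'E f'b]] := @Dspan_lift n.+1 (Qop hf n.+1%:Z f).
  apply: IHj; last by rewrite -iterSr.
  by move=> b hb; rewrite QopC // fb // Qop0.
have -> : f = 1 *: (f - f') + f' by rewrite scale1r subrK.
apply: (@DspanP n.+1 1 (f - f') f'); last exact: Df'.
apply: (@Dspan_pad n (f - f')); apply: IHn => b hb.
rewrite linearB /=; have [h|h] := ltrP n.+1%:Z b; first by rewrite fb // f'b // subr0.
by have -> : b = n.+1%:Z by [lia]; rewrite f'E subrr.
Qed.
End Detection.

(** * Generation by e^alpha *)

Section Generation.
Variable F : fieldType.
Hypothesis charF : forall n : nat, (n.+1%:R : F) != 0.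
Local Notation R := (fcar (free_mod F {poly nat})).
Local Notation one := (mon 0 : R).
Implicit Types (s : F) (f g : R) (a b l m j w r p kap : int) (n k i N : nat) (c : {poly nat}).

Lemma fsupp_efield s kap j f : fsupp (fun b => Sop s (j + b - kap) (Qop s b f)).
Proof. by apply: (@fsupp_Qop F s (fun b g => Sop s (j + b - kap) g)) => b; apply: Sop0. Qed.

Lemma efield_Sop1 kap j a f : efield 1 kap j (Sop 1 a f) =
  Sop 1 a (efield 1 kap j f) - 2 *: Sop 1 (a - 1) (efield 1 kap (j + 1) f)
  + Sop 1 (a - 2) (efield 1 kap (j + 2) f).
Proof.
have fs j' a' : fsupp (fun b => Sop 1 a' (Sop 1 (j' + b - kap) (Qop 1 b f))).
  by have [N hN] := fsupp_efield 1 kap j' f; exists N => b /hN ->; apply: Sop0.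
have SE j' a' (n : int) : Sop 1 a' (efield 1 kap (j' + n) f) =
    lsum (fun b => Sop 1 a' (Sop 1 (j' + b - kap) (Qop 1 (b - n) f))).
  rewrite efieldE raddf_lsum; last exact: fsupp_efield.
  rewrite -(lsum_shift (- n)); last exact: fs.
  apply: eq_lsum => b /=.
  by have -> : j' + n + (b + - n) - kap = j' + b - kap by lia.
have fsS j' a' (n : int) : fsupp (fun b => Sop 1 a' (Sop 1 (j' + b - kap) (Qop 1 (b - n) f))).
  have [N hN] := fsupp_shift (- n) (fs (j' + n) a'); exists N => b /hN /= <-.
  by have -> : j' + n + (b - n) - kap = j' + b - kap by lia.
have SE0 : Sop 1 a (efield 1 kap j f) =
    lsum (fun b => Sop 1 a (Sop 1 (j + b - kap) (Qop 1 b f))).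
  by rewrite efieldE raddf_lsum //; apply: fsupp_efield.
rewrite SE0 !SE efieldE scaler_lsum // -lsumN; last exact: fsuppZ.
have fN (U : int -> R) : fsupp U -> fsupp (fun b : int => - (2 *: U b) : R).
  by move=> fU; apply: fsuppN; apply: fsuppZ.
rewrite -lsumD //; last exact: fN.
rewrite -lsumD //; last by apply: fsuppD => //; apply: fN.
apply: eq_lsum => b; rewrite (Qop_Sop2 charF) SopD (linearB (Sop 1 _)) /= SopZ.
by rewrite !(SopC charF 1 (j + b - kap)).
Qed.

Lemma efield_shift s kap kap' j f : efield s (kap + kap') j f = efield s kap (j - kap') f.
Proof.
rewrite !efieldE; apply: eq_lsum => b.
by have -> : j + b - (kap + kap') = j - kap' + b - kap by lia.
Qed.

Lemma efield_one s j : efield s 0 j one = Sop s j one.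
Proof.
rewrite efieldE (@lsum1 _ _ 0) ?Qop_0 ?addr0 ?subr0 // => b b0.
have [h|h] := ltrP 0 b; first by rewrite Qop_one // Sop0.
by rewrite Qop_lt0 ?Sop0 //; lia.
Qed.

(** The factor prod_i (z - t_i)^2 has no negative powers of z. *)
Lemma efield_hvec_lt0 ks j : j < 0 -> efield 1 (2 * (size ks)%:Z) j (hvec F ks) = 0.
Proof.
elim: ks j => [|k ks IH] j j0; first by rewrite /= mulr0 efield_one Sop_lt0.
have -> : 2 * (size (k :: ks))%:Z = 2 * (size ks)%:Z + 2 by rewrite /=; lia.
move: (2 * (size ks)%:Z) IH => kap IH.
rewrite /= efield_Sop1 (efield_shift 1 kap 2 j) (efield_shift 1 kap 2 (j + 1)).
rewrite (efield_shift 1 kap 2 (j + 2)).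
rewrite (IH (j - 2)); last by lia.
rewrite (IH (j + 1 - 2)); last by lia.
rewrite (IH (j + 2 - 2)); last by lia.
by rewrite !Sop0 scaler0 subr0 addr0.
Qed.

Definition Sops (ks : seq nat) f : R := foldr (fun k f => Sop 1 k%:Z f) f ks.

Lemma Sops_Sop ks a f : Sops ks (Sop 1 a f) = Sop 1 a (Sops ks f).
Proof. by elim: ks => //= k ks ->; rewrite SopC. Qed.

Lemma Sops_linear ks (x : F) f g : Sops ks (x *: f + g) = x *: Sops ks f + Sops ks g.
Proof. by elim: ks => //= k ks ->; rewrite SopD SopZ. Qed.

Lemma Sops0 ks : Sops ks 0 = 0.
Proof. by elim: ks => //= k ks ->; rewrite Sop0. Qed.

Lemma Sops_cat ks ks' f : Sops (ks ++ ks') f = Sops ks (Sops ks' f).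
Proof. by rewrite /Sops foldr_cat. Qed.

(* The generating function of e^alpha(z) applied to h(t_1)...h(t_n) is
   prod_i (z - t_i)^2 h(z) h(t_1)...h(t_n); the factors (z - t_i)^2 are divided out one at
   a time, by induction on the power of z. *)
Lemma divide_factors (P : R -> Prop) n :
  (forall (x : F) f g, P f -> P g -> P (x *: f + g)) ->
  forall ks1, (forall ks2 j, size ks2 = n -> P (Sops ks1 (efield 1 (2 * n%:Z) j (hvec F ks2)))) ->
  forall ks2 a, size ks2 = n -> P (Sops ks1 (Sops ks2 (Sop 1 a one))).
Proof.
move=> PP; elim: n => [|n IH] ks1 Pe.
  move=> [|//] a _; have := Pe [::] a erefl.
  by rewrite mulr0 efield_one.
move=> [//|k ks2] a [sz].
(* The factor h_k moves to [ks1], where it is no longer coupled to z; one factor (z - t_i)^2 has to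
   be removed for this. *)
rewrite -[k :: ks2]/([:: k] ++ ks2) Sops_cat -Sops_cat.
apply: IH => // {ks2 a sz} ks2 j sz; rewrite Sops_cat /= -/(Sops _ _).
(* P is closed under combinations only, so 0 is obtained as - v + v from some member v. *)
have P0 : P 0 by have := PP (-1) _ _ (Pe (nseq n.+1 0%N) 0 (size_nseq _ _))
  (Pe (nseq n.+1 0%N) 0 (size_nseq _ _)); rewrite scaleN1r addNr.
pose G j (k : nat) := Sops ks1 (Sop 1 k%:Z (efield 1 (2 * n%:Z) j (hvec F ks2))).
(* All k at once: solving the relation for G j k refers to k + 1 and k + 2 at lower powers of z. *)
suff h : forall (M : nat) j k, j <= M%:Z -> P (G j k).
  by apply: (h `|j|%N); lia.
have neg j' k' : j' < 0 -> G j' k' = 0.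
  by move=> hj; rewrite /G -sz efield_hvec_lt0 // Sop0 Sops0.
have efield_shift2 j' f : efield 1 (2 * n%:Z + 2) j' f = efield 1 (2 * n%:Z) (j' - 2) f.
  exact: efield_shift.
have rel j' k' : P (G (j' - 2) k'.+2 - 2 *: G (j' - 1) k'.+1 + G j' k').
  have := Pe (k'.+2 :: ks2) j'; rewrite /= sz => /(_ erefl).
  have -> : 2 * n.+1%:Z = 2 * n%:Z + 2 by lia.
  rewrite efield_Sop1 (efield_shift2 j') (efield_shift2 (j' + 1)) (efield_shift2 (j' + 2)).
  have -> : j' + 1 - 2 = j' - 1 by lia.
  have -> : j' + 2 - 2 = j' by lia.
  have -> : k'.+2%:Z - 1 = k'.+1%:Z by lia.
  have -> : k'.+2%:Z - 2 = k'%:Z by lia.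
  rewrite -[Sop 1 k'.+2%:Z _]scale1r -scaleNr -addrA Sops_linear Sops_linear scale1r.
  by rewrite addrA scaleNr.
have step j' k' : P (G (j' - 2) k'.+2) -> P (G (j' - 1) k'.+1) -> P (G j' k').
  move=> h2 h1; have := PP (-1) _ _ h2 (PP 2 _ _ h1 (rel j' k')).
  set u := G (j' - 2) _; set v := G (j' - 1) _; set w := G j' _.
  have -> : -1 *: u + (2 *: v + (u - 2 *: v + w)) = w; last by [].
  by rewrite scaleN1r -addrA (addrCA (2 *: v)) addKr addNKr.
elim=> [|M IHM] j' k' hj.
  have [h|h] := ltrP j' 0; first by rewrite neg.
  by apply: step; rewrite neg //; lia.
have [h|h] := ltrP j' 0; first by rewrite neg.
by apply: step; apply: IHM; lia.
Qed.

(** P p f stands for membership of f e^{p alpha} in W; the last hypothesis is closure under the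
    modes of e^alpha. *)
Lemma hvec_generated (P : nat -> R -> Prop) :
  (forall (p : nat) (x : F) f g, P p f -> P p g -> P p (x *: f + g)) ->
  P 0%N one ->
  (forall (p : nat) f j, P p f -> P p.+1 (efield 1 (2 * p%:Z) j f)) ->
  forall ks, P (size ks) (hvec F ks).
Proof.
move=> PP P1 Pe ks; have [n sz] : exists n, size ks = n by exists (size ks).
rewrite sz; elim: n ks sz => [|n IH] [|k ks] //= [sz].
have := @divide_factors (P n.+1) n (@PP n.+1) [::] _ ks k%:Z sz.
rewrite /= Sops_Sop -/(hvec F ks); apply => ks2 j sz2.
by apply: Pe; apply: IH.
Qed.

(** On the vacuum the annihilation terms vanish, the binomial coefficient is 0 for 0 < l < k, and
    the terms l >= k involve only coefficients of index at most j of the inner field. *)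
Lemma Yf_one_lt0 p ks j : j < 0 -> Yf F 0 p ks j one = 0.
Proof.
elim: ks j => [|k ks IH] j j0.
  by rewrite /Yf /= mulr0 efield_one Sop_lt0.
rewrite /= NopE; apply: lsum0 => l; rewrite LopE; case: ifP => l0.
  have [lk|kl] := leqP k `|l|%N; first by rewrite IH ?xop0 ?scaler0 //; lia.
  have -> : l - 1 = (`|l|.-1)%N%:Z by lia.
  by rewrite binz_nat // bin_small ?scale0r //; lia.
have -> : az 0 (- l) one = 0.
  rewrite /az; case: eqP => [_|/eqP h]; first by rewrite mulr0 scale0r.
  have := @fil_aop F _ (- l) _ (@fil_mon F 0).
  rewrite (_ : wdegp 0 = 0%N); last by rewrite /wdegp size_poly0 big_ord0.
  by apply: fil_lt0; lia.
by rewrite linear0 scaler0.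
Qed.

Lemma Yf_one_0 p ks : all (leq 1) ks ->
  Yf F 0 p ks 0 one = mon (\sum_(k <- ks) 'X^(k.-1)).
Proof.
elim: ks => [|k ks IH].
  by rewrite /Yf /= mulr0 efield_one Sop_0 big_nil.
move=> /= /andP[k0 hks]; rewrite NopE (@lsum1 _ _ k%:Z).
  have -> : k%:Z - 1 = (k.-1)%:Z by lia.
  rewrite binz_nat // binn scale1r LopE ifT; last by lia.
  have k0' : 0 < k%:Z by lia.
  by rewrite add0r subrr IH // (xopU k0') big_cons addrC.
move=> l lk; rewrite LopE; case: ifP => l0.
  have [kl|kl] := ltnP k `|l|%N; first by rewrite Yf_one_lt0 ?xop0 ?scaler0 //; lia.
  have -> : l - 1 = (`|l|.-1)%N%:Z by lia.
  by rewrite binz_nat // bin_small ?scale0r //; lia.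
have -> : az 0 (- l) one = 0.
  rewrite /az; case: eqP => [_|/eqP h]; first by rewrite mulr0 scale0r.
  have := @fil_aop F _ (- l) _ (@fil_mon F 0).
  rewrite (_ : wdegp 0 = 0%N); last by rewrite /wdegp size_poly0 big_ord0.
  by apply: fil_lt0; lia.
by rewrite linear0 scaler0.
Qed.

Lemma cf_sum (ks : seq nat) i : all (leq 1) ks ->
  cf (\sum_(k <- ks) 'X^(k.-1)) i = count_mem i.+1 ks.
Proof.
elim: ks => [|k ks IH] /=; first by rewrite big_nil /cf polyseq0 nth_nil.
move=> /andP[k0 /IH E]; rewrite big_cons cfD cfXn E.
by congr (_ + _)%N; rewrite -[in RHS](prednK k0) eqSS eq_sym.
Qed.

Lemma modesp_ge1 c : all (leq 1) (modesp c).
Proof.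
apply/allP => -[|x] // h; exfalso; move: h.
by rewrite -has_pred1 has_count count_modes.
Qed.

Lemma creation p c : Yc F 0 p c 0 one = mon c.
Proof.
rewrite /Yc Yf_one_0 ?modesp_ge1 //; congr mon; apply: eq_expo => i.
by rewrite cf_sum ?modesp_ge1 // count_modes.
Qed.
End Generation.

(** * The dual pair *)

Lemma charCx (n : nat) : (n.+1%:R : Cx) != 0.
Proof.
pose Cn : numDomainType := complex.complex Rdefinitions.R.
have h : (n.+1%:R : Cn) != 0 by rewrite pnatr_eq0.
exact: h.
Qed.
Opaque Cx.

Local Notation R := (fcar (free_mod Cx {poly nat})).
Local Notation one := (mon 0 : R).

Section Components.
Implicit Types (v w : vec) (f g : R) (p q r m n j l : int) (c : {poly nat}) (e : seq nat).

(* The component of charge r, and [Psi] the homogeneous vector with given component. *)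
Definition Phi v r : R := \sum_(x <- v | x.2.1 == r) x.1 *: mon (Poly x.2.2).

Lemma PhiE v r : Phi v r = \sum_(x <- v) (if x.2.1 == r then x.1 *: mon (Poly x.2.2) else 0).
Proof. exact: big_mkcond. Qed.

Lemma Phi0 r : Phi vzero r = 0. Proof. exact: big_nil. Qed.

Lemma Phi_add v w r : Phi (vadd v w) r = Phi v r + Phi w r.
Proof. exact: big_cat. Qed.

Lemma Phi_scale (x : Cx) v r : Phi (vscale x v) r = x *: Phi v r.
Proof.
rewrite /Phi /vscale big_map scaler_sumr; apply: eq_bigr => y _.
by rewrite scalerA.
Qed.

Lemma Phi1 (x : Cx) p e r :
  Phi [:: (x, (p, e))] r = if p == r then x *: mon (Poly e) else 0.
Proof. by rewrite PhiE big_seq1. Qed.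

Lemma Phi_flatten I (s : seq I) (G : I -> vec) r :
  Phi (flatten [seq G i | i <- s]) r = \sum_(i <- s) Phi (G i) r.
Proof.
elim: s => [|i s IH]; first by rewrite big_nil [LHS]Phi0.
by rewrite big_cons -IH /= [LHS]Phi_add.
Qed.

Lemma Phi_lift (h : key -> vec) v r :
  Phi (Defs.lift h v) r = \sum_(x <- v) x.1 *: Phi (h x.2) r.
Proof. by rewrite Phi_flatten; apply: eq_bigr => x _; rewrite Phi_scale. Qed.

Lemma Phi_lift_homog (h : key -> vec) (T : int -> {linear R -> R}) p v r :
  (forall q e, Phi (h (q, e)) r = if q + p == r then T q (mon (Poly e)) else 0) ->
  Phi (Defs.lift h v) r = T (r - p) (Phi v (r - p)).
Proof.
move=> hE; rewrite Phi_lift PhiE linear_sum; apply: eq_bigr => -[x [q e]] _ /=.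
have -> : (q == r - p) = (q + p == r) by lia.
rewrite hE; case: eqP => [<-|_]; first by rewrite addrK linearZ_LR.
by rewrite scaler0 linear0.
Qed.

Lemma eqexpE e e' : eqexp e e' = (Poly e == Poly e' :> {poly nat}).
Proof.
apply/allP/eqP => [h|h i _]; last by rewrite -!cf_Poly h.
apply: eq_expo => i; rewrite !cf_Poly.
case: (ltnP i (maxn (size e) (size e'))) => hi.
  by apply/eqP/h; rewrite mem_iota.
by move: hi; rewrite geq_max => /andP[h1 h2]; rewrite !nth_default.
Qed.

Lemma coef_Phi v k : coef v k = mcoef (Poly k.2) (Phi v k.1).
Proof.
rewrite /coef /Phi mcoef_sum big_mkcondr; apply: eq_bigr => x _.
by rewrite mcoefZ mcoef_mon eqexpE; case: eqP => _; rewrite ?mulr1 ?mulr0.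
Qed.

Lemma veqP v w : veq v w <-> forall r, Phi v r = Phi w r.
Proof.
split=> [h r|h k]; last by rewrite !coef_Phi h.
by apply: eq_mcoef => c; have := h (r, polyseq c); rewrite !coef_Phi /= polyseqK.
Qed.

Definition Psi p f : vec := [seq (mcoef c f, (p, polyseq c)) | c <- supp f].

Lemma Phi_Psi p f r : Phi (Psi p f) r = if p == r then f else 0.
Proof.
rewrite PhiE /Psi big_map /=; case: eqP => _; last by rewrite big1.
by rewrite [RHS]expand; apply: eq_bigr => c _; rewrite polyseqK.
Qed.

Definition charges v : seq int := undup [seq x.2.1 | x <- v].

Lemma Phi_charges v r : r \notin charges v -> Phi v r = 0.
Proof.
rewrite mem_undup => rv; rewrite /Phi big_seq_cond big1 // => x /andP[xv /eqP xr].
by case/negP: rv; apply/mapP; exists x.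
Qed.

Lemma Psi_sum v : veq (flatten [seq Psi p (Phi v p) | p <- charges v]) v.
Proof.
apply/veqP => r; rewrite Phi_flatten; under eq_bigr do rewrite Phi_Psi.
case: (boolP (r \in charges v)) => hr; last first.
  rewrite Phi_charges // big_seq big1 // => p hp; case: eqP => // pr.
  by rewrite -pr hp in hr.
rewrite (bigD1_seq r) ?undup_uniq //= eqxx big1 ?addr0 // => p pr.
by rewrite (negbTE pr).
Qed.

Lemma subspace_components (P : vec -> Prop) v : vsubspace P ->
  (forall p, P (Psi p (Phi v p))) -> P v.
Proof.
case=> Pe P0 PD _ h; apply: Pe (Psi_sum v).
by elim: (charges v) => //= p s IH; apply: PD.
Qed.
End Components.

(** * The given modes as coefficients of fields *)

Section ModeComponents.
Implicit Types (v w : vec) (f g : R) (p q r m n j l : int) (c : {poly nat}) (e : seq nat).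

Definition hop q j : {linear R -> R} :=
  if j < 0 then xop (- j) : {linear R -> R} else az q j : {linear R -> R}.

Lemma hopE q j f : hop q j f = if j < 0 then xop (- j) f else az q j f.
Proof. by rewrite /hop; case: ifP. Qed.

Lemma Phi_heis j q e r :
  Phi (heis j (q, e)) r = if q + 0 == r then hop q j (mon (Poly e)) else 0.
Proof.
rewrite addr0 hopE /heis /=; case: ltrP => j0.
  rewrite Phi1; case: eqP => _ //; rewrite scale1r.
  have j0' : 0 < - j by lia.
  rewrite (xopU j0'); congr mon; apply: eq_expo => i.
  by rewrite cfD !cf_Poly nth_incr_nth cfXn abszN addnC eq_sym.
case: (eqVneq j 0) => [->|jn]; first by rewrite Phi1 az0.
rewrite Phi1; case: eqP => _ //; have jp : 0 < j by lia.
rewrite az_gt0 // (aopU jp) cf_Poly.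
congr (_ *: mon _); apply: eq_expo => i.
rewrite cf_Poly nth_set_nth /= cf_csub cf_Poly eq_sym.
by case: eqP => [->|_]; rewrite ?subn1 ?subn0.
Qed.

Lemma Poly_combexp e a b : size a = size e ->
  Poly (combexp e a b) = Poly (mkseq (fun i => nth 0 e i - nth 0 a i)%N (size e)) + Poly b
  :> {poly nat}.
Proof.
move=> sa; apply: eq_expo => i; rewrite cfD !cf_Poly /combexp.
case: (ltnP i (maxn (size e) (size b))) => hi.
  rewrite nth_mkseq //; congr (_ + _)%N.
  case: (ltnP i (size e)) => hi'; first by rewrite nth_mkseq.
  by rewrite [RHS]nth_default ?size_mkseq // nth_default.
move: (hi); rewrite geq_max => /andP[h1 h2].
by rewrite !nth_default ?size_mkseq.
Qed.

(** Returns to the sum over [subvecs], the shape used by [emode]. *)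
Lemma Qop_raw (s : Cx) b e :
  Qop s b (mon (Poly e)) = \sum_(a <- subvecs e) (if (wdeg a)%:Z == b then
   (\prod_(i < size a) ('C(nth 0%N e i, nth 0%N a i)%:R * (- 2 * s) ^+ nth 0%N a i)) *:
    mon (Poly (mkseq (fun i => nth 0 e i - nth 0 a i)%N (size e))) else 0) :> R.
Proof.
case: b => [N|N]; last by rewrite Qop_lt0 // big1 // => a _; rewrite ifF.
transitivity (Qvec s e N); last exact: big_mkcond.
rewrite (Qop_mon s N); apply: eq_mcoef => d.
by rewrite !coef_Qvec polyseqK.
Qed.

Lemma Sop_raw (s : Cx) a c : Sop s a (mon c) =
  if a < 0 then 0 else \sum_(b <- parts `|a|%N) expc s (Poly b) *: mon (c + Poly b) :> R.
Proof.
case: ltrP => a0; first by rewrite Sop_lt0.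
case: a a0 => // N _; rewrite (Sop_mon s N) /Svec linear_sum; apply: eq_bigr => b _.
by rewrite linearZ_LR /= lext_mon.
Qed.

Lemma Phi_emode p m q e r : Phi (emode p m (q, e)) r =
  if q + p == r then efield (p%:~R : Cx) (2 * p * q) (- m - 1) (mon (Poly e)) else 0.
Proof.
rewrite Phi_flatten efieldE.
set s : Cx := p%:~R.
pose A a : Cx := \prod_(i < size a) ('C(nth 0%N e i, nth 0%N a i)%:R * (- 2 * s) ^+ nth 0%N a i).
pose M a : R := mon (Poly (mkseq (fun i => nth 0 e i - nth 0 a i)%N (size e))).
have -> : lsum (fun b => Sop s (- m - 1 + b - 2 * p * q) (Qop s b (mon (Poly e)))) =
  \sum_(a <- subvecs e) A a *: Sop s (- m - 1 - 2 * p * q + (wdeg a)%:Z) (M a).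
  transitivity (lsum (fun b => \sum_(a <- subvecs e)
     (if (wdeg a)%:Z == b then A a *: Sop s (- m - 1 + b - 2 * p * q) (M a) else 0))).
    apply: eq_lsum => b; rewrite Qop_raw linear_sum; apply: eq_bigr => a _.
    by case: eqP => _; [rewrite linearZ_LR | rewrite linear0].
  rewrite lsum_sum; last first.
    by move=> a _; exists (wdeg a).+1 => b hb; rewrite ifF //; lia.
  apply: eq_bigr => a _; rewrite (@lsum1 _ _ (wdeg a)%:Z) ?eqxx; last first.
    by move=> b ba; rewrite eq_sym (negbTE ba).
  congr (_ *: Sop s _ _); lia.
transitivity (\sum_(a <- subvecs e) if q + p == r then
    A a *: Sop s (- m - 1 - 2 * p * q + (wdeg a)%:Z) (M a) else 0); last first.
  by case: eqP => // _; rewrite big1.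
apply: eq_big_seq => a /subvecsP[sa _]; rewrite Sop_raw /=.
case: ltrP => h0; first by rewrite [LHS]Phi0 scaler0 if_same.
rewrite PhiE big_map /=; case: eqP => _; last by rewrite big1.
rewrite scaler_sumr; apply: eq_bigr => b _; rewrite scalerA (Poly_combexp b sa).
congr (_ * _ *: _).
  rewrite big_mkord; apply: eq_bigr => i _; congr (_ * _ ^+ _).
  by rewrite intrM.
rewrite big_mkord (@expcE _ (size b)) ?size_Poly //; apply: eq_bigr => i _.
by rewrite cf_Poly.
Qed.

(** Shaped after the sum in [Ymode], whose term i pairs the creation mode l = k + i with the mode l
    = - i. Here k is one less than there, and the gap in between is where the binomial coefficient
    vanishes. *)
Lemma lsum_two_sided (V : zmodType) (G : int -> V) (k N : nat) :
  (forall i : nat, (N <= i)%N -> G (- i%:Z) = 0) ->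
  (forall i : nat, (i < k)%N -> G i.+1%:Z = 0) ->
  (forall i : nat, (N <= i)%N -> G (k.+1 + i)%N%:Z = 0) ->
  lsum G = \sum_(i < N) (G (k.+1 + i)%N%:Z + G (- i%:Z)).
Proof.
move=> G1 G2 G3; rewrite (@lsum_range _ _ (1 - N%:Z) (N + (k + N))); last first.
  move=> i hi; case: (ltrP i 0) => i0.
    by have -> : i = - `|i|%N%:Z by [lia]; apply: G1; lia.
  case: (leqP `|i|%N k) => hk.
    case: (posnP `|i|%N) => i00; last first.
      by have -> : i = (`|i|.-1).+1%:Z by [lia]; apply: G2; lia.
    by have -> : i = - 0%N%:Z by [lia]; apply: G1; lia.
  have -> : i = (k.+1 + (`|i| - k.+1))%N%:Z by lia.
  by apply: G3; lia.
rewrite big_split_ord /= big_split_ord /= big_split /= addrC; congr (_ + _).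
  rewrite big1 ?add0r => [|i _]; last first.
    have -> : 1 - N%:Z + (N + i)%N%:Z = i.+1%:Z by lia.
    exact: G2.
  apply: eq_bigr => i _; congr G; lia.
rewrite (reindex_inj rev_ord_inj); apply: eq_bigr => i _ /=; congr G.
by have := ltn_ord i; lia.
Qed.

Definition Ybound ks p m q e : nat :=
  (size e + `|((sumn ks)%:Z + p * p + wt (q, e) - m)%R|).+1.

Lemma Phi_Ymode_cons k ks p m q e r : Phi (Ymode (k :: ks) p m (q, e)) r =
  \sum_(i < Ybound ks p m q e)
   (('C(k + i - 1, i))%:R *:
      Phi (Defs.lift (heis (- (k + i)%N%:Z)) (Ymode ks p (m + i%:Z) (q, e))) r
    - ((-1) ^+ k * ('C(k + i - 1, i))%:R) *:
      Phi (Defs.lift (Ymode ks p (m - k%:Z - i%:Z)) (heis i%:Z (q, e))) r).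
Proof.
rewrite [LHS]Phi_flatten -/(Ybound ks p m q e).
have -> : iota 0 (Ybound ks p m q e) = index_iota 0 (Ybound ks p m q e).
  by rewrite /index_iota subn0.
rewrite big_mkord; apply: eq_bigr => i _.
by rewrite Phi_add !Phi_scale scaleNr.
Qed.

Lemma Phi_Ymode ks p m q e r : all (leq 1) ks -> Phi (Ymode ks p m (q, e)) r =
  if q + p == r then Yf Cx q p ks (- m - 1) (mon (Poly e)) else 0.
Proof.
elim: ks m q e r => [|k ks IH] m q e r; first by move=> _; apply: Phi_emode.
case/andP => k0 hks; have {}IH m' q' e' r' := IH m' q' e' r' hks.
rewrite Phi_Ymode_cons; set f : R := mon (Poly e).
pose B := Yf Cx q p ks.
have xE i : Phi (Defs.lift (heis (- (k + i)%N%:Z)) (Ymode ks p (m + i%:Z) (q, e))) r =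
    if q + p == r then xop (k + i)%N%:Z (B (- m - 1 - i%:Z) f) else 0.
  rewrite (@Phi_lift_homog _ (fun q => hop q (- (k + i)%N%:Z)) 0); last first.
    by move=> q' e'; apply: Phi_heis.
  rewrite subr0 hopE ifT ?opprK; last by lia.
  rewrite IH; case: eqP => _; last exact: linear0.
  by have -> : - (m + i%:Z) - 1 = - m - 1 - i%:Z by lia.
have aE (i : nat) : Phi (Defs.lift (Ymode ks p (m - k%:Z - i%:Z)) (heis i%:Z (q, e))) r =
    if q + p == r then B (- m - 1 + k%:Z + i%:Z) (az q i%:Z f) else 0.
  rewrite (@Phi_lift_homog _ (fun q => Yf Cx q p ks (- (m - k%:Z - i%:Z) - 1)) p); last first.
    by move=> q' e'; apply: IH.
  rewrite Phi_heis addr0; have -> : (q == r - p) = (q + p == r) by lia.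
  case: eqP => [<-|_]; last exact: linear0.
  rewrite addrK hopE /=.
  by have -> : - (m - k%:Z - i%:Z) - 1 = - m - 1 + k%:Z + i%:Z by lia.
under eq_bigr do rewrite xE aE.
case: eqP => _; last by rewrite big1 // => i _; rewrite !scaler0 subr0.
have wf : fil (wdeg e)%:Z f by rewrite -wdegp_Poly; apply: fil_mon.
have -> : Yf Cx q p (k :: ks) (- m - 1) f = Nop q k B (- m - 1) f by [].
have Bvan j : j + (wdeg e)%:Z + (sumn ks)%:Z < 2 * p * q -> B j f = 0 by exact: Yf_van wf.
rewrite NopE; move: B xE aE Bvan => B xE aE Bvan.
case: k k0 {xE aE} => // k _; rewrite (@lsum_two_sided _ _ k (Ybound ks p m q e)).
- apply: eq_bigr => i _; rewrite !LopE.
  have -> : (0 < - i%:Z) = false by lia.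
  have -> : (0 < (k.+1 + i)%N%:Z) by lia.
  rewrite opprK.
  have -> : (k.+1 + i)%N%:Z - 1 = (k + i)%N%:Z by lia.
  rewrite (binz_nat charCx) (binz_neg charCx) /= addSn subn1 /=.
  have -> : 'C(k + i, k) = 'C(k + i, i) by rewrite -(bin_sub (leq_addl k i)) addnK.
  have -> : - m - 1 + k.+1%:Z - (k + i).+1%:Z = - m - 1 - i%:Z by lia.
  by rewrite exprS mulN1r mulNr scaleNr opprK.
- move=> i; rewrite /Ybound => hi; rewrite LopE ifF ?opprK; last by lia.
  rewrite az_gt0; last by lia.
  have i0 : 0 < i%:Z by lia.
  rewrite (aopU i0) cf_Poly nth_default ?muln0 ?scale0r ?linear0 ?scaler0 //; lia.
- move=> i hi; have -> : i.+1%:Z - 1 = i%:Z by lia.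
  by rewrite (binz_nat charCx) bin_small ?scale0r.
move=> i hi; rewrite LopE; have -> : (0 < (k.+1 + i)%N%:Z) by lia.
rewrite Bvan ?xop0 ?scaler0 //.
(* The bound in [Ymode] contains p^2 + q^2, whereas truncation is governed by - 2 p q; the
   difference is (p + q)^2. *)
have : 0 <= (p + q) * (p + q) by rewrite -expr2 sqr_ge0.
rewrite !mulrDl !mulrDr; move: hi; rewrite /Ybound /wt /=; lia.
Qed.
End ModeComponents.

Local Notation hf := (fhalf Cx).

(** * Commutation of modes and the two inclusions *)

Section DualPair.
Implicit Types (u v w : vec) (f g : R) (p q r m n j l : int) (c : {poly nat}) (e : seq nat).

(* The mode of index m of f e^{p alpha} applied to g e^{q alpha}. *)
Definition act p f m q g : R := lext (fun c => Yc Cx q p c (- m - 1) g) f.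

Lemma act0 p f m q : act p f m q 0 = 0.
Proof.
rewrite /act (eq_lext (psi := fun => 0)); last by move=> c; apply: linear0.
by rewrite /lext big1 // => c _; rewrite scaler0.
Qed.

Lemma act0l p m q g : act p 0 m q g = 0.
Proof. exact: linear0. Qed.

Lemma modes_ge1 e : all (leq 1) (modes e).
Proof.
apply/allP => -[|x] // h; exfalso; move: h.
by rewrite -has_pred1 has_count count_modes.
Qed.

Lemma Yf_modes q p e j g : Yf Cx q p (modes e) j g = Yc Cx q p (Poly e) j g.
Proof.
apply: Yf_perm; apply/allP => x _ /=; rewrite !count_modes.
by case: x => // y; rewrite -/(cf (Poly e) y) cf_Poly.
Qed.

Lemma Phi_mode_lift v m w r : Phi (mode v m w) r =
  \sum_(x <- v) x.1 *: act x.2.1 (mon (Poly x.2.2)) m (r - x.2.1) (Phi w (r - x.2.1)).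
Proof.
rewrite [LHS]Phi_flatten; apply: eq_bigr => -[x [p e]] _ /=.
rewrite Phi_scale; congr (_ *: _).
rewrite (@Phi_lift_homog _ (fun q => Yf Cx q p (modes e) (- m - 1)) p); last first.
  by move=> q e'; apply: Phi_Ymode; apply: modes_ge1.
by rewrite Yf_modes /act lext_mon.
Qed.

(** [charges v] depends on the representative and may list charges of zero component, hence the
    freedom to enlarge it. *)
Lemma Phi_mode_charges v m w r (ps : seq int) : uniq ps -> {subset charges v <= ps} ->
  Phi (mode v m w) r = \sum_(p <- ps) act p (Phi v p) m (r - p) (Phi w (r - p)).
Proof.
move=> ups vps; rewrite Phi_mode_lift.
have actE p : act p (Phi v p) m (r - p) (Phi w (r - p)) = \sum_(x <- v)
    (if x.2.1 == p then x.1 *: act p (mon (Poly x.2.2)) m (r - p) (Phi w (r - p)) else 0).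
  rewrite /act {1}/Phi linear_sum /= big_mkcond; apply: eq_bigr => x _.
  by rewrite linearZ_LR.
under [RHS]eq_bigr => p _ do rewrite actE.
rewrite exchange_big; apply: eq_big_seq => x xv /=.
have xps : x.2.1 \in ps by apply: vps; rewrite mem_undup; apply/mapP; exists x.
rewrite (bigD1_seq x.2.1) //= eqxx big1 ?addr0 // => p px.
by rewrite eq_sym (negbTE px).
Qed.

Lemma Phi_mode v m w r : Phi (mode v m w) r =
  \sum_(p <- charges v) act p (Phi v p) m (r - p) (Phi w (r - p)).
Proof. by apply: Phi_mode_charges => //; apply: undup_uniq. Qed.

Lemma Phi_mode_homog v p m w r : (forall q, q != p -> Phi v q = 0) ->
  Phi (mode v m w) r = act p (Phi v p) m (r - p) (Phi w (r - p)).
Proof.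
move=> v0; rewrite (@Phi_mode_charges v m w r (undup (p :: charges v))) ?undup_uniq //.
  rewrite (bigD1_seq p) ?undup_uniq ?mem_undup ?mem_head //= big1 ?addr0 // => q qp.
  by rewrite v0 // act0l.
by move=> q hq; rewrite mem_undup inE hq orbT.
Qed.

Lemma Phi_vacuum r : Phi vacuum r = if 0 == r then one else 0.
Proof. by rewrite Phi1 scale1r. Qed.

Lemma Phi_e_alpha r : Phi e_alpha r = if 1 == r then one else 0.
Proof. by rewrite Phi1 scale1r. Qed.

Lemma mode_creation v : veq (mode v (-1) vacuum) v.
Proof.
apply/veqP => r; rewrite Phi_mode.
have cr p f : act p f (-1) 0 one = f.
  rewrite /act (eq_lext (psi := mon)).
    by apply: (eq_linear_mon (A := lext mon) (B := idfun)) => c /=; rewrite lext_mon.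
  by move=> c; rewrite opprK subrr creation //; apply: charCx.
case: (boolP (r \in charges v)) => hr; last first.
  rewrite [RHS]Phi_charges // big_seq big1 // => p hp; rewrite Phi_vacuum.
  case: eqP => [h|_]; last by rewrite act0.
  by case/negP: hr; have -> : r = p by lia.
rewrite (bigD1_seq r) ?undup_uniq //= subrr Phi_vacuum eqxx cr big1 ?addr0 // => p pr.
by rewrite Phi_vacuum ifF ?act0 //; lia.
Qed.

Definition cvec N : vec := Psi 1 (Sop hf N%:Z one).

Lemma Phi_mode_cvec N m w r :
  Phi (mode (cvec N) m w) r = cfield Cx (r - 1) N (- m - 1) (Phi w (r - 1)).
Proof.
rewrite (@Phi_mode_homog _ 1).
  by rewrite Phi_Psi eqxx; apply: comb_cfield; apply: charCx.
by move=> q q1; rewrite Phi_Psi eq_sym (negbTE q1).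
Qed.

(** The set Z of the overview: negative powers of z carry the modes of index i >= 0. *)
Definition annihilated v := forall r N j, j < 0 -> cfield Cx r N j (Phi v r) = 0.

Definition homog_span p f := if p is Posz n then Dspan n f else f = 0.

Lemma annihilated_span v r : annihilated v -> homog_span r (Phi v r).
Proof.
move=> hv; have h := cfield_detect charCx (hv r).
case: r h => [n|n] h /=; first exact: Qop_bounded_Dspan charCx _ _ h.
(* For negative charge the degree bound already covers Q_0 = 1. *)
by rewrite -[LHS](Qop_0 hf) h.
Qed.

(** Both sides are linear in f, so it suffices to treat products of the h_k, where [Gamma_cfield]
    applies. *)
Lemma cfield_act p f m q g N n : homog_span p f ->
  cfield Cx (q + p) N n (act p f m q g) = act p f m (q + 1) (cfield Cx q N n g).
Proof.
case: p => [k|k] /= Df; last by rewrite Df !act0l linear0.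
apply: (Df (fun f => cfield Cx (q + k%:Z) N n (act k f m q g) =
                     act k f m (q + 1) (cfield Cx q N n g))).
- by rewrite !act0l linear0.
- move=> x f1 f2 E1 E2; rewrite /act !(linearP (lext _)) (linearP (cfield _ _ _ _)) /=.
  by rewrite -/(act _ _ _ _ _) E1 E2.
move=> ks <-; rewrite /act !(comb_Gamma charCx); apply: (Gamma_cfield charCx).
Qed.

Lemma cfield_mode N n u m w r : annihilated u ->
  cfield Cx r N n (Phi (mode u m w) r) =
  \sum_(p <- charges u) act p (Phi u p) m (r - p + 1) (cfield Cx (r - p) N n (Phi w (r - p))).
Proof.
move=> hu; rewrite Phi_mode linear_sum; apply: eq_bigr => p _.
by rewrite -cfield_act ?subrK //; apply: annihilated_span.
Qed.

Lemma annihilated_veq u v : veq u v -> annihilated u -> annihilated v.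
Proof. by move/veqP => uv hu r N j j0; rewrite -uv hu. Qed.

Lemma annihilated_subspace : vsubspace annihilated.
Proof.
split=> [v w hv vw||v w hv hw r N j j0|x v hv r N j j0].
- exact: annihilated_veq vw hv.
- by move=> r N j j0; rewrite Phi0 linear0.
- by rewrite Phi_add linearD hv // hw // addr0.
by rewrite Phi_scale linearZ_LR hv ?scaler0.
Qed.

Lemma cfield_one_lt0 N j : j < 0 -> cfield Cx 0 N j one = 0.
Proof.
move=> j0; rewrite -(comb_cfield charCx) (eq_lext (psi := fun => 0)).
  by rewrite /lext big1 // => c _; rewrite scaler0.
by move=> c; apply: Yf_one_lt0 => //; apply: charCx.
Qed.

Lemma annihilated_vacuum : annihilated vacuum.
Proof.
move=> r N j j0; rewrite Phi_vacuum; case: eqP => [<-|_]; last exact: linear0.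
exact: cfield_one_lt0.
Qed.

Lemma annihilated_e_alpha : annihilated e_alpha.
Proof.
move=> r N j j0; rewrite Phi_e_alpha; case: eqP => [<-|_]; last exact: linear0.
(* e^alpha is created from the vacuum by its own mode, past which c^N can be moved; c^N then
   annihilates the vacuum. *)
have <- : Gammaf Cx 0 [:: 0%N] 0 one = one.
  rewrite -(comb_Gamma charCx) /= Sop_0 lext_mon; exact: creation charCx _ _.
have := Gamma_cfield charCx [:: 0%N] 0 N 0 j one.
by rewrite add0r => ->; rewrite cfield_one_lt0 // linear0.
Qed.

Lemma W_annihilated v : W v -> annihilated v.
Proof.
apply=> [|||u w n hu hw].
- exact: annihilated_subspace.
- exact: annihilated_vacuum.
- by move=> u /veqP ue; apply: annihilated_veq annihilated_e_alpha; apply/veqP => r.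
(* For u and w in Z, c^N moves past the mode of u and annihilates w. *)
move=> r N j j0; rewrite cfield_mode // big1 // => p _.
by rewrite hw ?act0.
Qed.

Lemma cvec_commutant N : Cc (cvec N).
Proof.
move=> u /W_annihilated hu n m w; apply/veqP => r.
rewrite Phi_mode_cvec cfield_mode // Phi_mode; apply: eq_bigr => p _.
rewrite Phi_mode_cvec.
have -> : r - 1 - p + 1 = r - p by lia.
by have -> : r - p - 1 = r - 1 - p by lia.
Qed.

(** Writing v as v_(-1) applied to the vacuum, a mode of c^N of index n >= 0 moves past v_(-1) and
    annihilates the vacuum. *)
Lemma Com_Cc_annihilated v : Com Cc v -> annihilated v.
Proof.
move=> hv r N j j0; pose n := - j - 1.
have /veqP/(_ (r + 1)) := hv _ (cvec_commutant N) n (-1) vacuum.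
rewrite Phi_mode_cvec addrK.
have -> : - n - 1 = j by rewrite /n; lia.
have /veqP -> := mode_creation v; move=> ->.
rewrite Phi_mode big1 // => p _; rewrite Phi_mode_cvec.
have -> : - n - 1 = j by rewrite /n; lia.
by rewrite annihilated_vacuum ?act0.
Qed.

Lemma W_subspace : vsubspace W.
Proof.
split=> [v w Wv vw|P [_ P0 _ _] //|v w Wv Ww|c v Wv] P Ps Pv Pg Pm.
- by case: (Ps) => Pe _ _ _; apply: Pe vw; apply: Wv.
- by case: (Ps) => _ _ PD _; apply: PD; [apply: Wv | apply: Ww].
by case: (Ps) => _ _ _ PZ; apply: PZ; apply: Wv.
Qed.

Lemma W_Psi_hvec ks : W (Psi (size ks)%:Z (hvec Cx ks)).
Proof.
have [We W0 WD WZ] := W_subspace.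
refine (@hvec_generated Cx charCx (fun (n : nat) f => W (Psi n%:Z f)) _ _ _ ks).
- move=> p x f g Wf Wg; apply: We (WD _ _ (WZ x _ Wf) Wg) _; apply/veqP => r.
  by rewrite Phi_add Phi_scale !Phi_Psi; case: eqP => _; rewrite ?scaler0 ?addr0.
- apply: (We vacuum); first by move=> P Ps Pv.
  by apply/veqP => r; rewrite Phi_Psi Phi_vacuum.
move=> p f j Wf; apply: (We (mode e_alpha (- j - 1) (Psi p f))).
  move=> P Ps Pv Pg Pm; apply: (Pm); last exact: Wf.
  by apply: Pg; apply/veqP.
apply/veqP => r; rewrite (@Phi_mode_homog _ 1); last first.
  by move=> q q1; rewrite Phi_e_alpha eq_sym (negbTE q1).
rewrite Phi_e_alpha eqxx !Phi_Psi.
have -> : (p%:Z == r - 1) = (p.+1%:Z == r) by lia.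
case: eqP => [<-|_]; last exact: act0.
have -> : p.+1%:Z - 1 = p%:Z by lia.
have -> : 2 * p%:Z = 2 * 1 * p%:Z by rewrite mulr1.
rewrite /act lext_mon /Yc modesp0 /Yf /=.
by have -> : - (- j - 1) - 1 = j by lia.
Qed.

Lemma annihilated_W v : annihilated v -> W v.
Proof.
move=> hv; have [We W0 WD WZ] := W_subspace.
apply: subspace_components W_subspace _ => p.
have WP0 q : W (Psi q 0).
  by apply: We W0 _; apply/veqP => r; rewrite Phi0 Phi_Psi if_same.
have := annihilated_span p hv; move: (Phi v p) => f.
case: p => [n|n] /= Df; last by rewrite Df.
apply: (Df (fun f => W (Psi n f))) => [|x g h Wg Wh|ks <-]; first exact: WP0.
  apply: We (WD _ _ (WZ x _ Wg) Wh) _; apply/veqP => r.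
  by rewrite Phi_add Phi_scale !Phi_Psi; case: eqP => _; rewrite ?scaler0 ?addr0.
exact: W_Psi_hvec.
Qed.
End DualPair.

Theorem theorem5p1 :
  (forall v : vec, Com Cc v <-> W v) /\ (forall v : vec, Com W v <-> Cc v).
Proof.
split=> // v; split; first by move/Com_Cc_annihilated/annihilated_W.
(* Commuting is a symmetric relation, so W lies in its double commutant. *)
move=> Wv u Cu n m w k; symmetry; exact: Cu.
Qed.
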